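(* Let $K$ be a totally real field, $L/K$ a CM extension, $E$ a number field, and $M$ a regular, special realization over $K$ with coefficients in $E$, of rank $d$ and weight $w$, endowed with a polarization $M\otimes_EM\to E(-w)$. Let $\chi$ be a critical algebraic Hecke character of $L$ of weight $w(\chi)$, with $E\otimes\mathbb Q(\chi)$ a field, and assume $M\otimes RM(\chi)$ has critical values. Fix $\sigma\in J_K$ and let $\mathbf r_\sigma=(r_{\sigma,\varphi,\rho}(\chi))_{\varphi\otimes\rho}$, $\mathbf s_\sigma=(d-r_{\sigma,\varphi,\rho}(\chi))_{\varphi\otimes\rho}$. Then \[c^+_\sigma(M\otimes RM(\chi))\sim(2\pi i)^{-\lceil d/2\rceil w(\chi)}\,\delta_\sigma([\chi_0\varepsilon_L])^{\mathbf r_\sigma}\,\delta_\sigma(M)\,a^*_\sigma(\chi)\,Q_\sigma(\chi)^{\mathbf r_\sigma-\lceil d/2\rceil}\prod_{j=1}^{\mathbf s_\sigma}Q_{j,\sigma},\] where $a^*_\sigma(\chi)=1$ if $d$ is even and $a^*_\sigma(\chi)=a^\pm_\sigma(\chi)$ if $d$ is odd, with $\pm=-$ if $d^+>d^-$ and $\pm=+$ if $d^->d^+$; here $\sim$ means $\sim_{(E\otimes\mathbb Q(\chi))\otimes K,\sigma}$.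
   Context: Realizations. $J_F=\mathrm{Hom}(F,\mathbb C)$. A realization $M$ over $K$ with coefficients in $E$, pure of weight $w$ and rank $d$, consists of: for each $\sigma\in J_K$ an $E$-vector space $M_\sigma$ of dimension $d$ with a pure $\mathbb Q$-Hodge structure $M_\sigma\otimes\mathbb C=\oplus_{p+q=w}M^{pq}_\sigma$ by $E\otimes\mathbb C$-submodules and an $E$-linear involution $F_\sigma$ with $F_{\sigma,\mathbb C}=F_\sigma\otimes1$ mapping $M^{pq}_\sigma$ onto $M^{qp}_\sigma$; a free $E\otimes K$-module $M_{dR}$ of rank $d$ with a decreasing filtration $F^\bullet$; and $E\otimes\mathbb C$-isomorphisms $I_{\infty,\sigma}:M_\sigma\otimes\mathbb C\to M_{dR}\otimes_{K,\sigma}\mathbb C$ carrying $\oplus_{p'\ge p}M_\sigma^{p'q}$ onto $F^pM_{dR}\otimes_{K,\sigma}\mathbb C$, compatible with complex conjugations (plus compatible $\lambda$-adic data). Tensor products, duals, Tate twists $M(n)$, restriction of scalars are the usual ones. Via $E\otimes\mathbb C\cong\mathbb C^{J_E}$ write $M_\sigma(\varphi)$, $M^{pq}_\sigma(\varphi)$, $h^{pq}_\sigma(\varphi)=\dim M^{pq}_\sigma(\varphi)$. $M$ is regular if all $h^{pq}_\sigma(\varphi)\le1$; then $p_1(\sigma,\varphi)>\dots>p_d(\sigma,\varphi)$ are the $p$ with $h^{p,w-p}_\sigma(\varphi)=1$. $M$ is special if $F_{\sigma,\mathbb C}$ acts on $M^{w/2,w/2}_\sigma$ by a scalar $\pm1$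 independent of $\sigma$; then $M^\pm_\sigma$ are the $\pm1$-eigenspaces of $F_\sigma$, $d^\pm=\dim_EM^\pm_\sigma$, $F^\pm(M_{dR})$ are filtration steps with $M^\pm_{dR}=M_{dR}/F^\mp(M_{dR})$ free of rank $d^\pm$ and the induced map $I^\pm_{\infty,\sigma}:M^\pm_\sigma\otimes\mathbb C\to M^\pm_{dR}\otimes_{K,\sigma}\mathbb C$ an isomorphism; $c^\pm_\sigma(M)=\det I^\pm_{\infty,\sigma}$ and $\delta_\sigma(M)=\det I_{\infty,\sigma}$ (w.r.t. $E$-bases and $E\otimes K$-bases), well defined modulo $(E\otimes K)^\times$ embedded via $\sigma$. $a\sim_{F\otimes K,\sigma}b$: $b=0$ or $a/b\in(F\otimes K)^\times\subset(F\otimes\mathbb C)^\times$ via $1\otimes\sigma$. For a continuous $\epsilon:\Gamma_K\to E^\times$, the Artin motive $[\epsilon]$ has $[\epsilon]_\sigma=E$, $[\epsilon]_{dR}=(E\otimes\overline K)^{\Gamma_K}$, Hodge type $(0,0)$, $I^{-1}_{\infty,\sigma}((e\otimes\lambda)\otimes z)=e\otimes\tilde\sigma(\lambda)z$ ($\tilde\sigma$ an extension of $\sigma$); for $A=[\epsilon]$ an $A$-polarization is a nondegenerate morphism $M\otimes_EM\to A(-w)$ (polarization: $\epsilon=1$). Quadratic periods. For $M$ regular, special with $A$-polarization, fix an $E\otimes K$-basis $\zeta$ of $A_{dR}$ and, for $\sigma\in J_K$, an $E\otimes K$-basis $\omega_{1,\sigma},\dots,\omega_{d,\sigma}$ of $M_{dR}$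 such that $\omega_{1,\sigma},\dots,\omega_{d^\pm,\sigma}$ is a basis of $F^\pm(M_{dR})$ and for every $\varphi$ and $i$ the images $\omega_{1,\sigma}(\varphi),\dots,\omega_{i,\sigma}(\varphi)$ in $M_{dR}\otimes_{E\otimes K,\varphi\otimes\sigma}\mathbb C$ span $F^{p_i(\sigma,\varphi)}$. Let $\Omega_{i,\sigma}\in M_\sigma\otimes\mathbb C$ have $\varphi$-component the unique element of $M_\sigma^{p_i(\sigma,\varphi),w-p_i(\sigma,\varphi)}(\varphi)$ whose image under $I_{\infty,\sigma}$ lies in $\omega_{i,\sigma}(\varphi)+F^{p_i(\sigma,\varphi)+1}$. Define $\lambda_{i,\sigma}\in(E\otimes\mathbb C)^\times$ by $F_{\sigma,\mathbb C}(\Omega_{i,\sigma})=\lambda_{i,\sigma}\Omega_{d+1-i,\sigma}$ and $\mu_{i,\sigma}\in E\otimes K$ by $\langle\omega_{i,\sigma},\omega_{d+1-i,\sigma}\rangle_{dR}=\mu_{i,\sigma}\zeta$, and set $Q_{i,\sigma}=\lambda_{i,\sigma}\,(1\otimes\sigma)(\mu_{i,\sigma})\,\delta_\sigma(A)^{-1}$ (this is $\langle\Omega_{i,\sigma},F_{\sigma,\mathbb C}\Omega_{i,\sigma}\rangle_\sigma$). Hecke characters. $\chi$ is an algebraic Hecke character of $L$ of infinity type $(n_\tau)_{\tau\in J_L}$, weight $w(\chi)=n_\tau+n_{\overline\tau}$, $\mathbb Q(\chi)$ the field generated by its values on finite ideles; critical means $n_\tau\neq n_{\overline\tau}$ for all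 $\tau$. $\chi|_{\mathbb A_K^\times}=\chi_0\|\cdot\|^{-w(\chi)}$ with $\chi_0$ of finite order; $\varepsilon_L$ is the quadratic character of $L/K$. $M(\chi)$ is the rank-one motive over $L$ with coefficients $\mathbb Q(\chi)$ attached to $\chi$ and $RM(\chi)=R_{L/K}M(\chi)$ (rank 2, weight $w(\chi)$); for $\sigma\in J_K$, $\rho\in J_{\mathbb Q(\chi)}$ its Hodge types in $RM(\chi)_\sigma(\rho)$ are $(n(\tau,\rho),n(\overline\tau,\rho))$ and the reverse, $\tau,\overline\tau$ the extensions of $\sigma$, $n(\tau,\rho)=n_{\tilde\rho^{-1}\tau}$; write $p^\chi_1(\sigma,\rho)>p^\chi_2(\sigma,\rho)$ for them and $t_{\sigma,\rho}(\chi)=p^\chi_1-p^\chi_2$. $\Lambda^2RM(\chi)\cong[\chi_0\varepsilon_L](-w(\chi))$ gives a $[\chi_0\varepsilon_L]$-polarization of $RM(\chi)$; $Q_\sigma(\chi)$ is its quadratic period $Q_{1,\sigma}$; $a^\pm_\sigma(\chi)=c^\pm_\sigma(RM(\chi)^\vee)$. $M\otimes RM(\chi)$ (coefficients $E\otimes\mathbb Q(\chi)$) has critical values when there is an integer $n$ at which neither $L_\infty(M\otimes RM(\chi),s)$ nor $L_\infty((M\otimes RM(\chi))^\vee,1-s)$ (standard archimedean factors) has a pole; then for each $\sigma,\varphi,\rho$ there is a unique $r=r_{\sigma,\varphi,\rho}(\chi)\in\{0,\dots,d\}$ with $w-2p_r(\sigma,\varphi)<t_{\sigma,\rho}(\chi)<w-2p_{r+1}(\sigma,\varphi)$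 ($p_0=+\infty$, $p_{d+1}=-\infty$). Embeddings of the field $E\otimes\mathbb Q(\chi)$ are pairs $\varphi\otimes\rho$; for $\mathbf r=(r_{\varphi\otimes\rho})$ and $x$ in $E\otimes\mathbb Q(\chi)\otimes\mathbb C$, $x^{\mathbf r}$ and $\prod_{j=1}^{\mathbf r}Q_j$ are computed componentwise ($Q_{j,\sigma}$ viewed in $E\otimes\mathbb Q(\chi)\otimes\mathbb C$). *)

(* Defs.v *)
From HB Require Import structures.
From mathcomp Require Import all_boot all_order all_algebra all_field.
From mathcomp Require Import all_classical all_reals all_analysis.
From mathcomp.real_closed Require Import complex mxtens.

Set Implicit Arguments.
Unset Strict Implicit.
Unset Printing Implicit Defensive.

Import Order.TTheory GRing.Theory Num.Theory.
Import numFieldNormedType.Exports.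
Local Open Scope classical_set_scope.
Local Open Scope ring_scope.

(* General conventions.
   - A number field is a [fieldExtType rat]; C is [R[i]] for R : realType;
     Hom(F, C) is [emb R F].
   - E ⊗ C is read as C^(Hom(E, C)): an element of E ⊗ C is a function on
     [emb R E], a matrix over E ⊗ C is a function from [emb R E] to matrices.
   - Vectors are row vectors and linear maps act by right multiplication.
   - The E-vector spaces M_σ and the free (E ⊗ K)-module M_dR of a rank d
     realization are given in coordinates, as E^d and (E ⊗ K)^d. *)

Notation emb R F := {rmorphism F -> R[i]}.

Definition cj (R : realType) (F : pzRingType) (s : emb R F) : emb R F :=
  Num.conj \o s.

Definition two_pi_i (R : realType) : R[i] := Complex 0 (2 * pi).

(* algC, used as a model of the algebraic closure, as a Q-algebra. *)
Section AlgCAlgebra.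
Implicit Types (a b : rat) (x y : algC).
Fact algC_scaleA a b x : ratr a * (ratr b * x) = ratr (a * b) * x.
Proof. by rewrite mulrA rmorphM. Qed.
Fact algC_scale1 : left_id 1 (fun a x => ratr a * x).
Proof. by move=> x; rewrite rmorph1 mul1r. Qed.
Fact algC_scaleDr : right_distributive (fun a x => ratr a * x) +%R.
Proof. by move=> a x y; rewrite mulrDr. Qed.
Fact algC_scaleDl x : {morph (fun a => ratr a * x) : a b / a + b}.
Proof. by move=> a b; rewrite rmorphD mulrDl. Qed.
HB.instance Definition _ := GRing.Zmodule_isLmodule.Build rat algC
  algC_scaleA algC_scale1 algC_scaleDr algC_scaleDl.
Fact algC_scaleAl a x y : a *: (x * y) = (a *: x) * y.
Proof. exact: mulrA. Qed.
HB.instance Definition _ :=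
  GRing.Lmodule_isLalgebra.Build rat algC algC_scaleAl.
Fact algC_scaleAr a x y : a *: (x * y) = x * (a *: y).
Proof. exact: mulrCA. Qed.
HB.instance Definition _ :=
  GRing.Lalgebra_isAlgebra.Build rat algC algC_scaleAr.
End AlgCAlgebra.

(* The Q-algebra A ⊗ B, for a number field B: the element x stands for
   the sum of the x_k ⊗ b_k, where b is the basis [vbasis {:B}] of B over Q. *)
Definition tens (A : comAlgType rat) (B : fieldExtType rat) : Type :=
  'rV[A]_(\dim {:B}).

HB.instance Definition _ (A : comAlgType rat) (B : fieldExtType rat) :=
  GRing.Zmodule.on (tens A B).

Section TensorRing.
Variables (A : comAlgType rat) (B : fieldExtType rat).
Implicit Types (x y z : tens A B) (a : A) (b : B) (k : 'I_(\dim {:B})).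

(* The elementary tensor a ⊗ b. *)
Definition pure a b : tens A B :=
  \row_k (coord (vbasis {:B}) k b *: a).

Definition tens_mul x y : tens A B :=
  \sum_i \sum_j pure (x 0 i * y 0 j) ((vbasis {:B})`_i * (vbasis {:B})`_j).

Fact pureDl b : {morph pure^~ b : a c / a + c}.
Proof. by move=> a c; apply/rowP=> k; rewrite !mxE scalerDr. Qed.
Fact pureDr a : {morph pure a : b c / b + c}.
Proof. by move=> b c; apply/rowP=> k; rewrite !mxE linearD scalerDl. Qed.
Fact pure0l b : pure 0 b = 0.
Proof. by apply/rowP=> k; rewrite !mxE scaler0. Qed.
Fact pure0r a : pure a 0 = 0.
Proof. by apply/rowP=> k; rewrite !mxE linear0 scale0r. Qed.
Fact pure_suml (I : Type) (r : seq I) (P : pred I) (F : I -> A) b :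
  pure (\sum_(i <- r | P i) F i) b = \sum_(i <- r | P i) pure (F i) b.
Proof. exact: (big_morph _ (pureDl b) (pure0l b)). Qed.
Fact pure_sumr (I : Type) (r : seq I) (P : pred I) (F : I -> B) a :
  pure a (\sum_(i <- r | P i) F i) = \sum_(i <- r | P i) pure a (F i).
Proof. exact: (big_morph _ (pureDr a) (pure0r a)). Qed.
Fact pureZ (c : rat) a b : pure (c *: a) b = pure a (c *: b).
Proof.
by apply/rowP=> k; rewrite !mxE [in RHS]linearZ /= !scalerA mulrC.
Qed.

Fact pure_coord x : x = \sum_k pure (x 0 k) (vbasis {:B})`_k.
Proof.
apply/rowP=> k; rewrite summxE (bigD1 k) //= big1 ?addr0 => [|j jk].
  by rewrite mxE coord_free ?(basis_free (vbasisP _)) // eqxx scale1r.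
rewrite mxE coord_free ?(basis_free (vbasisP _)) // (_ : (j == k) = false).
  by rewrite scale0r.
exact: negPf.
Qed.

Fact pureM a a' b b' :
  tens_mul (pure a b) (pure a' b') = pure (a * a') (b * b').
Proof.
rewrite [in RHS](coord_vbasis (memvf b)) [in RHS](coord_vbasis (memvf b')).
rewrite mulr_suml pure_sumr; apply: eq_bigr => i _.
rewrite mulr_sumr pure_sumr; apply: eq_bigr => j _.
rewrite !mxE; set c := coord _ i b; set c' := coord _ j b'.
rewrite -[c *: a * _]scalerAl -[a * (c' *: _)]scalerAr.
by rewrite -[c *: _ * _ in RHS]scalerAl -[_ * (c' *: _) in RHS]scalerAr
  !pureZ !scalerA (mulrC c').
Qed.

Fact tens_mulDl : left_distributive tens_mul +%R.
Proof.
move=> x y z; rewrite /tens_mul -big_split; apply: eq_bigr => i _ /=.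
rewrite -big_split; apply: eq_bigr => j _ /=.
by rewrite mxE mulrDl pureDl.
Qed.
Fact tens_mulC : commutative tens_mul.
Proof.
move=> x y; rewrite /tens_mul exchange_big; apply: eq_bigr => i _ /=.
by apply: eq_bigr => j _; rewrite mulrC [(_)`_i * _]mulrC.
Qed.
Fact tens_mulDr : right_distributive tens_mul +%R.
Proof. by move=> x y z; rewrite !(tens_mulC x) tens_mulDl. Qed.
Fact tens_mul0l x : tens_mul 0 x = 0.
Proof.
by apply: (addrI (tens_mul 0 x)); rewrite -tens_mulDl !addr0.
Qed.
Fact tens_mul_suml (I : Type) (r : seq I) (F : I -> tens A B) y :
  tens_mul (\sum_(i <- r) F i) y = \sum_(i <- r) tens_mul (F i) y.
Proof.
by elim/big_rec2: _ => [|i u v _ <-]; rewrite ?tens_mul0l ?tens_mulDl.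
Qed.
Fact tens_mul_sumr (I : Type) (r : seq I) (F : I -> tens A B) y :
  tens_mul y (\sum_(i <- r) F i) = \sum_(i <- r) tens_mul y (F i).
Proof.
by rewrite tens_mulC tens_mul_suml; apply: eq_bigr => i _; rewrite tens_mulC.
Qed.
Fact tens_mulA : associative tens_mul.
Proof.
move=> x y z; rewrite (pure_coord z) !tens_mul_sumr; apply: eq_bigr => k _.
rewrite (pure_coord y) tens_mul_suml !tens_mul_sumr tens_mul_suml.
apply: eq_bigr => j _; rewrite (pure_coord x) !tens_mul_suml.
by apply: eq_bigr => i _; rewrite !pureM !mulrA.
Qed.
Fact tens_mul1 : left_id (pure 1 1) tens_mul.
Proof.
move=> x; rewrite {1}(pure_coord x) tens_mul_sumr [RHS](pure_coord x).
by apply: eq_bigr => k _; rewrite pureM !mul1r.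
Qed.
Fact tens_nonzero : pure 1 1 != 0 :> tens A B.
Proof.
apply/eqP => /rowP h.
have: coord (vbasis {:B}) ^~ (1 : B) =1 (fun=> 0).
  move=> k; apply/eqP; have /eqP := h k; rewrite !mxE.
  by rewrite scaler_eq0 oner_eq0 orbF.
move=> h0; have := coord_vbasis (memvf (1 : B)).
rewrite big1 => [/eqP|k _]; first by rewrite oner_eq0.
by rewrite h0 scale0r.
Qed.

HB.instance Definition _ := GRing.Zmodule_isComNzRing.Build (tens A B)
  tens_mulA tens_mulC tens_mul1 tens_mulDl tens_nonzero.

(* For ring morphisms f and g this is the map f ⊗ g : A ⊗ B -> S,
   a ⊗ b |-> f a * g b. *)
Definition tens_map (S : comNzRingType) (f : A -> S) (g : B -> S) x : S :=
  \sum_k f (x 0 k) * g (vbasis {:B})`_k.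

End TensorRing.

Section Embeddings.
Variables (R : realType) (E K : fieldExtType rat).

(* The map φ ⊗ σ : E ⊗ K -> C, i.e. the φ-component of
   1 ⊗ σ : E ⊗ K -> E ⊗ C. *)
Definition ev (phi : emb R E) (sigma : emb R K) : tens E K -> R[i] :=
  tens_map phi sigma.

(* a ~ b in the sense of the relation ~_(E ⊗ K, σ). *)
Definition sim (sigma : emb R K) (a b : emb R E -> R[i]) : Prop :=
  (forall phi, b phi = 0) \/
  exists u u' : tens E K, u * u' = 1 /\
    forall phi, b phi != 0 /\ a phi / b phi = ev phi sigma u.
End Embeddings.

Definition span (S : pzRingType) d (U : set 'rV[S]_d) : set 'rV[S]_d :=
  [set x | exists n (c : 'rV[S]_n) (v : 'M[S]_(n, d)),
     (forall i, U (row i v)) /\ x = c *m v].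

Definition sdim (S : fieldType) d (U : set 'rV[S]_d) : nat :=
  \max_(n < d.+1 | `[< exists v : 'M[S]_(n, d),
                         row_free v /\ forall i, U (row i v) >]) n.

(* The Hodge and de Rham part of a realization over K with coefficients in E
   and rank d. For a general number field K the involutions form a system of
   maps F_σ : M_σ -> M_(cσ), c being complex conjugation; for totally real K
   one has cσ = σ. As q = w - p, [hodge] is indexed by p only. *)
Record hodge_dR (R : realType) (K E : fieldExtType rat) (d : nat) := HodgeDR {
  frob : emb R K -> 'M[E]_d;
  hodge : emb R K -> emb R E -> int -> set 'rV[R[i]]_d;
  fil : int -> set 'rV[tens E K]_d;
  cmp : emb R K -> emb R E -> 'M[R[i]]_d }.

Section HodgeDeRham.
Variables (R : realType) (K E : fieldExtType rat).
Implicit Types (sigma : emb R K) (phi : emb R E).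

(* The φ-component of F^p M_dR ⊗_(K,σ) C. *)
Definition filC d (M : hodge_dR R K E d) sigma phi p : set 'rV[R[i]]_d :=
  span [set map_mx (ev phi sigma) x | x in fil M p].

Definition hodge_number d (M : hodge_dR R K E d) sigma phi p : nat :=
  sdim (hodge M sigma phi p).

Definition is_hodge_dR d (M : hodge_dR R K E d) (w : int) : Prop :=
  [/\ (* the M_σ^(p, w - p)(φ) decompose M_σ(φ) *)
      forall sigma phi,
        (forall p, hodge M sigma phi p = span (hodge M sigma phi p)) /\
        exists s : seq int,
        [/\ uniq s,
            forall p, p \notin s -> hodge M sigma phi p = [set 0],
            forall x, exists y : int -> 'rV_d,
              (forall p, hodge M sigma phi p (y p)) /\ x = \sum_(p <- s) y p
          & forall y : int -> 'rV_d, (forall p, hodge M sigma phi p (y p)) ->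
              \sum_(p <- s) y p = 0 -> forall p, p \in s -> y p = 0],
      (* purity: complex conjugation on M_σ ⊗ C exchanges M^pq and M^qp, and
         the φ- and cφ-components *)
      forall sigma phi p x, hodge M sigma phi p x <->
        hodge M sigma (cj phi) (w - p) (map_mx Num.conj x),
      forall sigma, frob M sigma *m frob M (cj sigma) = 1%:M /\
        forall phi p x, hodge M sigma phi p x <->
          hodge M (cj sigma) phi (w - p) (x *m map_mx phi (frob M sigma)),
      (forall p, fil M p = span (fil M p)) /\
        forall p p', p <= p' -> fil M p' `<=` fil M p
    & forall sigma phi,
        [/\ cmp M sigma phi \in unitmx,
            (* comparison of the Hodge decomposition and the filtration *)
            forall p, [set x *m cmp M sigma phi | x in
                span [set x | exists2 p', p <= p' & hodge M sigma phi p' x]]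
              = filC M sigma phi p
          & (* F_σ ⊗ c corresponds to 1 ⊗ c *)
            map_mx Num.conj (cmp M sigma phi) =
              map_mx (cj phi) (frob M sigma) *m cmp M (cj sigma) (cj phi)]].

Definition regular d (M : hodge_dR R K E d) : Prop :=
  forall sigma phi p, (hodge_number M sigma phi p <= 1)%N.

Definition special d (M : hodge_dR R K E d) (w : int) : Prop :=
  exists e : bool, forall sigma phi p x, p + p = w -> hodge M sigma phi p x ->
    x *m map_mx phi (frob M sigma) = (-1) ^+ e *: x.

(* p 0 > p 1 > ... are the p with h^(p, w - p)_σ(φ) = 1. *)
Definition hodge_types d (M : hodge_dR R K E d) sigma phi (p : 'I_d -> int) :=
  (forall i k : 'I_d, (i < k)%N -> p k < p i) /\
  forall q, hodge_number M sigma phi q = 1%N <-> exists i, p i = q.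

(* Signs are booleans: false is +, true is -. *)
Definition Mpm d (M : hodge_dR R K E d) sigma (b : bool) : 'M[E]_d :=
  eigenspace (frob M sigma) ((-1) ^+ b).

Definition dpm d (M : hodge_dR R K E d) sigma (b : bool) : nat :=
  \rank (Mpm M sigma b).

(* F^m M_dR is the filtration step F^∓(M_dR) for the sign ± = b, and c is the
   determinant of I^±_σ with respect to the basis B of M^±_σ and the basis of
   M_dR / F^m M_dR given by the coordinate projection P. *)
Definition period_wrt d (M : hodge_dR R K E d) sigma b (m : int)
    (c : emb R E -> R[i]) : Prop :=
  exists (B : 'M[E]_(dpm M sigma b, d)) (P : 'M[tens E K]_(d, dpm M sigma b)),
    [/\ (B :=: Mpm M sigma b)%MS,
        forall y : 'rV_(dpm M sigma b), exists x, y = x *m P,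
        forall x, fil M m x <-> x *m P = 0
      & forall phi,
          c phi = \det (map_mx phi B *m cmp M sigma phi
                          *m map_mx (ev phi sigma) P) /\ c phi != 0].

(* c is a value of c^±_σ(M), ± = b, for some choice of bases. *)
Definition period d (M : hodge_dR R K E d) sigma b c : Prop :=
  exists m, period_wrt M sigma b m c.

(* F^m M_dR is F^±(M_dR), ± = b. *)
Definition is_Fpm d (M : hodge_dR R K E d) sigma b (m : int) : Prop :=
  exists c, period_wrt M sigma (~~ b) m c.

Definition delta d (M : hodge_dR R K E d) sigma (phi : emb R E) : R[i] :=
  \det (cmp M sigma phi).

(* Q(1) has Betti lattice 2πi Q, de Rham lattice Q and F = -1. *)
Definition twist d (M : hodge_dR R K E d) (n : int) : hodge_dR R K E d :=
  {| frob := fun sigma => (-1) ^ n *: frob M sigma;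
     hodge := fun sigma phi p => hodge M sigma phi (p + n);
     fil := fun p => fil M (p + n);
     cmp := fun sigma phi => two_pi_i R ^ n *: cmp M sigma phi |}.

(* A linear form is given by its values on the standard basis. *)
Definition dual d (M : hodge_dR R K E d) : hodge_dR R K E d :=
  {| frob := fun sigma => (invmx (frob M sigma))^T;
     hodge := fun sigma phi p =>
       [set f | forall p' x, p' != - p -> hodge M sigma phi p' x ->
                  x *m f^T = 0];
     fil := fun p => [set f | forall x, fil M (1 - p) x -> x *m f^T = 0];
     cmp := fun sigma phi => (invmx (cmp M sigma phi))^T |}.

(* M ⊗_E M', in the Kronecker basis. *)
Definition tensor d d' (M : hodge_dR R K E d) (M' : hodge_dR R K E d') :
    hodge_dR R K E (d * d') :=
  {| frob := fun sigma => frob M sigma *t frob M' sigma;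
     hodge := fun sigma phi n =>
       span [set z | exists p p' x x', [/\ p + p' = n, hodge M sigma phi p x,
         hodge M' sigma phi p' x' & z = (x *t x' : 'rV_(d * d'))]];
     fil := fun n =>
       span [set z | exists p p' x x', [/\ p + p' = n, fil M p x,
         fil M' p' x' & z = (x *t x' : 'rV_(d * d'))]];
     cmp := fun sigma phi => cmp M sigma phi *t cmp M' sigma phi |}.

Definition morphism d d' (M : hodge_dR R K E d) (M' : hodge_dR R K E d')
    (f : emb R K -> 'M[E]_(d, d')) (g : 'M[tens E K]_(d, d')) : Prop :=
  [/\ forall sigma,
        frob M sigma *m f (cj sigma) = f sigma *m frob M' sigma,
      forall sigma phi p x, hodge M sigma phi p x ->
        hodge M' sigma phi p (x *m map_mx phi (f sigma)),
      forall p x, fil M p x -> fil M' p (x *m g)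
    & forall sigma phi, map_mx phi (f sigma) *m cmp M' sigma phi =
        cmp M sigma phi *m map_mx (ev phi sigma) g].

Definition pairing (S : pzRingType) d (g : 'M[S]_(d * d, 1)) (x y : 'rV[S]_d) :
    'rV[S]_1 :=
  (x *t y : 'rV_(d * d)) *m g.

(* An A-polarization M ⊗_E M -> A(-w). *)
Definition polarization d (M : hodge_dR R K E d) (w : int)
    (A : hodge_dR R K E 1) (f : emb R K -> 'M[E]_(d * d, 1))
    (g : 'M[tens E K]_(d * d, 1)) : Prop :=
  [/\ morphism (tensor M M) (twist A (- w)) f g,
      forall sigma x, (forall y, pairing (f sigma) x y = 0) -> x = 0
    & forall x, (forall y, pairing g x y = 0) -> x = 0].

(* For M of rank 2, such a polarization is the same thing as an isomorphism
   Λ²M -> A(-w). *)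
Definition alternating_polarization d (M : hodge_dR R K E d) (w : int)
    (A : hodge_dR R K E 1) f g : Prop :=
  [/\ polarization M w A f g,
      forall sigma x, pairing (f sigma) x x = 0
    & forall x, pairing g x x = 0].

(* The quadratic periods Q_(i,σ) of M with respect to the A-polarization whose
   de Rham part is g; p i is p_(i,σ), rows of omega are the ω_(i,σ), and ζ is
   the standard basis of A_dR. Indices start at 0, so that d + 1 - i becomes
   [rev_ord i]. *)
Definition quadratic_periods d (M : hodge_dR R K E d) (A : hodge_dR R K E 1)
    (g : 'M[tens E K]_(d * d, 1)) (sigma : emb R K)
    (p : emb R E -> 'I_d -> int) (Q : 'I_d -> emb R E -> R[i]) : Prop :=
  exists (omega : 'M[tens E K]_d) (Omega : 'I_d -> emb R E -> 'rV[R[i]]_d)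
         (lambda : 'I_d -> emb R E -> R[i]),
  [/\ exists omega', omega *m omega' = 1%:M /\ omega' *m omega = 1%:M,
      forall b, exists2 m, is_Fpm M sigma b m &
        forall x, fil M m x <-> exists c : 'rV_d,
          (forall i : 'I_d, (dpm M sigma b <= i)%N -> c 0 i = 0) /\
          x = c *m omega,
      forall phi (i : 'I_d),
        span [set map_mx (ev phi sigma) (row k omega) | k in
                [set k : 'I_d | (k <= i)%N]] = filC M sigma phi (p phi i),
      forall phi i,
        [/\ hodge M sigma phi (p phi i) (Omega i phi),
            filC M sigma phi (p phi i + 1)
              (Omega i phi *m cmp M sigma phi -
               map_mx (ev phi sigma) (row i omega))
          & Omega i phi *m map_mx phi (frob M sigma) =
              lambda i phi *: Omega (rev_ord i) phi]
    & forall i phi, Q i phi =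
        lambda i phi *
        ev phi sigma (pairing g (row i omega) (row (rev_ord i) omega) 0 0) /
        delta A sigma phi].

End HodgeDeRham.

(* M ⊗_E F, for i : E -> F. *)
Definition ext_coeff (R : realType) (K E F : fieldExtType rat)
    (i : {rmorphism E -> F}) d (M : hodge_dR R K E d) : hodge_dR R K F d :=
  {| frob := fun sigma => map_mx i (frob M sigma);
     hodge := fun sigma psi p => hodge M sigma (psi \o i) p;
     fil := fun p => span
       [set map_mx (tens_map (fun e => pure (i e) 1) (pure (1 : F))) x
          | x in fil M p];
     cmp := fun sigma psi => cmp M sigma (psi \o i) |}.

(* N' is isomorphic to R_(L/K) N: N'_σ is the direct sum of the N_τ with
   τ o j = σ, N'_dR is N_dR viewed as an (E ⊗ K)-module, and
   N_dR ⊗_(K,σ) C is the direct sum of the N_dR ⊗_(L,τ) C with τ o j = σ. *)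
Definition is_restriction (R : realType) (K L E : fieldExtType rat)
    (j : {rmorphism K -> L}) d d' (N : hodge_dR R L E d)
    (N' : hodge_dR R K E d') : Prop :=
  exists (a : emb R L -> 'M[E]_(d', d)) (b : 'M[tens E L]_(d', d)),
  let over (tau : emb R L) (sigma : emb R K) :=
    forall x, tau (j x) = sigma x in
  let bmap (x : 'rV[tens E K]_d') : 'rV[tens E L]_d :=
    map_mx (tens_map (fun e => pure e 1) (fun y => pure 1 (j y))) x *m b in
  [/\ forall sigma (y : emb R L -> 'rV[E]_d), exists! x : 'rV[E]_d',
        forall tau, over tau sigma -> x *m a tau = y tau,
      bijective bmap,
      forall tau sigma, over tau sigma ->
        frob N' sigma *m a (cj tau) = a tau *m frob N tau,
      (forall sigma phi p x, hodge N' sigma phi p x <->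
         forall tau, over tau sigma ->
           hodge N tau phi p (x *m map_mx phi (a tau))) /\
      (forall p x, fil N' p x <-> fil N p (bmap x))
    & forall tau sigma phi, over tau sigma ->
        cmp N' sigma phi *m map_mx (ev phi tau) b =
        map_mx phi (a tau) *m cmp N tau phi].

Section ArchimedeanFactors.
Variable R : realType.

(* Gauss's product for 1/Γ, which is entire. *)
Definition inv_Gamma (s : R) : R :=
  lim ((fun m : nat => (\prod_(k < m.+1) (s + k%:R)) /
                       ((m`!)%:R * m%:R `^ s)) @ \oo).

Definition inv_GammaR (s : R) : R := pi `^ (s / 2) * inv_Gamma (s / 2).
Definition inv_GammaC (s : R) : R := (2 * pi) `^ s / 2 * inv_Gamma s.

(* L_∞(M, s) is the product, over σ, of Γ_C(s - p) for every Hodge type (p, q)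
   with p < q, and of Γ_R(s - p + e), e in {0, 1}, for every Hodge type (p, p)
   on which F_σ acts by (-1)^(p + e). Since no Γ-factor has a zero, L_∞ has a
   pole exactly where one of the factors has one. *)
Definition Linf_pole (K E : fieldExtType rat) d (M : hodge_dR R K E d)
    (w s : int) : Prop :=
  exists sigma phi p x, [/\ x != 0, hodge M sigma phi p x &
    (p < w - p /\ inv_GammaC (s - p)%:~R = 0) \/
    (p = w - p /\ exists e : bool,
       x *m map_mx phi (frob M sigma) = (-1) ^ (p + e%:Z) *: x /\
       inv_GammaR (s - p + e%:Z)%:~R = 0)].

Definition has_critical_values (K E : fieldExtType rat) d
    (M : hodge_dR R K E d) (w : int) : Prop :=
  exists n : int, ~ Linf_pole M w n /\ ~ Linf_pole (dual M) (- w) (1 - n).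

End ArchimedeanFactors.

(* Normalized discrete valuations, with the convention ord 0 = 0. *)
Definition is_valuation (F : fieldType) (v : F -> int) : Prop :=
  [/\ v 0 = 0,
      forall x y, x != 0 -> y != 0 -> v (x * y) = v x + v y,
      forall x y, x != 0 -> y != 0 -> x + y != 0 ->
        Num.min (v x) (v y) <= v (x + y)
    & exists x, v x = 1].

(* The finite places of a number field. *)
Record place (F : fieldType) := Place {
  ord : F -> int;
  ordP : is_valuation ord }.

Definition close (F : fieldType) (v : F -> int) (B : int) (x y : F) : Prop :=
  x = y \/ B <= v (x - y).

Record completion (F : fieldType) (v : place F) := Completion {
  cfield :> fieldType;
  cemb : {rmorphism F -> cfield};
  cord : cfield -> int;
  cordP : is_valuation cord;
  cord_emb : forall x, cord (cemb x) = ord v x;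
  c_dense : forall B x, exists a, close cord B x (cemb a);
  c_complete : forall u : nat -> cfield,
    (forall B, exists N, forall m n, (N <= m)%N -> (N <= n)%N ->
       close cord B (u m) (u n)) ->
    exists l, forall B, exists N, forall n, (N <= n)%N -> close cord B (u n) l }.

Definition completions (F : fieldType) := forall v : place F, completion v.

(* q is the cardinality of the residue field of v. *)
Definition residue_card (F : fieldType) (v : place F) (q : nat) : Prop :=
  exists s : seq F,
  [/\ size s = q, uniq s, forall x, x \in s -> 0 <= ord v x
    & forall x, 0 <= ord v x -> exists! y, y \in s /\ close (ord v) 1 x y].

Definition lies_over (K L : fieldType) (j : {rmorphism K -> L})
    (w : place L) (v : place K) : Prop :=
  forall x, 0 < ord v x -> 0 < ord w (j x).

(* Q̄ is algC; Γ_K is the group of automorphisms of algC fixing kappa(K). *)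
Notation aut_alg := {rmorphism algC -> algC}.

Section Galois.
Variables (K : fieldExtType rat) (kappa : {rmorphism K -> algC}).
Implicit Types (v : place K) (gamma : aut_alg) (P : set algC).

Definition gal gamma : Prop := forall x, gamma (kappa x) = kappa x.

(* P is a prime ideal, above v, of the ring of algebraic integers. *)
Definition prime_over v P : Prop :=
  [/\ (forall x, P x -> x \in Aint) /\ ~ P 1,
      forall x y, P x -> P y -> P (x + y),
      forall x y, x \in Aint -> P y -> P (x * y),
      forall x y, x \in Aint -> y \in Aint -> P (x * y) -> P x \/ P y
    & forall a, kappa a \in Aint -> (P (kappa a) <-> a = 0 \/ 0 < ord v a)].

Definition geom_frobenius v gamma : Prop :=
  gal gamma /\ exists P q, [/\ prime_over v P, residue_card v q
    & forall x, x \in Aint -> P (x - gamma x ^+ q)].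

Definition inertia v gamma : Prop :=
  gal gamma /\ exists2 P, prime_over v P &
    forall x, x \in Aint -> P (gamma x - x).

(* A continuous character ε : Γ_K -> E^*. *)
Definition galois_character (E : fieldType) (epsilon : aut_alg -> E) : Prop :=
  [/\ forall gamma, gal gamma -> epsilon gamma != 0,
      forall gamma gamma', gal gamma -> gal gamma' ->
        epsilon (gamma \o gamma') = epsilon gamma * epsilon gamma'
    & exists S : seq algC, forall gamma, gal gamma ->
        (forall x, x \in S -> gamma x = x) -> epsilon gamma = 1].

Variables (R : realType) (E : fieldExtType rat).

(* (E ⊗ Q̄)^(Γ_K), for the action e ⊗ l |-> ε(γ)e ⊗ γ(l). *)
Definition artin_invariant (epsilon : aut_alg -> E) (x : tens algC E) : Prop :=
  forall gamma, gal gamma ->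
    pure 1 (epsilon gamma) *
    tens_map (fun l => pure (gamma l) 1) (pure (1 : algC)) x = x.

(* A is the Artin motive [ε], in the basis 1 of A_σ = E and some basis ζ of
   the (E ⊗ K)-module A_dR; [ext] chooses the extensions to Q̄ of the
   embeddings of K. F_σ : A_σ -> A_(cσ) is the action of complex conjugation. *)
Definition is_artin (epsilon : aut_alg -> E) (A : hodge_dR R K E 1) : Prop :=
  exists (zeta : tens algC E) (ext : emb R K -> emb R algC),
  [/\ artin_invariant epsilon zeta /\
      (forall x, artin_invariant epsilon x -> exists! t : tens E K,
         x = tens_map (pure (1 : algC)) (fun a => pure (kappa a) 1) t * zeta),
      forall sigma x, ext sigma (kappa x) = sigma x,
      forall sigma phi,
        cmp A sigma phi = ((tens_map (ext sigma) phi zeta)^-1)%:M,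
      forall sigma gamma, gal gamma ->
        (forall x, (ext sigma x)^* = ext (cj sigma) (gamma x)) ->
        frob A sigma = (epsilon gamma)%:M
    & (forall sigma phi p,
         hodge A sigma phi p = if p == 0 then setT else [set 0]) /\
      (forall p, fil A p = if p <= 0 then setT else [set 0])].

End Galois.

(* A realization: [rep] is the Galois action on M_λ = E_λ^d, and [lcmp] is the
   comparison isomorphism M_σ ⊗ E_λ -> M_λ attached to an embedding of Q̄
   into C extending σ. *)
Record realization (R : realType) (K E : fieldExtType rat)
    (Ehat : completions E) (d : nat) := Realization {
  hdr :> hodge_dR R K E d;
  rep : forall l : place E, aut_alg -> 'M[Ehat l]_d;
  lcmp : forall l : place E, emb R algC -> 'M[Ehat l]_d }.

Definition is_realization (R : realType) (K E : fieldExtType rat)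
    (Ehat : completions E) d (kappa : {rmorphism K -> algC})
    (M : realization R K Ehat d) (w : int) : Prop :=
  [/\ is_hodge_dR M w,
      forall l,
        [/\ rep M l idfun = 1%:M,
            forall gamma gamma', gal kappa gamma -> gal kappa gamma' ->
              rep M l (gamma \o gamma') = rep M l gamma' *m rep M l gamma
          & forall B : int, exists S : seq algC,
              forall gamma, gal kappa gamma ->
              (forall x, x \in S -> gamma x = x) ->
              forall i k, close (@cord _ _ (Ehat l)) B
                            (rep M l gamma i k) ((i == k)%:R)],
      (* strict compatibility *)
      exists S : set (place K), finite_set S /\
        forall v, ~ S v -> exists P : {poly E},
        forall (l : place E) q, residue_card v q -> ord l q%:R = 0 ->
          (forall gamma, inertia kappa v gamma -> rep M l gamma = 1%:M) /\
          (forall gamma, geom_frobenius kappa v gamma ->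
             char_poly (rep M l gamma) = map_poly (cemb (Ehat l)) P)
    & forall l (s : emb R algC),
        [/\ lcmp M l s \in unitmx,
            forall gamma, gal kappa gamma ->
              lcmp M l (s \o gamma) *m rep M l gamma = lcmp M l s
          & map_mx (cemb (Ehat l)) (frob M (s \o kappa)) *m lcmp M l (cj s)
              = lcmp M l s]].

Section Hecke.
Variables (R : realType) (L : fieldExtType rat) (Lhat : completions L).

Definition idele_family := forall v : place L, Lhat v.

(* The finite ideles of L. *)
Definition is_idele (x : idele_family) : Prop :=
  (forall v, x v != 0) /\ finite_set [set v | cord (x v) != 0].

(* For a place v of K and a in K^*: the image in the ideles of L of the idele
   of K which is a at v and 1 elsewhere. *)
Definition local_idele (K : fieldExtType rat) (j : {rmorphism K -> L})
    (v : place K) (a : K) : idele_family :=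
  fun w => if `[< lies_over j w v >] then cemb (Lhat w) (j a) else 1.

(* chi is the restriction to the finite ideles of an algebraic Hecke character
   of L of infinity type n, for L without real places. The component at
   infinity is x |-> prod_τ τ(x)^(- n_τ), so that triviality on L^* is the last
   clause; continuity on the finite ideles amounts to an open kernel. *)
Definition is_hecke (chi : idele_family -> R[i]) (n : emb R L -> int) : Prop :=
  [/\ forall x, is_idele x -> chi x != 0,
      forall x y, is_idele x -> is_idele y ->
        chi (fun v => x v * y v) = chi x * chi y,
      exists2 e : place L -> nat, finite_set [set v | e v != 0%N] &
        forall x, is_idele x ->
          (forall v, cord (x v) = 0 /\
             (e v != 0%N -> close (@cord _ _ (Lhat v)) (e v)%:Z (x v) 1)) ->
          chi x = 1
    & forall a, a != 0 -> forall t : 'I_(\dim {:L}) -> emb R L, bijective t ->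
        chi (fun v => cemb (Lhat v) a) = \prod_i t i a ^ n (t i)].

Variables (Q : fieldExtType rat) (iota : emb R Q).

(* iota identifies Q with the subfield of C generated by the values of chi. *)
Definition is_value_field (chi : idele_family -> R[i]) : Prop :=
  (forall x, is_idele x -> exists y, iota y = chi x) /\
  forall U : {subfield Q},
    (forall x y, is_idele x -> iota y = chi x -> y \in U) -> U = {:Q}%VS :> {vspace Q}.

(* k = n(τ, ρ), i.e. k = n_(ρ~^-1 τ) where ρ~ extends ρ. *)
Definition twisted_type (n : emb R L -> int) (tau : emb R L) (rho : emb R Q)
    (k : int) : Prop :=
  exists (g : {rmorphism R[i] -> R[i]}) (tau' : emb R L),
    [/\ bijective g, forall y, g (iota y) = rho y,
        forall x, g (tau' x) = tau x & k = n tau'].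

(* N is the realization of M(χ): it is of rank one, its Hodge types are given
   by the infinity type of χ, and the geometric Frobenius at v acts on N_λ by
   the value of χ at a uniformizer, for almost all v. *)
Definition is_hecke_motive (Qhat : completions Q)
    (kappa : {rmorphism L -> algC}) (chi : idele_family -> R[i])
    (n : emb R L -> int) (wchi : int) (N : realization R L Qhat 1) : Prop :=
  [/\ is_realization kappa N wchi,
      forall tau rho, exists2 k, twisted_type n tau rho k &
        forall p, hodge N tau rho p = if p == k then setT else [set 0]
    & exists S : set (place L), finite_set S /\
        forall v, ~ S v -> forall (l : place Q) q a gamma,
          residue_card v q -> ord l q%:R = 0 -> ord v a = 1 ->
          geom_frobenius kappa v gamma ->
          exists2 y, iota y = chi (local_idele idfun v a) &
            rep N l gamma = (cemb (Qhat l) y)%:M].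

(* chi0, a character of Γ_K, corresponds by class field theory (uniformizers
   being sent to geometric Frobenius elements) to χ_0, the finite order
   character with χ = χ_0 |.|^(-w) on the ideles of K; the norm of a
   uniformizer is the inverse of the cardinality of the residue field. *)
Definition is_chi_0 (K : fieldExtType rat) (j : {rmorphism K -> L})
    (kappa : {rmorphism K -> algC}) (chi : idele_family -> R[i]) (wchi : int)
    (chi0 : aut_alg -> Q) : Prop :=
  galois_character kappa chi0 /\
  exists S : set (place K), finite_set S /\
    forall v, ~ S v -> forall q a gamma,
      residue_card v q -> ord v a = 1 -> geom_frobenius kappa v gamma ->
      iota (chi0 gamma) = chi (local_idele j v a) * (q%:R^-1) ^ wchi.

(* The quadratic character of L/K, on Γ_K. *)
Definition quadratic_character (kappa : {rmorphism L -> algC})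
    (gamma : aut_alg) : Q :=
  if `[< gal kappa gamma >] then 1 else -1.

End Hecke.

Definition totally_real (R : realType) (K : fieldExtType rat) : Prop :=
  forall (sigma : emb R K) x, (sigma x)^* = sigma x.

(* L is a totally imaginary quadratic extension of K. *)
Definition CM_over (R : realType) (K L : fieldExtType rat)
    (j : {rmorphism K -> L}) : Prop :=
  \dim {:L} = (2 * \dim {:K})%N /\
  forall tau : emb R L, exists x, (tau x)^* != tau x.

(* w - 2 p_r < t < w - 2 p_(r+1), with p_0 = +∞ and p_(d+1) = -∞; here p has
   indices starting at 0. *)
Definition is_r d (w : int) (p : 'I_d -> int) (t : int) (r : nat) : Prop :=
  (r <= d)%N /\ forall i : 'I_d,
    (i.+1 = r -> w - 2 * p i < t) /\ (i = r :> nat -> t < w - 2 * p i).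

(* Main.v *)
(* Let psi be an embedding of F, with restrictions phi to E and rho to Q(chi),
   and let r be the integer attached to it. If g in Q(chi)^2 and its image gF'
   under Frobenius form a basis of RM(chi)_sigma, then x |-> x ⊗ g + Fx ⊗ gF'
   identifies M_sigma with the +1-eigenspace of Frobenius on M ⊗ RM(chi), so that
   c^+ is a determinant of size d. The step of the filtration that occurs in c^+
   is the middle one, and in the basis of the Omega_i the determinant is that of
   a + b F times l^r, the product of the lambda_i for i <= r, and D_r(psi), the
   determinant of the classes of d de Rham basis vectors. Here l = lambda_1(chi)
   and a, b are the coordinates of g. The determinant of a + b F is a product of
   powers of a + b and a - b, whose product is, up to Q(chi)^*,
   (2 pi i)^(-w(chi)) / Q_sigma(chi), and whose inverses are the periods a^±(chi).

   Rationality over F ⊗ K needs no Galois orbits: D_r'(psi) = 0 for every r'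
   other than r, so that an expression depending on r is the sum over r' of its
   values at r', each weighted by D_r'. An element of F ⊗ K that is nonzero at all
   the psi ⊗ sigma, for one fixed sigma, is a unit. *)

Require Import Defs.
From HB Require Import structures.
From mathcomp Require Import all_boot all_order all_algebra all_field.
From mathcomp Require Import all_classical all_reals all_analysis.
From mathcomp.real_closed Require Import complex mxtens.
From mathcomp Require Import fingroup perm zify ring.

Set Implicit Arguments.
Unset Strict Implicit.
Unset Printing Implicit Defensive.

Import Order.TTheory GRing.Theory Num.Theory.
Local Open Scope ring_scope.

(** * The ring F ⊗ K *)

(** Since F squares to 1 and sends Omega_i to lambda_i Omega_(d+1-i), one has lambda_i
    lambda_(d+1-i) = 1. Hence lambda_1...lambda_r is, up to det F and a sign,
    lambda_1...lambda_(d-r): this is why d - r quadratic periods of M occur, while l^r yields the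
    r-th powers of Q_sigma(chi) and of delta of the Artin motive. The factor delta(M) is the cost of
    passing from a rational basis of M_sigma to the Omega_i, the determinant of the latter being
    that of the omega_i divided by delta(M). The exponent ceil(d/2) is the larger of d^+ and d^-,
    which differ by at most one because F is antidiagonal in the basis of the Omega_i.

    The obstacle on the de Rham side is that [period] only supplies some step F^m with free quotient
    of the right rank. Its position relative to the Hodge types has to be recovered, by a dimension
    count, from the inequalities that define r. Everything then rests on which tensors of basis
    vectors lie in F^m. *)

Lemma mul_pure (A : comAlgType rat) (B : fieldExtType rat) (a a' : A) (b b' : B) :
  pure a b * pure a' b' = pure (a * a') (b * b') :> tens A B.
Proof. exact: pureM. Qed.

Section TensMap.
Variables (R : realType) (A : comAlgType rat) (B : fieldExtType rat).
Variables (f : {rmorphism A -> R[i]}) (g : {rmorphism B -> R[i]}).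

Lemma rmorph_ratZ (V : algType rat) (h : {rmorphism V -> R[i]}) c v :
  h (c *: v) = ratr c * h v.
Proof.
rewrite -[c *: v]mulr_algl rmorphM /=; congr (_ * _).
exact: (fmorph_eq_rat (h \o in_alg V)).
Qed.

Lemma tens_map_pure a b : tens_map f g (pure a b) = f a * g b.
Proof.
rewrite /tens_map [in RHS](coord_vbasis (memvf b)) rmorph_sum mulr_sumr.
apply: eq_bigr => k _; rewrite mxE !rmorph_ratZ.
by rewrite mulrCA mulrA.
Qed.

Fact tens_map_is_zmod_morphism : zmod_morphism (tens_map f g).
Proof.
move=> x y; rewrite /tens_map -sumrB; apply: eq_bigr => k _.
by rewrite !mxE rmorphB mulrBl.
Qed.
HB.instance Definition _ :=
  GRing.isZmodMorphism.Build (tens A B) R[i] (tens_map f g)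
    tens_map_is_zmod_morphism.

Fact tens_map_is_monoid_morphism : monoid_morphism (tens_map f g).
Proof.
split=> [|x y].
  by rewrite [LHS](tens_map_pure 1 1) !rmorph1 mulr1.
rewrite [x in LHS]pure_coord [y in LHS]pure_coord mulr_suml.
rewrite raddf_sum mulr_suml; apply: eq_bigr => i _.
rewrite mulr_sumr raddf_sum mulr_sumr; apply: eq_bigr => j _.
by rewrite mul_pure /= !tens_map_pure !rmorphM mulrACA.
Qed.
HB.instance Definition _ :=
  GRing.isMonoidMorphism.Build (tens A B) R[i] (tens_map f g)
    tens_map_is_monoid_morphism.
End TensMap.

HB.instance Definition _ (R : realType) (E K : fieldExtType rat)
    (phi : emb R E) (sigma : emb R K) :=
  GRing.RMorphism.copy (ev phi sigma) (tens_map phi sigma).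

Lemma ev_pure (R : realType) (E K : fieldExtType rat) (phi : emb R E)
  (sigma : emb R K) a b : ev phi sigma (pure a b) = phi a * sigma b.
Proof. exact: tens_map_pure. Qed.

Definition pureL (A : comAlgType rat) (B : fieldExtType rat) (a : A) : tens A B :=
  pure a 1.
Definition pureR (A : comAlgType rat) (B : fieldExtType rat) (b : B) : tens A B :=
  pure 1 b.

Section Pure.
Variables (A : comAlgType rat) (B : fieldExtType rat).
Fact pureL_is_zmod_morphism : zmod_morphism (@pureL A B).
Proof.
move=> x y; apply: (addIr (pureL B y)).
by rewrite subrK /pureL -pureDl subrK.
Qed.
Fact pureL_is_monoid_morphism : monoid_morphism (@pureL A B).
Proof. by split=> // x y; rewrite /pureL mul_pure mulr1. Qed.
HB.instance Definition _ :=
  GRing.isZmodMorphism.Build A (tens A B) (@pureL A B) pureL_is_zmod_morphism.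
HB.instance Definition _ :=
  GRing.isMonoidMorphism.Build A (tens A B) (@pureL A B)
    pureL_is_monoid_morphism.
Fact pureR_is_zmod_morphism : zmod_morphism (@pureR A B).
Proof.
move=> x y; apply: (addIr (pureR A y)).
by rewrite subrK /pureR -pureDr subrK.
Qed.
Fact pureR_is_monoid_morphism : monoid_morphism (@pureR A B).
Proof. by split=> // x y; rewrite /pureR mul_pure mulr1. Qed.
HB.instance Definition _ :=
  GRing.isZmodMorphism.Build B (tens A B) (@pureR A B) pureR_is_zmod_morphism.
HB.instance Definition _ :=
  GRing.isMonoidMorphism.Build B (tens A B) (@pureR A B)
    pureR_is_monoid_morphism.

Lemma tensE (x : tens A B) :
  x = \sum_k pureL B (x 0 k) * pureR A (vbasis {:B})`_k.
Proof.
rewrite [LHS]pure_coord; apply: eq_bigr => k _.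
by rewrite mul_pure mulr1 mul1r.
Qed.
End Pure.

Section UnitCriterion.
Variables (R : realType) (F K : fieldExtType rat).

(** F is Q[X] modulo [q]. The value at [beta] of a rational polynomial depends only on its value at
    [alpha], because the polynomials that kill [alpha] are multiples of [q], which has [beta] as a
    root. *)
Lemma emb_of_root (alpha : F) (beta : R[i]) (q : {poly rat}) :
  <<1; alpha>>%VS = fullv -> map_poly (in_alg F) q = minPoly 1 alpha ->
  root (map_poly ratr q) beta ->
  exists psi : emb R F, psi alpha = beta.
Proof.
move=> gen qE q0.
have P y : exists s : {poly rat}, y = (map_poly (in_alg F) s).[alpha].
  have : y \in <<1; alpha>>%VS by rewrite gen memvf.
  by case/Fadjoin1_polyP=> s ->; exists s.
pose s y := projT1 (cid (P y)).
have sE y : (map_poly (in_alg F) (s y)).[alpha] = y by rewrite -(projT2 (cid (P y))).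
have kill t : (map_poly (in_alg F) t).[alpha] = 0 -> (map_poly ratr t).[beta] = 0.
  move=> t0; have : minPoly 1 alpha %| map_poly (in_alg F) t.
    by rewrite minPoly_dvdp ?rootE ?t0 //; apply/polyOver1P; exists t.
  rewrite -qE dvdp_map => /dvdpP[u ->].
  by rewrite rmorphM /= hornerM (eqP q0) mulr0.
pose psi y := (map_poly ratr (s y)).[beta].
have eqv t u : (map_poly (in_alg F) t).[alpha] = (map_poly (in_alg F) u).[alpha] ->
    (map_poly ratr t).[beta] = (map_poly ratr u).[beta].
  move=> tu; apply/eqP; rewrite -subr_eq0 -hornerN -hornerD -rmorphB /=.
  by apply/eqP/kill; rewrite rmorphB hornerD hornerN tu subrr.
have psi_zmod : zmod_morphism psi.
  move=> x y; rewrite /psi -hornerN -hornerD -rmorphB /=; apply: eqv.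
  by rewrite rmorphB hornerD hornerN !sE.
have psi_monoid : monoid_morphism psi.
  split=> [|x y]; rewrite /psi.
    rewrite -[RHS](hornerC _ beta) -[1%:P](rmorph1 (map_poly ratr)); apply: eqv.
    by rewrite sE rmorph1 hornerC.
  by rewrite -hornerM -rmorphM /=; apply: eqv; rewrite rmorphM hornerM !sE.
pose Z := GRing.isZmodMorphism.Build F R[i] psi psi_zmod.
pose M := GRing.isMonoidMorphism.Build F R[i] psi psi_monoid.
pose psi' : emb R F := HB.pack psi Z M.
exists psi'; rewrite /= /psi -[RHS](hornerX beta) -(map_polyX ratr).
by apply: eqv; rewrite map_polyX hornerX sE.
Qed.

(* Writing [F = Q(alpha)], the ring [F ⊗ K] is the quotient of [K[X]] by the minimal
   polynomial of [alpha]; a root in C of a common factor of the latter and of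
   a representative of [x] would give an embedding at which [x] vanishes. *)
Lemma ev_unit (sigma : emb R K) (x : tens F K) :
  (forall psi, ev psi sigma x != 0) -> exists y, x * y = 1.
Proof.
move=> x0.
pose alpha := separable_generator 1%AS {:F}.
have gen : <<1; alpha>>%VS = fullv.
  rewrite -eq_adjoin_separable_generator ?sub1v //.
  by apply/separableP => y _; apply: pcharf0_separable => c; rewrite pchar_lalg pchar_num.
have [q qE] : exists q : {poly rat}, map_poly (in_alg F) q = minPoly 1 alpha.
  by have /polyOver1P[q ->] := minPolyOver 1 alpha; exists q.
have qroot : (map_poly (in_alg F) q).[alpha] = 0 by rewrite qE minPolyxx.
(* Evaluation of K[X] at alpha ⊗ 1: a ring morphism onto F ⊗ K that kills the minimal polynomial of
   [alpha]. *)
pose theta (g : {poly K}) := (map_poly (@pureR F K) g).[pureL K alpha].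
have theta_q t : theta (map_poly (in_alg K) t) = pureL K (map_poly (in_alg F) t).[alpha].
  rewrite /theta -map_poly_comp -horner_map -map_poly_comp; congr (_.[_]).
  by apply: eq_map_poly => c /=; rewrite /pureL /pureR pureZ.
have thetaM t u : theta (t * u) = theta t * theta u.
  by rewrite /theta rmorphM hornerM.
have thetaD t u : theta (t + u) = theta t + theta u.
  by rewrite /theta rmorphD hornerD.
have [g gx] : exists g, theta g = x.
  have P k : exists t : {poly rat}, x 0 k = (map_poly (in_alg F) t).[alpha].
    by apply/Fadjoin1_polyP; rewrite gen memvf.
  have [t tE] := choice P.
  exists (\sum_k (map_poly (in_alg K) (t k) * ((vbasis {:K})`_k)%:P)).
  rewrite [RHS]tensE; elim/big_rec2: _ => [|k y z _ <-].
    by rewrite /theta rmorph0 horner0.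
  by rewrite thetaD thetaM theta_q -tE [theta _%:P]/theta map_polyC hornerC.
have ev_theta (psi : emb R F) h : ev psi sigma (theta h) = (map_poly sigma h).[psi alpha].
  rewrite /theta -horner_map -map_poly_comp /= ev_pure rmorph1 mulr1; congr (_.[_]).
  by apply: eq_map_poly => c /=; rewrite ev_pure rmorph1 mul1r.
have [cop|/negP ncop] := boolP (coprimep g (map_poly (in_alg K) q)).
  (* Bezout holds only up to nonzero constants [c] and [e], hence the factor [e^-1 * c] in the
     inverse. *)
  have [[u v] /= /eqpP[[c e] /= /andP[c0 e0] uv]] := Bezout_coprimepP _ _ cop.
  exists (theta ((e^-1 * c)%:P * u)).
  rewrite -gx -thetaM.
  have -> : g * ((e^-1 * c)%:P * u) =
      1 - (e^-1 * c)%:P * v * map_poly (in_alg K) q.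
    apply/eqP; rewrite eq_sym subr_eq; apply/eqP.
    rewrite mulrCA -!mulrA -mulrDr [g * u]mulrC rmorphM /= -mulrA.
    by rewrite [c%:P * _]mul_polyC uv alg_polyC -rmorphM mulVf.
  rewrite /theta rmorphB hornerD hornerN -/(theta _) -/(theta _) thetaM.
  by rewrite theta_q qroot rmorph0 mulr0 subr0 /theta rmorph1 hornerC.
have : size (gcdp g (map_poly (in_alg K) q)) != 1%N by apply/negP.
rewrite -(size_map_poly sigma) => /closed_rootP[beta].
rewrite gcdp_map root_gcd => /andP[gb].
rewrite -map_poly_comp (eq_map_poly (g := ratr)) => [qb|c]; last first.
  by rewrite /= rmorph_ratZ rmorph1 mulr1.
have [psi psiE] := emb_of_root gen qE qb.
have := x0 psi; rewrite -gx ev_theta psiE => /negP[].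
exact: gb.
Qed.
End UnitCriterion.

Section Rational.
Variables (R : realType) (F K : fieldExtType rat) (sigma : emb R K).
Implicit Types h : emb R F -> R[i].

(** The image of F ⊗ K in the functions on the embeddings of F, for the one fixed [sigma]. By
    [ev_unit] it contains the inverses of its nowhere vanishing elements. *)
Definition rational h := exists x : tens F K, forall psi, h psi = ev psi sigma x.

Lemma eq_rational h h' : h =1 h' -> rational h -> rational h'.
Proof. by move=> hh [x xE]; exists x => psi; rewrite -hh. Qed.

Lemma rational_ev (x : tens F K) : rational (fun psi => ev psi sigma x).
Proof. by exists x. Qed.

Lemma rational_emb (e : F) : rational (fun psi => psi e).
Proof. by exists (pure e 1) => psi; rewrite ev_pure rmorph1 mulr1. Qed.

Lemma rational1 : rational (fun=> 1).
Proof. by exists 1 => psi; rewrite rmorph1. Qed.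

Lemma rationalM h h' : rational h -> rational h' -> rational (fun psi => h psi * h' psi).
Proof. by move=> [x xE] [y yE]; exists (x * y) => psi; rewrite rmorphM xE yE. Qed.

Lemma rationalX h n : rational h -> rational (fun psi => h psi ^+ n).
Proof. by move=> [x xE]; exists (x ^+ n) => psi; rewrite rmorphXn xE. Qed.

Lemma rational_sum n (G : 'I_n -> emb R F -> R[i]) :
  (forall i, rational (G i)) -> rational (fun psi => \sum_i G i psi).
Proof.
move=> /choice[x xE]; exists (\sum_i x i) => psi.
by rewrite rmorph_sum; apply: eq_bigr => i _; rewrite xE.
Qed.

Lemma rational_prod n (P : pred 'I_n) (G : 'I_n -> emb R F -> R[i]) :
  (forall i, rational (G i)) -> rational (fun psi => \prod_(i | P i) G i psi).
Proof.
move=> /choice[x xE]; exists (\prod_(i | P i) x i) => psi.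
by rewrite rmorph_prod; apply: eq_bigr => i _; rewrite xE.
Qed.

Lemma rationalV h : (forall psi, h psi != 0) -> rational h ->
  rational (fun psi => (h psi)^-1).
Proof.
move=> h0 [x xE]; have [psi|y xy] := @ev_unit R F K sigma x.
  by rewrite -xE.
exists y => psi; apply: (mulfI (h0 psi)).
by rewrite mulfV // xE -rmorphM xy rmorph1.
Qed.

(** The quotient vanishes nowhere, so [ev_unit] makes it the image of a unit as soon as it is
    rational. *)
Lemma sim_rational (h h' : emb R F -> R[i]) :
  (forall psi, h psi != 0) -> (forall psi, h' psi != 0) ->
  rational (fun psi => h psi / h' psi) -> sim sigma h h'.
Proof.
move=> h0 h'0 [x xE]; right.
have [psi|y xy] := @ev_unit R F K sigma x.
  by rewrite -xE mulf_neq0 ?invr_eq0.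
by exists x, y; split=> // psi; split.
Qed.

End Rational.

Lemma ev_ext (R : realType) (E F K : fieldExtType rat) (sigma : emb R K)
    (i : {rmorphism E -> F}) (psi : emb R F) (x : tens E K) :
  ev psi sigma (tens_map (fun e => pure (i e) 1) (pure (1 : F)) x) =
  ev (psi \o i) sigma x.
Proof.
rewrite [in RHS]/ev /tens_map rmorph_sum /=; apply: eq_bigr => k _.
by rewrite rmorphM /= !ev_pure !rmorph1 mulr1 mul1r.
Qed.

Lemma rational_ext (R : realType) (E F K : fieldExtType rat) (sigma : emb R K)
    (i : {rmorphism E -> F}) (h : emb R E -> R[i]) :
  rational sigma h -> rational sigma (fun psi : emb R F => h (psi \o i)).
Proof.
move=> [x xE]; exists (tens_map (fun e => pure (i e) 1) (pure (1 : F)) x) => psi.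
by rewrite xE ev_ext.
Qed.

(** Total reality equates only the values of [cj sigma] and [sigma], whereas [frob], [hodge] and
    [cmp] are indexed by the bundled embeddings. *)
Lemma emb_inj (R : realType) (K : fieldExtType rat) (s t : emb R K) :
  s =1 t -> s = t.
Proof.
case: s t => [f cf] [g cg] /= /funext hf; move: cg; rewrite -{}hf => cg.
suff -> : cf = cg by [].
case: cf cg => [[a] [b]] [[a'] [b']].
by rewrite (Prop_irrelevance a a') (Prop_irrelevance b b').
Qed.

Lemma cjK (R : realType) (K : fieldExtType rat) : involutive (@cj R K).
Proof. by move=> s; apply: emb_inj => x; rewrite /= conjCK. Qed.

(** * Linear algebra *)

(** A permutation other than 1 with a nonzero term in the determinant would strictly increase the
    sum of the heights, which every permutation preserves. This handles a matrix that is
    unitriangular after a reordering of the indices, without performing the reordering. *)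
Lemma det_height_unitriangular (S : comNzRingType) n (A : 'M[S]_n) (h : 'I_n -> nat) :
  (forall i, A i i = 1) ->
  (forall i k, i != k -> A i k != 0 -> (h i < h k)%N) -> \det A = 1.
Proof.
move=> A1 Ah; rewrite /determinant (bigD1 1%g) //= [X in _ + X]big1 => [|s s1].
  by rewrite odd_perm1 mul1r addr0 big1 // => i _; rewrite perm1.
apply/eqP/negPn/negP => nz.
have Asnz i : A i (s i) != 0.
  by apply: contra nz => /eqP Ai; rewrite (bigD1 i) //= Ai mul0r mulr0.
have [i si] : exists i, s i != i.
  apply/existsP; apply: contraR s1; rewrite negb_exists => /forallP sid.
  by apply/eqP/permP => i; rewrite perm1; apply/eqP/negPn/sid.
have le_h k : (h k <= h (s k))%N.
  have [<-|ks] := eqVneq k (s k); first by [].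
  by apply/ltnW/Ah.
have : (\sum_k h k < \sum_k h (s k))%N.
  rewrite (bigD1 i) // [X in (_ < X)%N](bigD1 i) //= -addSn leq_add ?leq_sum //.
  by apply: Ah; rewrite // eq_sym.
by rewrite -(reindex_inj (@perm_inj _ s) (P := xpredT) (F := h)) ltnn.
Qed.

Section TensorRow.
Variables (S : comNzRingType).

(** The matrix of the map x |-> x ⊗ g, which turns statements about all x ⊗ g with g fixed into
    matrix identities. *)
Definition tensr d n (g : 'rV[S]_n) : 'M[S]_(d, d * n) :=
  \matrix_(i, k) ((i == (mxtens_unindex k).1)%:R * g 0 (mxtens_unindex k).2).

Lemma mul_tensr d n (x : 'rV[S]_d) (g : 'rV[S]_n) :
  x *m tensr d g = (x *t g : 'rV_(d * n)).
Proof.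
apply/rowP => k; case: (mxtens_indexP k) => i l.
rewrite mxE (bigD1 i) //= big1 ?addr0 => [|i' ne]; rewrite !mxE !mxtens_indexK /=.
  by rewrite eqxx mul1r; congr (x _ i * g _ l); rewrite [RHS]ord1.
by rewrite (negPf ne) mul0r mulr0.
Qed.

Lemma tensr_mul d n d' n' (g : 'rV[S]_n) (A : 'M[S]_(d, d')) (B : 'M[S]_(n, n')) :
  tensr d g *m (A *t B) = A *m tensr d' (g *m B).
Proof.
apply/row_matrixP => i; rewrite !row_mul !rowE !mul_tensr.
by rewrite (@tensmx_mul _ 1 d 1 n d' n').
Qed.

Lemma tensrD d n (g g' : 'rV[S]_n) : tensr d (g + g') = tensr d g + tensr d g'.
Proof. by apply/matrixP => i k; rewrite !mxE mulrDr. Qed.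

Lemma tensrZ d n a (g : 'rV[S]_n) : tensr d (a *: g) = a *: tensr d g.
Proof. by apply/matrixP => i k; rewrite !mxE mulrCA. Qed.
End TensorRow.

Lemma map_tensr (S S' : comNzRingType) (f : {rmorphism S -> S'}) d n (g : 'rV[S]_n) :
  map_mx f (tensr d g) = tensr d (map_mx f g).
Proof. by apply/matrixP => i k; rewrite !mxE rmorphM rmorph_nat. Qed.

Lemma rank_diag_mx (E : fieldType) n (v : 'rV[E]_n) :
  \rank (diag_mx v) = (\sum_i (v 0 i != 0)%R)%N.
Proof.
elim: n v => [|n IHn] v; first by rewrite thinmx0 mxrank0 big_ord0.
have vE : diag_mx v = block_mx (diag_mx (lsubmx (v : 'rV_(1 + n)))) 0
    0 (diag_mx (rsubmx (v : 'rV_(1 + n)))) :> 'M[E]_(1 + n).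
  by rewrite -(@diag_mx_row _ n 1) hsubmxK.
rewrite big_ord_recl [diag_mx v]vE (@rank_diag_block_mx _ 1 1 n n) IHn; congr (_ + _)%N.
  have -> : diag_mx (lsubmx (v : 'rV_(1 + n))) = (v 0 ord0)%:M.
    apply/matrixP => i k; rewrite !ord1 !mxE eqxx; congr (v _ _ *+ _).
    exact/val_inj.
  by rewrite rank_rV -scalemx1 scalemx_eq0 (negPf (matrix_nonzero1 _ _)) orbF.
by apply: eq_bigr => i _; rewrite mxE; congr (nat_of_bool (v _ _ != 0)); apply: val_inj.
Qed.

Section Involution.
Variables (E : fieldType) (d : nat) (F : 'M[E]_d).
Hypotheses (E2 : 2%:R != 0 :> E) (FF : F *m F = 1%:M).

Lemma involution_diag : exists (V : 'M[E]_d) (e : 'I_d -> bool),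
  V \in unitmx /\ V *m F = diag_mx (\row_i (-1) ^+ e i) *m V.
Proof.
have N1 : 1 != -1 :> E by rewrite -subr_eq0 opprK.
have : diagonalizable F.
  apply/diagonalizablePeigen; exists [:: 1; -1]; first by rewrite /= inE N1.
  rewrite big_cons big_seq1; apply/eqmxP; rewrite submx1 /=.
  have -> : 1%:M = 2%:R^-1 *: (1%:M + F) + 2%:R^-1 *: (1%:M - F).
    by rewrite -scalerDr addrACA subrr addr0 -mulr2n -scaler_nat scalerA mulVf ?scale1r.
  apply: addmx_sub_adds; apply: scalemx_sub; apply/eigenspaceP.
    by rewrite mulmxDl mul1mx FF scale1r addrC.
  by rewrite mulmxBl mul1mx FF scaleN1r opprB.
case=> V Vu /diagonalizable_forPex[D /(simmxP Vu) VF].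
have DD i : D 0 i * D 0 i = 1.
  have : V *m F *m F *m invmx V = 1%:M by rewrite -(mulmxA V) FF mulmx1 mulmxV.
  rewrite VF -(mulmxA _ V) VF mulmxA mulmxK // mulmx_diag => /matrixP/(_ i i).
  by rewrite !mxE eqxx.
exists V, (fun i => D 0 i != 1); split=> //; rewrite VF; congr (diag_mx _ *m _).
apply/rowP => i; rewrite mxE; have /eqP := DD i.
by rewrite -expr2 sqrf_eq1; have [->|_ /= /eqP] := eqVneq.
Qed.

Lemma rank_eigenspace_diag (V : 'M[E]_d) (e : 'I_d -> bool) (b : bool) :
  V \in unitmx -> V *m F = diag_mx (\row_i (-1) ^+ e i) *m V ->
  \rank (eigenspace F ((-1) ^+ b)) = (\sum_i (e i == b))%N.
Proof.
move=> Vu VF.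
have s_inj (c c' : bool) : ((-1) ^+ c == (-1) ^+ c' :> E) = (c == c').
  have N1 : 1 != -1 :> E by rewrite -subr_eq0 opprK.
  by case: c c' => [] []; rewrite ?eqxx ?expr0 ?expr1 ?[-1 == 1]eq_sym ?(negPf N1).
rewrite mxrank_ker -(mxrankMfree (F - _) (_ : row_free (invmx V))); last first.
  by rewrite row_free_unit unitmx_inv.
have -> : F - ((-1) ^+ b)%:M = invmx V *m (diag_mx (\row_i ((-1) ^+ e i - (-1) ^+ b)) *m V).
  have -> : \row_i ((-1) ^+ e i - (-1) ^+ b) =
      \row_i (-1) ^+ e i - const_mx ((-1) ^+ b) :> 'rV[E]_d.
    by apply/rowP => i; rewrite !mxE.
  rewrite raddfB /= diag_const_mx mulmxBl -VF -scalar_mxC -mulmxBr.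
  by rewrite mulmxA mulVmx // mul1mx.
rewrite mulmxA mulmxK // -mxrank_tr trmx_mul mxrankMfree; last first.
  by rewrite row_free_unit unitmx_tr unitmx_inv.
rewrite mxrank_tr rank_diag_mx.
rewrite -[X in (X - _)%N](card_ord d) -sum1_card -sumnB => [|i _]; last by case: (_ != _).
by apply: eq_bigr => i _; rewrite mxE subr_eq0 s_inj; case: (_ == _).
Qed.

Lemma mxtrace_involution :
  \tr F + (\rank (eigenspace F (-1)))%:R = (\rank (eigenspace F 1))%:R.
Proof.
have [V [e [Vu VF]]] := involution_diag.
rewrite -[1]/((-1)^+false) -[X in eigenspace _ X]/((-1) ^+ true).
rewrite !(rank_eigenspace_diag _ Vu VF) !natr_sum.
have -> : F = invmx V *m (diag_mx (\row_i (-1) ^+ e i) *m V).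
  by rewrite -VF mulmxA mulVmx // mul1mx.
rewrite mxtrace_mulC mulmxK // mxtrace_diag -big_split; apply: eq_bigr => i _ /=.
by rewrite mxE; case: (e i); rewrite ?addNr ?addr0.
Qed.

Lemma det_involution (C : fieldType) (f : {rmorphism E -> C}) (a b : C) :
  \det (a%:M + b *: map_mx f F) =
  (a + b) ^+ \rank (eigenspace F 1) * (a - b) ^+ \rank (eigenspace F (-1)).
Proof.
have [V [e [Vu VF]]] := involution_diag.
rewrite -[1]/((-1)^+false) -[X in _ * _ ^+ \rank (eigenspace _ X)]/((-1) ^+ true).
rewrite !(rank_eigenspace_diag _ Vu VF).
have Fu : map_mx f V \in unitmx by rewrite map_unitmx.
have : map_mx f V *m (a%:M + b *: map_mx f F) =
   diag_mx (\row_i (a + b * (-1) ^+ e i)) *m map_mx f V.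
  rewrite mulmxDr -scalemxAr -map_mxM VF map_mxM scalar_mxC scalemxAl -mulmxDl.
  congr (_ *m _); rewrite map_diag_mx -diag_const_mx -!linearZ -raddfD; congr (diag_mx _).
  by apply/rowP => i; rewrite !mxE rmorphXn rmorphN1.
move/(congr1 determinant); rewrite !det_mulmx mulrC.
have dV : \det (map_mx f V) != 0 by rewrite -unitfE -unitmxE.
move/(mulIf dV) ->; rewrite det_diag.
rewrite !expr_sum -big_split; apply: eq_bigr => i _ /=.
by rewrite mxE; case: (e i); rewrite ?expr0 ?expr1 ?mulr1 ?mul1r ?mulrN1.
Qed.
End Involution.

(* Modulo the middle step of the filtration of M ⊗ N, with N of rank two, the
   vectors [w_i ⊗ w0] with [i < r] and [w_i ⊗ w1] with [i < d - r] vanish; these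
   are the remaining ones. *)
Definition quot_rows (S : comNzRingType) d n (r : nat) (w : 'M[S]_d) (w0 w1 : 'rV[S]_n)
    (P : 'M[S]_(d * n, d)) : 'M[S]_d :=
  \matrix_(i < d) if (i < r)%N then row (rev_ord i) w *m tensr d w1 *m P
                  else row i w *m tensr d w0 *m P.

(** The matrix of Frobenius in the basis of the Omega_i. *)
Definition antidiag (S : comNzRingType) d (lam : 'I_d -> S) : 'M[S]_d :=
  \matrix_(i, k) (lam i *+ (k == rev_ord i)).

Lemma mul_antidiag (S : comNzRingType) d m (lam : 'I_d -> S) (A : 'M[S]_(d, m)) i :
  row i (antidiag lam *m A) = lam i *: row (rev_ord i) A.
Proof.
rewrite row_mul [row i _ *m A]mulmx_sum_row (bigD1 (rev_ord i)) //= big1 ?addr0.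
  by rewrite !mxE eqxx mulr1n.
by move=> k ne; rewrite !mxE (negPf ne) mulr0n scale0r.
Qed.

Section QuotientDeterminant.
Variables (S : comNzRingType) (d n r : nat).
Hypothesis le_rd : (r <= d)%N.
Hypothesis rev_lt : forall k : 'I_d, (r <= k)%N -> (rev_ord k < r)%N.
Variables (N w : 'M[S]_d) (w0 w1 : 'rV[S]_n) (m l : S) (lam : 'I_d -> S).
Variable P : 'M[S]_(d * n, d).
Hypothesis N1 : forall i, N i i = 1.
Hypothesis N0 : forall i k : 'I_d, (i < k)%N -> N i k = 0.
Let a0 k := row k w *m tensr d w0 *m P.
Let a1 k := row k w *m tensr d w1 *m P.
Hypothesis kill0 : forall k : 'I_d, (k < r)%N -> a0 k = 0.
Hypothesis kill1 : forall k : 'I_d, (r <= k)%N -> a1 (rev_ord k) = 0.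
Let O := N *m w.

(** Row i is O_i ⊗ w0 + l lam_i O_(rev i) ⊗ (w1 + m w0), taken modulo the filtration. As [N] is
    lower triangular, the first summand dies for i < r and the second for i >= r. What remains is,
    up to the scalars l lam_i for i < r, a combination of the rows of [quot_rows] whose matrix is
    unitriangular in a suitable order. *)
Lemma det_quotient :
  \det ((O *m tensr d w0 + l *: (antidiag lam *m O *m tensr d (w1 + m *: w0))) *m P) =
  l ^+ r * \prod_(k < d | (k < r)%N) lam k * \det (quot_rows r w w0 w1 P).
Proof.
(* For k < r the k-th row of [quot_rows] involves w_(rev k) ⊗ w1, hence the reversed indices. The
   entries with factor [m] come from the w0-part of w1 + m w0. *)
pose Npp := \matrix_(i, k < d)
  if (i < r)%N then if (k < r)%N then N (rev_ord i) (rev_ord k) else m * N (rev_ord i) k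
  else if (k < r)%N then 0 else N i k.
pose tau := \row_(i < d) if (i < r)%N then l * lam i else 1.
have Orow g i : row i (O *m tensr d g *m P) =
    \sum_k N i k *: (row k w *m tensr d g *m P).
  rewrite /O -!mulmxA row_mul [row i N *m _]mulmx_sum_row.
  by apply: eq_bigr => k _; rewrite mxE row_mul mulmxA.
have -> : (O *m tensr d w0 + l *: (antidiag lam *m O *m tensr d (w1 + m *: w0))) *m P =
    diag_mx tau *m (Npp *m quot_rows r w w0 w1 P).
  apply/row_matrixP => i; rewrite [RHS]row_mul row_diag_mx -scalemxAl -rowE mxE.
  rewrite mulmxDl linearD /= -scalemxAl linearZ /= -!mulmxA mul_antidiag !mulmxA !Orow.
  rewrite row_mul [row i Npp *m _]mulmx_sum_row.
  case: ltnP => [ir|ri].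
    rewrite big1 ?add0r => [|k _]; last first.
      have [ik|ki] := ltnP i k; first by rewrite N0 ?scale0r.
      by rewrite -/(a0 k) kill0 ?scaler0 // (leq_ltn_trans ki).
    rewrite scalerA; congr (_ *: _).
    under eq_bigr => k _ do rewrite tensrD tensrZ mulmxDr mulmxDl -scalemxAr -scalemxAl
      scalerDr -/(a0 k) -/(a1 k).
    rewrite big_split /= (reindex_inj rev_ord_inj) -big_split /=.
    apply: eq_bigr => k _; rewrite !mxE ir rowK; case: ltnP => [kr|rk].
      by rewrite [a0 k]kill0 // !scaler0 addr0.
    by rewrite kill1 // scaler0 add0r scalerA mulrC.
  rewrite [X in _ *: (_ *: X)]big1 => [|k _]; last first.
    have [ik|ki] := ltnP (rev_ord i) k; first by rewrite N0 ?scale0r.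
    rewrite tensrD tensrZ mulmxDr mulmxDl -scalemxAr -scalemxAl -/(a0 k) -/(a1 k).
    rewrite kill0 ?(leq_ltn_trans ki) ?rev_lt // scaler0 addr0 -[k]rev_ordK kill1 ?scaler0 //.
    by rewrite /= leq_subRL ?ltn_ord //; move: ki; rewrite /= leq_subRL ?ltn_ord //; lia.
  rewrite !scaler0 addr0 scale1r; apply: eq_bigr => k _; rewrite !mxE ltnNge ri /= rowK.
  by case: ltnP => [kr|rk]; rewrite ?scale0r // -/(a0 k) kill0 ?scaler0.
(* Below r the reversed block of [N] is upper triangular and the height increases with the index.
   From r on the block is lower triangular and the height decreases. The offset [2 * d] puts the
   second group above the first. *)
rewrite det_mulmx det_diag det_mulmx (@det_height_unitriangular _ _ Npp
  (fun k => if (k < r)%N then k : nat else (2 * d - k)%N)).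
- rewrite mul1r; congr (_ * _).
  have -> : \prod_(i < d) tau 0 i = \prod_(i < d | (i < r)%N) (l * lam i).
    by rewrite [RHS]big_mkcond; apply: eq_bigr => i _; rewrite mxE.
  by rewrite big_split /= -(big_ord_widen _ (fun=> l)) // prodr_const card_ord.
- by move=> i; rewrite mxE !N1; case: ltnP.
move=> i k ne; rewrite mxE.
have := ltn_ord i; have := ltn_ord k; move: ne; rewrite -(inj_eq val_inj) /=.
case: (ltnP i r) => ir; case: (ltnP k r) => kr ne ki ii; rewrite ?eqxx //.
- move=> nz; have : ~~ (rev_ord i < rev_ord k)%N.
    by apply: contra nz => /N0->.
  by rewrite /=; lia.
- by lia.
- move=> nz; have : ~~ (i < k)%N by apply: contra nz => /N0->.
  by lia.
Qed.
End QuotientDeterminant.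

(** * Filtrations, pairings and quadratic periods *)

Local Notation lspan := Defs.span.

Section Span.
Variables (S : comNzRingType) (d : nat).
Implicit Types (U : set 'rV[S]_d) (x : 'rV[S]_d).

Lemma sub_span U x : U x -> lspan U x.
Proof.
by move=> Ux; exists 1, 1%:M, x; split=> [i|]; rewrite ?mul1mx // (rowE i) ord1
  (_ : 'e_0 = 1%:M) ?mul1mx //; apply/rowP => k; rewrite !mxE !ord1.
Qed.

Lemma span_mul0 U x m (A : 'M[S]_(d, m)) :
  (forall u, U u -> u *m A = 0) -> lspan U x -> x *m A = 0.
Proof.
move=> UA [n [c [v [vU ->]]]]; rewrite -mulmxA (_ : v *m A = 0) ?mulmx0 //.
by apply/row_matrixP => i; rewrite row_mul UA // row0.
Qed.

Lemma span_tr0 U x (z : 'rV[S]_d) :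
  (forall u, U u -> z *m u^T = 0) -> lspan U x -> z *m x^T = 0.
Proof.
move=> Uz Ux; rewrite -[LHS]trmxK trmx_mul trmxK (span_mul0 _ Ux) ?trmx0 // => u Uu.
by rewrite -[LHS]trmxK trmx_mul trmxK Uz // trmx0.
Qed.

Lemma span_mono U V x : (forall u, U u -> V u) -> lspan U x -> lspan V x.
Proof. by move=> UV [n [c [v [vU ->]]]]; exists n, c, v; split=> // i; apply: UV. Qed.
End Span.

Lemma map_span (S S' : comNzRingType) (f : {rmorphism S -> S'}) d
    (U : set 'rV[S]_d) (V : set 'rV[S']_d) x :
  (forall u, U u -> V (map_mx f u)) -> lspan U x -> lspan V (map_mx f x).
Proof.
move=> UV [n [c [v [vU ->]]]]; rewrite map_mxM.
by exists n, (map_mx f c), (map_mx f v); split=> // i; rewrite -map_row; apply: UV.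
Qed.

Lemma span_submx (F : fieldType) d (U : set 'rV[F]_d) x m (B : 'M[F]_(m, d)) :
  (forall u, U u -> (u <= B)%MS) -> lspan U x -> (x <= B)%MS.
Proof.
move=> UB [n [c [v [vU ->]]]]; apply: (submx_trans (submxMl _ _)).
by apply/row_subP => i; apply: UB.
Qed.

Section Gram.
Variables (S : comNzRingType) (d : nat).
Definition gram (g : 'M[S]_(d * d, 1)) : 'M[S]_d :=
  \matrix_(i, k) g (mxtens_index (i, k)) 0.

Lemma pairingE (g : 'M[S]_(d * d, 1)) x y :
  pairing g x y = x *m gram g *m y^T.
Proof.
apply/matrixP => i k; rewrite !ord1 /pairing !mxE.
under [RHS]eq_bigr => l _ do rewrite mxE mulr_suml.
rewrite exchange_big pair_big /=.
rewrite (reindex (@mxtens_index d d)) /=; last first.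
  by exists (@mxtens_unindex d d) => l _; rewrite ?mxtens_indexK ?mxtens_unindexK.
apply: eq_bigr => -[l l'] _; rewrite !mxE mxtens_indexK /= mulrAC.
by congr (x _ l * g _ _ * y _ l'); rewrite [LHS]ord1.
Qed.
End Gram.

Lemma gram_tens (S : comNzRingType) d (A : 'M[S]_d) (g : 'M[S]_(d * d, 1)) :
  gram ((A *t A) *m g) = A *m gram g *m A^T.
Proof.
apply/matrixP => i k.
have -> : (A *m gram g *m A^T) i k = (row i A *m gram g *m (row k A)^T) 0 0.
  by rewrite -row_mul [LHS]mxE [RHS]mxE; apply: eq_bigr => l _; rewrite !mxE.
rewrite -pairingE /pairing mxE [RHS]mxE [LHS]mxE.
apply: eq_bigr => l _; congr (_ * _); case: (mxtens_indexP l) => a b.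
by rewrite !mxE !mxtens_indexK.
Qed.

(** With its columns reversed, [H] is lower triangular with nonzero determinant. *)
Lemma gram_antitriangular (F : fieldType) d (H : 'M[F]_d) :
  H \in unitmx -> (forall i k : 'I_d, (k < rev_ord i)%N -> H i k = 0) ->
  forall i, H i (rev_ord i) != 0.
Proof.
move=> Hu H0 i; pose H' := \matrix_(i, k) H i (rev_ord k).
have trig : is_trig_mx H'.
  by apply/is_trig_mxP => a b ab; rewrite mxE H0 //=; have := ltn_ord b; lia.
have H'E : H' = H *m antidiag (fun=> 1).
  apply/matrixP => a b; rewrite !mxE (bigD1 (rev_ord b)) //= big1 ?addr0.
    by rewrite !mxE rev_ordK eqxx mulr1.
  by move=> c ne; rewrite !mxE -(inj_eq rev_ord_inj) rev_ordK eq_sym (negPf ne) mulr0.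
have : \det H' != 0.
  rewrite H'E det_mulmx mulf_neq0 -?unitfE -?unitmxE //.
  suff : antidiag (fun=> 1 : F) *m antidiag (fun=> 1) = 1%:M :> 'M[F]_d.
    by case/mulmx1_unit.
  by apply/row_matrixP => a; rewrite mul_antidiag scale1r; apply/rowP => b;
    rewrite !mxE rev_ordK eq_sym.
rewrite det_trig // => /prodf_neq0/(_ i isT).
by rewrite mxE.
Qed.

Section QuadraticPeriods.
Variables (R : realType) (K E : fieldExtType rat) (d : nat).
Variables (M : hodge_dR R K E d) (w : int) (A : hodge_dR R K E 1).
Variables (f : emb R K -> 'M[E]_(d * d, 1)) (g : 'M[tens E K]_(d * d, 1)).
Variables (sigma : emb R K) (p : emb R E -> 'I_d -> int) (Q : 'I_d -> emb R E -> R[i]).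
Hypothesis hmor : morphism (tensor M M) (twist A (- w)) f g.
Hypothesis filA : forall q, fil A q = if q <= 0 then setT else [set 0]%classic.
Hypothesis fil_dec : forall q q' x, q <= q' -> fil M q' x -> fil M q x.
Hypothesis gram_unit : forall phi, map_mx (ev phi sigma) (gram g) \in unitmx.
Hypothesis p_dec : forall phi (i k : 'I_d), (i < k)%N -> p phi k < p phi i.
Hypothesis p_sym : forall phi i, p phi i + p phi (rev_ord i) = w.

Lemma filC_dec q q' phi x : q <= q' -> filC M sigma phi q' x -> filC M sigma phi q x.
Proof.
move=> qq'; apply: span_mono => u [y yq <-]; exists y => //.
exact: fil_dec qq' yq.
Qed.

(** The pairing sends F^q ⊗ F^q' into F^(q+q') of A(-w), which is zero once q + q' > w. *)
Lemma filC_orth q q' phi x y : w < q + q' ->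
  filC M sigma phi q x -> filC M sigma phi q' y ->
  x *m map_mx (ev phi sigma) (gram g) *m y^T = 0.
Proof.
move=> wqq' xq yq; rewrite -mulmxA; apply: span_mul0 xq => _ [x0 x0q <-].
rewrite mulmxA; apply: span_tr0 yq => _ [y0 y0q <-].
have [_ _ hfil _] := hmor.
have /hfil : fil (tensor M M) (q + q') (x0 *t y0 : 'rV_(d * d)).
  by apply: sub_span; exists q, q', x0, y0.
rewrite /= filA ifF => [gxy|]; last by apply/negbTE; rewrite -ltNge subr_gt0.
rewrite map_trmx -!map_mxM -pairingE.
by rewrite /pairing gxy raddf0.
Qed.

(** The definition describes F^q only for q among the p_i. For general q, notably p_i + 1, the
    vanishing of coordinates comes from the pairing: x in F^q is orthogonal to omega_(d+1-k)
    whenever p_k < q, and the Gram matrix of the omega_i is antitriangular with nonzero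
    antidiagonal. The same fact gives the nonvanishing of the mu_i. *)
Lemma quadratic_periodsP : quadratic_periods M A g sigma p Q ->
  exists omega omega' : 'M[tens E K]_d,
  let mu i := pairing g (row i omega) (row (rev_ord i) omega) 0 0 in
  [/\ omega *m omega' = 1%:M,
      forall b, exists2 m, is_Fpm M sigma b m &
        forall x, fil M m x <-> exists c : 'rV_d,
          (forall i : 'I_d, (dpm M sigma b <= i)%N -> c 0 i = 0) /\
          x = c *m omega,
      forall phi i, ev phi sigma (mu i) != 0,
      forall phi i, filC M sigma phi (p phi i) (row i (map_mx (ev phi sigma) omega))
    & forall phi,
      (forall q x, filC M sigma phi q x -> exists c : 'rV_d,
         x = c *m map_mx (ev phi sigma) omega /\ forall k, p phi k < q -> c 0 k = 0) /\
      exists (N Om : 'M[R[i]]_d) (lam : 'I_d -> R[i]),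
      [/\ (forall i, N i i = 1) /\ (forall i k : 'I_d, (i < k)%N -> N i k = 0),
          Om *m cmp M sigma phi = N *m map_mx (ev phi sigma) omega,
          Om *m map_mx phi (frob M sigma) = antidiag lam *m Om
        & forall i, Q i phi = lam i * ev phi sigma (mu i) / delta A sigma phi]].
Proof.
case=> omega [Om [lambda [[omega' [ww' _]] hF hspan hOm hQ]]].
exists omega, omega'; move=> mu.
pose om phi := map_mx (ev phi sigma) omega.
have row_om phi i : filC M sigma phi (p phi i) (row i (om phi)).
  rewrite -hspan -map_row.
  by apply: sub_span; exists i; rewrite /=.
have om_unit phi : om phi \in unitmx.
  have := congr1 (map_mx (ev phi sigma)) ww'; rewrite map_mxM map_mx1.
  by case/mulmx1_unit.
pose H phi := om phi *m map_mx (ev phi sigma) (gram g) *m (om phi)^T.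
have HE phi i k : H phi i k = (row i (om phi) *m map_mx (ev phi sigma) (gram g) *m (row k (om phi))^T) 0 0.
  by rewrite -row_mul [LHS]mxE [RHS]mxE; apply: eq_bigr => l _; rewrite !mxE.
have H0 phi (i k : 'I_d) : (k < rev_ord i)%N -> H phi i k = 0.
  move=> ki; rewrite HE (filC_orth _ (row_om phi i) (row_om phi k)) ?mxE //.
  by rewrite -(p_sym phi i) ltrD2l p_dec.
have H_unit phi : H phi \in unitmx by rewrite !unitmx_mul om_unit gram_unit unitmx_tr om_unit.
have Hrev phi i : H phi i (rev_ord i) != 0 by apply: gram_antitriangular => // a b; apply: H0.
have muE phi i : ev phi sigma (mu i) = H phi i (rev_ord i).
  rewrite HE /mu pairingE -!map_row -map_mxM map_trmx -map_mxM [RHS]mxE.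
  by [].
have coord q phi x : filC M sigma phi q x -> exists c : 'rV_d,
    x = c *m om phi /\ forall k, p phi k < q -> c 0 k = 0.
  move=> xq; exists (x *m invmx (om phi)); rewrite mulmxKV //; split=> //.
  set c := x *m _ => k0; have xE : x = c *m om phi by rewrite mulmxKV.
  (* Descending induction on the index k: pairing with omega_(rev k) leaves c_k times an
     antidiagonal entry, the terms l < k vanishing by antitriangularity and the terms l > k by
     induction. *)
  have [m] := ubnP (d - k0)%N; elim: m k0 => // m IHm k km pk.
  have : (x *m map_mx (ev phi sigma) (gram g) *m (row (rev_ord k) (om phi))^T) 0 0 = 0.
    rewrite (filC_orth _ xq (row_om phi (rev_ord k))) ?mxE //.
    by rewrite -(p_sym phi k) ltrD2r.
  rewrite xE [X in X *m _ *m _]mulmx_sum_row !mulmx_suml summxE (bigD1 k) //=.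
  rewrite big1 ?addr0 => [|l lk]; rewrite -!scalemxAl mxE -HE; last first.
    have [ll|ll] := ltnP l k; first by rewrite H0 ?mulr0 //=; have := ltn_ord k; lia.
    have {}lk : (k < l)%N by rewrite ltn_neqAle ll andbT eq_sym.
    rewrite IHm ?mul0r //; last exact: lt_trans (p_dec _ lk) pk.
    by have := ltn_ord l; lia.
  by move/eqP; rewrite mulf_eq0 (negPf (Hrev _ _)) orbF => /eqP.
split=> // [phi i|phi]; first by rewrite muE.
split=> [q x|]; first exact: coord.
have /choice[N' hN'] : forall i, exists c : 'rV_d,
    Om i phi *m cmp M sigma phi = row i (om phi) + c *m om phi /\
    forall k, p phi k < p phi i + 1 -> c 0 k = 0.
  move=> i; have [_ + _] := hOm phi i => /coord[c [cE c0]].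
  by exists c; rewrite -cE map_row addrCA subrr addr0.
(* The image of Omega_i differs from omega_i by an element of F^(p_i + 1), which involves only the
   omega_k with k < i. Hence [N] is lower unitriangular. *)
exists (\matrix_(i, k) ((i == k)%:R + N' i 0 k)), (\matrix_i Om i phi), (lambda^~ phi).
split.
- split=> [i|i k ik]; rewrite mxE; have [_ N0] := hN' i.
    by rewrite eqxx N0 ?addr0 // ltrDl.
  rewrite N0 ?addr0; last by rewrite ltr_wpDr // p_dec.
  by rewrite (_ : i == k = false) //; apply: ltn_eqF.
- apply/row_matrixP => i; rewrite !row_mul rowK; have [-> _] := hN' i.
  rewrite [in LHS]rowE -mulmxDl; congr (_ *m _).
  by apply/rowP => k; rewrite !mxE eqxx /= eq_sym.
- apply/row_matrixP => i; rewrite mul_antidiag row_mul !rowK.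
  by have [_ _ ->] := hOm phi i.
- by move=> i; rewrite hQ.
Qed.
End QuadraticPeriods.

Section SubspaceDimension.
Variables (C : fieldType) (d : nat).
Implicit Types U : set 'rV[C]_d.

Lemma sdim_gt0 U x : x != 0 -> U x -> (0 < sdim U)%N.
Proof.
move=> x0 Ux; case: d x U x0 Ux => [|d'] x U x0 Ux.
  by move: x0; rewrite [x]thinmx0 eqxx.
rewrite /sdim (bigD1 (lift ord0 ord0 : 'I_d'.+2)) ?leq_max //=.
apply/asboolP; exists x; split.
  by rewrite /row_free rank_rV x0.
by move=> i; rewrite (_ : row i x = x) //; apply/rowP => k; rewrite !mxE ord1.
Qed.

Lemma sdim_gt0P U : (0 < sdim U)%N -> exists2 x, x != 0 & U x.
Proof.
move=> h; apply: contrapT => U0; move: h; rewrite lt0n => /negP[].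
rewrite -leqn0; apply/bigmax_leqP => -[[|n] ltn] /asboolP[v [vfree vU]] //=.
exfalso; apply: U0; exists (row ord0 v); last exact: vU.
apply: contraTneq vfree => v0.
rewrite -kermx_eq0; apply/rowV0Pn; exists (delta_mx 0 ord0).
  by apply/sub_kermxP; rewrite -rowE.
by apply/eqP => /rowP/(_ ord0)/eqP; rewrite !mxE !eqxx oner_eq0.
Qed.
End SubspaceDimension.

(** An increasing self-map of an initial segment is at least the identity; so is its conjugate by
    reversal, which gives the other inequality. *)
Lemma ord_increasing_id d (h : 'I_d -> 'I_d) :
  (forall i k : 'I_d, (i < k)%N -> (h i < h k)%N) -> h =1 id.
Proof.
have ge_id (h' : 'I_d -> 'I_d) : (forall i k : 'I_d, (i < k)%N -> (h' i < h' k)%N) ->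
    forall i : 'I_d, (i <= h' i)%N.
  move=> h'i [m md]; elim: m md => // m IHm md.
  by apply: leq_ltn_trans (IHm (ltnW md)) _; apply: h'i => /=.
move=> hi i; apply/val_inj/anti_leq; rewrite (ge_id _ hi) andbT.
have /ge_id/(_ (rev_ord i)) : forall i k : 'I_d, (i < k)%N ->
    (rev_ord (h (rev_ord i)) < rev_ord (h (rev_ord k)))%N.
  move=> a b ab; have /hi : (rev_ord b < rev_ord a)%N.
    by rewrite /=; have := ltn_ord b; lia.
  by rewrite /=; have := ltn_ord (h (rev_ord a)); have := ltn_ord (h (rev_ord b)); lia.
rewrite rev_ordK /=; have := ltn_ord i; have := ltn_ord (h i); lia.
Qed.

(** Frobenius carries type p to type w - p, so w - p_i is again some p_k. The map i |-> rev k is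
    increasing, hence the identity. *)
Lemma hodge_types_sym (R : realType) (K E : fieldExtType rat) d (M : hodge_dR R K E d)
    (w : int) sigma phi (p : 'I_d -> int) :
  is_hodge_dR M w -> regular M -> cj sigma = sigma -> hodge_types M sigma phi p ->
  forall i, p i + p (rev_ord i) = w.
Proof.
move=> [_ _ hfrob _ _] hreg csigma [pdec pE].
have [FF Fswap] := hfrob sigma; rewrite csigma in FF Fswap.
have /choice[k kE] : forall i, exists k, p k = w - p i.
  move=> i; apply/pE; apply/eqP; rewrite eqn_leq hreg /=.
  have /sdim_gt0P[x x0 xi] : (0 < hodge_number M sigma phi (p i))%N.
    by have -> : hodge_number M sigma phi (p i) = 1%N by apply/pE; exists i.
  apply: (@sdim_gt0 _ _ _ (x *m map_mx phi (frob M sigma))); last first.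
    exact: (proj1 (Fswap phi (p i) x) xi).
  apply: contraNneq x0 => xF0; rewrite -[x]mulmx1 -(map_mx1 phi) -FF map_mxM mulmxA.
  by rewrite xF0 mul0mx.
move=> i; suff <- : k i = rev_ord i by rewrite kE addrC subrK.
apply: (can_inj rev_ordK); rewrite rev_ordK.
apply: (@ord_increasing_id _ (fun i => rev_ord (k i))) => a b ab.
suff : (k b < k a)%N by rewrite /=; have := ltn_ord (k a); lia.
case: (ssrnat.ltngtP (k b) (k a)) => [//|/pdec|/val_inj kab]; have := pdec _ _ ab.
  by rewrite !kE; lia.
by move/(congr1 p): kab; rewrite !kE; lia.
Qed.

Lemma nondegenerate_gram (F : fieldType) d (g : 'M[F]_(d * d, 1)) :
  (forall x, (forall y, pairing g x y = 0) -> x = 0) -> gram g \in unitmx.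
Proof.
move=> gx; rewrite unitmxE unitfE; apply/negP => /det0P[v v0 vg].
by move: v0; rewrite (gx v) ?eqxx // => y; rewrite pairingE vg mul0mx.
Qed.

(** Multiplication by [x] is an injective E-linear endomorphism of the finite-dimensional space E ⊗
    K, hence surjective. *)
Lemma regular_tens_unit (E K : fieldExtType rat) (x : tens E K) :
  (forall y, x * y = 0 -> y = 0) -> exists y, x * y = 1.
Proof.
move=> xreg.
have scaleE (a : E) (y : 'rV[E]_(\dim {:K})) : a *: y = pureL K a * (y : tens E K) :> tens E K.
  rewrite [y in RHS]pure_coord mulr_sumr; apply/rowP => k.
  rewrite mxE [y in LHS]pure_coord !summxE mulr_sumr; apply: eq_bigr => l _.
  by rewrite mul_pure mul1r !mxE scalerAr.
pose h (y : 'rV[E]_(\dim {:K})) : 'rV[E]_(\dim {:K}) := x * (y : tens E K).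
have hlin : linear h.
  by move=> a y z; rewrite /h mulrDr !scaleE mulrCA.
pose hL := GRing.isLinear.Build _ _ _ _ h hlin.
pose h' : {linear 'rV[E]_(\dim {:K}) -> 'rV[E]_(\dim {:K})} := HB.pack h hL.
have hE y : h y = y *m lin1_mx h' by rewrite mul_rV_lin1.
have A_unit : lin1_mx h' \in unitmx.
  rewrite unitmxE unitfE; apply/negP => /det0P[v /negP v0 vh]; apply: v0.
  by apply/eqP/xreg; rewrite -[LHS]/(h v) hE.
exists ((1 : tens E K) *m invmx (lin1_mx h')).
by rewrite -[LHS]/(h _) hE mulmxKV.
Qed.

Section Polarization.
Variables (R : realType) (K E : fieldExtType rat).

Lemma delta1 (A : hodge_dR R K E 1) sigma phi :
  cmp A sigma phi = (delta A sigma phi)%:M.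
Proof. by rewrite /delta det_mx11 -mx11_scalar. Qed.

(** The power of 2 pi i is the comparison factor of the Tate twist in the target; the one in the
    theorem has no other origin. *)
Lemma morphism_gram d (M : hodge_dR R K E d) (w : int) (A : hodge_dR R K E 1) f g
    sigma phi :
  Defs.morphism (tensor M M) (twist A (- w)) f g ->
  (two_pi_i R ^ (- w) * delta A sigma phi) *: map_mx phi (gram (f sigma)) =
  cmp M sigma phi *m map_mx (ev phi sigma) (gram g) *m (cmp M sigma phi)^T.
Proof.
move=> [_ _ _ /(_ sigma phi)] /= fg.
have -> : map_mx (ev phi sigma) (gram g) = gram (map_mx (ev phi sigma) g).
  by apply/matrixP => i k; rewrite !mxE.
rewrite -gram_tens -fg delta1 -scalemxAr mul_mx_scalar scalerA.
by apply/matrixP => i k; rewrite !mxE.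
Qed.

(** The element 1 is invariant, so 1 = t zeta with t in E ⊗ K, and the inverse of the image of zeta
    is the image of t. Thus delta of the trivial Artin motive can be absorbed into the rational
    factor. *)
Lemma delta_trivial_artin (kappa : {rmorphism K -> algC}) (U : hodge_dR R K E 1) sigma :
  is_artin kappa (fun=> 1) U ->
  rational sigma (delta U sigma) /\ forall phi, delta U sigma phi != 0.
Proof.
move=> [zeta [ext [[_ gen] ext_kappa cmpU _ _]]].
have inv1 : artin_invariant kappa (fun=> 1 : E) 1.
  move=> gamma _; rewrite [pure 1 1 * _]mul1r /tens_map [RHS]pure_coord.
  apply: eq_bigr => k _; rewrite mul_pure mulr1 mul1r; congr (pure _ _).
  rewrite [1%R](_ : _ = pure 1 1) // mxE.
  by rewrite -[_ *: 1]/(ratr _ * 1) mulr1 fmorph_rat.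
have [t [tE _]] := gen _ inv1.
have main phi : delta U sigma phi * tens_map (ext sigma) phi zeta = 1 /\
     delta U sigma phi = ev phi sigma t.
  have := congr1 (tens_map (ext sigma) phi) tE; rewrite rmorph1 rmorphM /=.
  set s := tens_map _ _ (tens_map _ _ _).
  have -> : s = ev phi sigma t.
    rewrite /s [X in tens_map _ _ X]/tens_map rmorph_sum /=; apply: eq_bigr => k _.
    by rewrite rmorphM /= !tens_map_pure !rmorph1 mul1r mulr1 ext_kappa.
  move=> st; have z0 : tens_map (ext sigma) phi zeta != 0.
    by apply/eqP => z0; move/eqP: st; rewrite z0 mulr0 oner_eq0.
  have -> : delta U sigma phi = (tens_map (ext sigma) phi zeta)^-1.
    by rewrite /delta cmpU det_scalar1.
  rewrite mulVf //; split=> //; apply: (mulIf z0).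
  by rewrite mulVf.
split; first by exists t => phi; have [_ ->] := main phi.
by move=> phi; have [/eqP + _] := main phi; apply: contraTneq => ->; rewrite mul0r eq_sym oner_eq0.
Qed.
End Polarization.

(** * Realizations of rank two *)

Lemma sum_ord2 (V : nmodType) (h : 'I_2 -> V) : \sum_i h i = h 0 + h 1.
Proof. by rewrite big_ord_recl big_ord1; congr (h _ + h _); apply/val_inj. Qed.

Lemma det_mx22 (S : comNzRingType) (A : 'M[S]_2) :
  \det A = A 0 0 * A 1 1 - A 0 1 * A 1 0.
Proof.
rewrite (expand_det_row _ 0) big_ord_recl big_ord1 /cofactor !det_mx11 !mxE.
rewrite expr0 mul1r expr1 mulN1r mulrN.
by congr (A _ _ * A _ _ - A _ _ * A _ _); apply/val_inj.
Qed.

Lemma det_col2 (S : comNzRingType) (x y : 'rV[S]_2) :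
  \det (col_mx x y : 'M[S]_2) = x 0 0 * y 0 1 - x 0 1 * y 0 0.
Proof.
have e0 : (0 : 'I_2) = lshift 1 (0 : 'I_1) by apply/val_inj.
have e1 : (1 : 'I_2) = rshift 1 (0 : 'I_1) by apply/val_inj.
have c0 k : col_mx x y 0 k = x 0 k by rewrite e0 col_mxEu.
have c1 k : col_mx x y 1 k = y 0 k by rewrite [X in col_mx _ _ X]e1 col_mxEd.
by rewrite det_mx22 !c0 !c1.
Qed.

Lemma det_row2 (S : comNzRingType) (x y : 'cV[S]_2) :
  \det (row_mx x y : 'M[S]_2) = x 0 0 * y 1 0 - x 1 0 * y 0 0.
Proof.
have e0 : (0 : 'I_2) = lshift 1 (0 : 'I_1) by apply/val_inj.
have e1 : (1 : 'I_2) = rshift 1 (0 : 'I_1) by apply/val_inj.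
have c0 k : row_mx x y k 0 = x k 0 by rewrite e0 row_mxEl.
have c1 k : row_mx x y k 1 = y k 0 by rewrite [X in row_mx _ _ _ X]e1 row_mxEr.
by rewrite det_mx22 !c0 !c1 [y 0 0 * _]mulrC.
Qed.

Lemma mul_col2 (S : comNzRingType) n (v : 'rV[S]_2) (x y : 'rV[S]_n) :
  v *m (col_mx x y : 'M[S]_(2, n)) = v 0 0 *: x + v 0 1 *: y.
Proof.
have e0 : (0 : 'I_2) = lshift 1 (0 : 'I_1) by apply/val_inj.
have e1 : (1 : 'I_2) = rshift 1 (0 : 'I_1) by apply/val_inj.
apply/rowP => k.
have c0 : col_mx x y 0 k = x 0 k by rewrite e0 col_mxEu.
have c1 : col_mx x y 1 k = y 0 k by rewrite [X in col_mx _ _ X]e1 col_mxEd.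
rewrite [LHS]mxE big_ord_recl big_ord1 [RHS]mxE [X in _ = X + _]mxE [X in _ = _ + X]mxE -c0 -c1.
by have -> : lift ord0 ord0 = 1 :> 'I_2 by apply/val_inj.
Qed.

Section Restriction.
Variables (R : realType) (K L Q : fieldExtType rat) (j : {rmorphism K -> L}).
Variables (N : hodge_dR R L Q 1) (RN : hodge_dR R K Q 2) (w : int) (sigma : emb R K).
Hypotheses (hRN : is_restriction j N RN) (hN : is_hodge_dR N w).
Hypothesis csigma : cj sigma = sigma.
Hypothesis hodgeN : forall tau rho, exists k, forall q,
  hodge N tau rho q = if q == k then setT else [set 0]%classic.

Lemma restriction_fil_dec q q' x : q <= q' -> fil RN q' x -> fil RN q x.
Proof.
have [a [b [_ _ _ [_ hfil] _]]] := hRN; have [_ _ _ [_ dec] _] := hN.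
by move=> qq' /hfil xq; apply/hfil/(dec _ _ qq').
Qed.

(** RM_sigma injects into the product of the lines N_tau, for tau over sigma, and two of these
    already give coordinates. There the comparison becomes a diagonal matrix with invertible
    entries, up to base change. Each N_tau has a single Hodge type, so proportional vectors of
    different types would vanish in every N_tau. *)
Lemma restriction_structure :
  [/\ frob RN sigma *m frob RN sigma = 1%:M,
      forall rho, cmp RN sigma rho \in unitmx
    & forall rho q q' x x', q != q' -> x != 0 -> x' != 0 ->
        hodge RN sigma rho q x -> hodge RN sigma rho q' x' ->
        \det (col_mx x x' : 'M[R[i]]_2) != 0].
Proof.
have [a [b [uniq _ hfrob [hhodge _] hcmp]]] := hRN.
have [_ _ frobN _ cmpN] := hN.
pose over (tau : emb R L) := forall x, tau (j x) = sigma x.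
have inj (x : 'rV[Q]_2) : (forall tau, over tau -> x *m a tau = 0) -> x = 0.
  move=> xa; have [y [_ yuniq]] := uniq sigma (fun=> 0).
  by rewrite -(yuniq x xa) -(yuniq 0) // => tau _; rewrite mul0mx.
have [tau0 [ov0 a0]] : exists tau, over tau /\ a tau != 0.
  apply: contrapT => h; have : const_mx 1 = 0 :> 'rV[Q]_2.
    apply: inj => tau ot; have -> : a tau = 0; last by rewrite mulmx0.
    by apply/eqP/negPn/negP => h'; apply: h; exists tau.
  by move/rowP/(_ 0); rewrite !mxE => /eqP; rewrite oner_eq0.
have [tau1 [ov1 u01]] : exists tau, over tau /\ \det (row_mx (a tau0) (a tau) : 'M[Q]_2) != 0.
  apply: contrapT => h; case/negP: a0.
  (* Multiplying [x] by a column gives the determinant of [a tau0] and that column. If all of these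
     were zero, [x] would vanish in every N_tau, hence be 0, and [a tau0] with it. *)
  pose x : 'rV[Q]_2 := \row_k (if k == 0 then - a tau0 1 0 else a tau0 0 0).
  have x0 : x = 0.
    apply: inj => tau ot; apply/matrixP => i k; rewrite !ord1 mxE big_ord_recl big_ord1 !mxE /=.
    have -> : lift ord0 ord0 = 1 :> 'I_2 by apply/val_inj.
    have : \det (row_mx (a tau0) (a tau) : 'M[Q]_2) = 0.
      by apply/eqP/negPn/negP => h'; apply: h; exists tau.
    by rewrite det_row2 mulNr addrC => <-.
  apply/eqP/matrixP => i k; rewrite ord1 mxE.
  have /rowP x0' := x0.
  case: (eqVneq i 0) => [->|i0]; first by have := x0' 1; rewrite !mxE.
  have -> : i = 1 by apply/val_inj; case: i i0 => [[|[|m]]].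
  by have := x0' 0; rewrite !mxE /= => /eqP; rewrite oppr_eq0 => /eqP.
pose V (rho : emb R Q) : 'M[R[i]]_2 := row_mx (map_mx rho (a tau0)) (map_mx rho (a tau1)).
have uV rho : V rho \in unitmx.
  move: u01; rewrite unitmxE unitfE !det_row2 !mxE -!rmorphM -rmorphB.
  by rewrite -(fmorph_eq0 rho).
have injC (rho : emb R Q) (x : 'rV[R[i]]_2) :
    (forall tau, over tau -> x *m map_mx rho (a tau) = 0) -> x = 0.
  move=> xa; have x0 : x *m V rho = 0 by rewrite [LHS](@mul_mx_row _ 1 2 1 1) !xa // row_mx0.
  by rewrite -[x](mulmxK (uV rho)) x0 mul0mx.
have over_cj tau : over tau -> over (cj tau).
  by move=> ot x; rewrite /= ot -[in RHS]csigma.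
split.
- apply/row_matrixP => i; rewrite row1 rowE; apply/eqP; rewrite -subr_eq0; apply/eqP.
  apply: inj => tau ot; rewrite mulmxBl -!mulmxA.
  have := hfrob _ _ (over_cj _ ot); rewrite cjK => ->.
  rewrite (mulmxA (frob RN sigma)) hfrob // -(mulmxA (a tau)) (_ : frob N tau *m frob N (cj tau) = 1%:M) ?mulmx1 ?subrr //.
  by have [] := frobN tau.
- move=> rho; have [u0 _ _] := cmpN tau0 rho; have [u1 _ _] := cmpN tau1 rho.
  pose D := block_mx (cmp N tau0 rho) 0 0 (cmp N tau1 rho) : 'M[R[i]]_2.
  pose B := row_mx (map_mx (ev rho tau0) b) (map_mx (ev rho tau1) b) : 'M[R[i]]_2.
  have VD : V rho *m D = cmp RN sigma rho *m B.
    rewrite [LHS](@mul_row_block _ 2 1 1 1 1) !mulmx0 addr0 add0r -(hcmp _ _ rho ov0) -(hcmp _ _ rho ov1).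
    by rewrite [RHS](@mul_mx_row _ 2 2 1 1).
  have : V rho *m D \in unitmx.
    rewrite unitmx_mul uV /= unitmxE (@det_ublock _ 1 1) unitrM -!unitmxE.
    by rewrite u0 u1.
  by rewrite VD unitmx_mul => /andP[].
move=> rho q q' x x' qq' x0 x'0 xq x'q'.
apply/negP => /det0P[v v0 vx].
have {}vx : v 0 0 *: x = - (v 0 1 *: x').
  by apply/eqP; rewrite -addr_eq0 -mul_col2 vx.
have vx0 : v 0 0 *: x = 0.
  apply: (injC rho) => tau ot; rewrite -scalemxAl.
  have [k hk] := hodgeN tau rho.
  have := (hhodge sigma rho q x).1 xq tau ot; rewrite hk.
  have [qk|_ ->] := eqVneq q k; last by rewrite scaler0.
  move=> _; rewrite scalemxAl vx mulNmx -scalemxAl.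
  have := (hhodge sigma rho q' x').1 x'q' tau ot; rewrite hk.
  by rewrite -qk eq_sym (negPf qq') => ->; rewrite scaler0 oppr0.
move: v0; suff -> : v = 0 by rewrite eqxx.
move/eqP: (vx0); rewrite scaler_eq0 (negPf x0) orbF => /eqP v00.
move/esym/eqP: vx; rewrite vx0 oppr_eq0 scaler_eq0 (negPf x'0) orbF => /eqP v01.
apply/rowP => i; rewrite mxE; case: (eqVneq i 0) => [-> //|i0].
by have -> : i = 1 by apply/val_inj; case: i i0 => [[|[|m]]].
Qed.
End Restriction.

Section AlternatingMx2.
Variable S : comNzRingType.
Implicit Types (G A : 'M[S]_2) (x y : 'rV[S]_2).

Definition alt_mx2 G := [/\ G 0 0 = 0, G 1 1 = 0 & G 1 0 = - G 0 1].

Let formE G x y : (x *m G *m y^T) 0 0 =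
  (x 0 0 * G 0 0 + x 0 1 * G 1 0) * y 0 0 + (x 0 0 * G 0 1 + x 0 1 * G 1 1) * y 0 1.
Proof. by rewrite mxE sum_ord2 !mxE !sum_ord2. Qed.

Lemma alt_mx2P G : (forall x, x *m G *m x^T = 0) -> alt_mx2 G.
Proof.
move=> G0; pose v (a b : S) : 'rV[S]_2 := \row_k (if k == 0 then a else b).
have Z a b : (a * G 0 0 + b * G 1 0) * a + (a * G 0 1 + b * G 1 1) * b = 0.
  by have := formE G (v a b) (v a b); rewrite G0 !mxE /= => <-.
have G00 : G 0 0 = 0 by have := Z 1 0; rewrite !(mul1r, mul0r, mulr1, mulr0, addr0).
have G11 : G 1 1 = 0 by have := Z 0 1; rewrite !(mul1r, mul0r, mulr1, mulr0, addr0, add0r).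
split=> //; have := Z 1 1; rewrite G00 G11 !(mul1r, mul0r, mulr1, mulr0, addr0, add0r).
by move/eqP; rewrite addr_eq0 => /eqP.
Qed.

Lemma alt_mx2_det G x y : alt_mx2 G ->
  (x *m G *m y^T) 0 0 = G 0 1 * \det (col_mx x y : 'M[S]_2).
Proof. by case=> G00 G11 G10; rewrite formE G00 G11 G10 det_col2; ring. Qed.

Lemma alt_mx2_congr G A : alt_mx2 G -> (A *m G *m A^T) 0 1 = G 0 1 * \det A.
Proof.
move=> Galt; have -> : (A *m G *m A^T) 0 1 = (row 0 A *m G *m (row 1 A)^T) 0 0.
  by rewrite -row_mul [LHS]mxE [RHS]mxE; apply: eq_bigr => l _; rewrite !mxE.
by rewrite alt_mx2_det // det_col2 det_mx22 !mxE.
Qed.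

Lemma det_alt_mx2 G : alt_mx2 G -> \det G = G 0 1 ^+ 2.
Proof. by case=> G00 G11 G10; rewrite det_mx22 G00 G11 G10; ring. Qed.
End AlternatingMx2.

Lemma map_alt_mx2 (S S' : comNzRingType) (h : {rmorphism S -> S'}) (G : 'M[S]_2) :
  alt_mx2 G -> alt_mx2 (map_mx h G).
Proof. by case=> G00 G11 G10; split; rewrite !mxE ?G00 ?G11 ?G10 ?rmorph0 ?rmorphN. Qed.

Section AlternatingRank2.
Variables (R : realType) (K Q : fieldExtType rat).
Variables (M : hodge_dR R K Q 2) (w : int) (A : hodge_dR R K Q 1).
Variables (f : emb R K -> 'M[Q]_(2 * 2, 1)) (g : 'M[tens Q K]_(2 * 2, 1)).
Variable sigma : emb R K.
Hypothesis hpol : alternating_polarization M w A f g.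
Hypothesis cmp_unit : forall rho, cmp M sigma rho \in unitmx.
Let f01 : Q := gram (f sigma) 0 1.
Let g01 : tens Q K := gram g 0 1.

Let altf : alt_mx2 (gram (f sigma)).
Proof. by apply: alt_mx2P => x; have [_ h _] := hpol; rewrite -pairingE; apply: h. Qed.
Let altg : alt_mx2 (gram g).
Proof. by apply: alt_mx2P => x; have [_ _ h] := hpol; rewrite -pairingE; apply: h. Qed.

(** In rank two an alternating form is its (0,1) entry times the determinant, so compatibility of
    the Betti and de Rham pairings is one scalar equation. Nondegeneracy makes [g01] a
    nonzerodivisor of Q ⊗ K, hence a unit, so it is nonzero at every embedding. *)
Lemma alternating_periods :
  [/\ f01 != 0, forall rho, ev rho sigma g01 != 0,
      forall rho, delta A sigma rho != 0,
      forall x y, pairing g x y 0 0 = g01 * \det (col_mx x y : 'M[tens Q K]_2)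
    & forall rho, two_pi_i R ^ (- w) * delta A sigma rho * rho f01 =
        ev rho sigma g01 * \det (cmp M sigma rho)].
Proof.
have [[hmor hf hg] _ _] := hpol.
have eq rho : two_pi_i R ^ (- w) * delta A sigma rho * rho f01 =
        ev rho sigma g01 * \det (cmp M sigma rho).
  have /matrixP/(_ 0 1) := morphism_gram sigma rho hmor.
  rewrite alt_mx2_congr; last exact: map_alt_mx2.
  by rewrite mxE [map_mx _ _ _ _]mxE => ->; rewrite mxE.
have gE x y : pairing g x y 0 0 = g01 * \det (col_mx x y : 'M[tens Q K]_2).
  by rewrite pairingE alt_mx2_det.
have f0 : f01 != 0.
  have := nondegenerate_gram (hf sigma); rewrite unitmxE unitfE det_alt_mx2 //.
  by rewrite expf_eq0.
have [y gy] : exists y, g01 * y = 1.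
  apply: regular_tens_unit => y gy; pose v : 'rV[tens Q K]_2 := \row_k (if k == 0 then y else 0).
  have /rowP/(_ 0) : v = 0.
    apply: hg => z; apply/matrixP => i k; rewrite !ord1 gE [RHS]mxE det_col2 !mxE /=.
    by rewrite mul0r subr0 mulrA gy mul0r.
  by rewrite !mxE.
have g0 rho : ev rho sigma g01 != 0.
  apply/eqP => g0; have /eqP := congr1 (ev rho sigma) gy.
  by rewrite rmorphM /= g0 mul0r rmorph1 eq_sym oner_eq0.
split=> // rho; apply/eqP => d0; have /eqP := eq rho; rewrite d0 mulr0 mul0r eq_sym mulf_eq0.
rewrite (negPf (g0 rho)) /=; apply/negP.
by have := cmp_unit rho; rewrite unitmxE unitfE.
Qed.

Lemma alternating_gram_unit rho : map_mx (ev rho sigma) (gram g) \in unitmx.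
Proof.
have [_ /(_ rho) g0 _ _ _] := alternating_periods.
rewrite unitmxE unitfE det_alt_mx2; last exact: map_alt_mx2.
by rewrite expf_eq0 mxE.
Qed.
End AlternatingRank2.

(** * The +1-eigenspace of a tensor product *)

(** If the two basis vectors and their sum are all eigenvectors, F is scalar. *)
Lemma cyclic_vector2 (E : fieldType) (F : 'M[E]_2) :
  (forall c, F != c%:M) -> exists g : 'rV[E]_2, \det (col_mx g (g *m F) : 'M[E]_2) != 0.
Proof.
move=> Fns; apply: contrapT => h.
have {}h (g : 'rV[E]_2) : \det (col_mx g (g *m F) : 'M[E]_2) = 0.
  by apply/eqP/negPn/negP => g0; apply: h; exists g.
pose v (a b : E) : 'rV[E]_2 := \row_k (if k == 0 then a else b).
have Z a b : a * (a * F 0 1 + b * F 1 1) - b * (a * F 0 0 + b * F 1 0) = 0.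
  by have := h (v a b); rewrite det_col2 !mxE !sum_ord2 !mxE /= => <-.
have F01 : F 0 1 = 0 by have := Z 1 0; rewrite !mul1r !mul0r subr0 addr0.
have F10 : F 1 0 = 0.
  by have := Z 0 1; rewrite !mul1r !mul0r sub0r add0r => /eqP; rewrite oppr_eq0 => /eqP.
have F11 : F 1 1 = F 0 0.
  by have := Z 1 1; rewrite F01 F10 !mul1r add0r addr0 => /eqP; rewrite subr_eq0 => /eqP.
have /eqP[] := Fns (F 0 0); apply/matrixP => i k; rewrite !mxE.
have c (l : 'I_2) : l = 0 \/ l = 1.
  by case: l => [[|[|m]] hm] //; [left|right]; apply/val_inj.
by case: (c i) => ->; case: (c k) => ->; rewrite ?F01 ?F10 ?F11 ?eqxx.
Qed.

Section Antidiagonal.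
Variables (C : fieldType) (d : nat) (lam : 'I_d -> C).

Lemma antidiag_involution i : antidiag lam *m antidiag lam = 1%:M ->
  lam i * lam (rev_ord i) = 1.
Proof.
move/(congr1 (row i)); rewrite mul_antidiag => /rowP/(_ i).
by rewrite !mxE rev_ordK eqxx.
Qed.

Lemma antidiag_conj (F Om : 'M[C]_d) : Om \in unitmx -> F *m F = 1%:M ->
  Om *m F = antidiag lam *m Om -> antidiag lam *m antidiag lam = 1%:M.
Proof.
move=> Omu FF OmF; apply: (can_inj (mulmxK Omu)).
by rewrite -!mulmxA -OmF mulmxA -OmF -mulmxA FF mulmx1 mul1mx.
Qed.

Lemma det_antidiag : \det (antidiag lam) = \prod_i lam i * \det (antidiag (fun _ : 'I_d => 1 : C)).
Proof.
have -> : antidiag lam = diag_mx (\row_i lam i) *m antidiag (fun=> 1).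
  apply/row_matrixP => i; rewrite [RHS]row_mul row_diag_mx -scalemxAl -rowE.
  by apply/rowP => k; rewrite !mxE mulr_natr.
by rewrite det_mulmx det_diag; congr (_ * _); apply: eq_bigr => i _; rewrite mxE.
Qed.

(** In the full product, the factors with index at least r are the inverses of those with index
    below d - r. This is where r turns into d - r. *)
Lemma prod_antidiag r : (r <= d)%N -> (forall i, lam i * lam (rev_ord i) = 1) ->
  \prod_(k < d | (k < r)%N) lam k = \prod_k lam k * \prod_(k < d | (k < d - r)%N) lam k.
Proof.
move=> rd lam1; rewrite [X in _ = X * _](bigID (fun k : 'I_d => k < r)%N) /= -mulrA.
rewrite [X in _ * (X * _)](reindex_inj rev_ord_inj) /=.
rewrite [X in _ * (X * _)](eq_bigl (fun k : 'I_d => k < d - r)%N) => [|k]; last first.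
  by have := ltn_ord k; lia.
rewrite -big_split /= [X in _ * X]big1 ?mulr1 // => k _.
by rewrite mulrC lam1.
Qed.

Lemma mxtrace_antidiag : \tr (antidiag lam) = \sum_(i | i == rev_ord i) lam i.
Proof.
by rewrite [RHS]big_mkcond; apply: eq_bigr => i _; rewrite mxE; case: eqP.
Qed.
End Antidiagonal.

Section PlusPart.
Variables (C : fieldType) (d r : nat).
Hypothesis le_rd : (r <= d)%N.
Hypothesis rev_lt : forall k : 'I_d, (r <= k)%N -> (rev_ord k < r)%N.
Variables (F Om I N w : 'M[C]_d) (lam : 'I_d -> C).
Hypotheses (FF : F *m F = 1%:M) (Om_unit : Om \in unitmx).
Hypothesis OmF : Om *m F = antidiag lam *m Om.
Hypotheses (N1 : forall i, N i i = 1) (N0 : forall i k : 'I_d, (i < k)%N -> N i k = 0).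
Hypothesis OmI : Om *m I = N *m w.
Variables (F' Om' I' N' w' : 'M[C]_2) (lam' : 'I_2 -> C).
Hypotheses (FF' : F' *m F' = 1%:M) (Om_unit' : Om' \in unitmx).
Hypothesis OmF' : Om' *m F' = antidiag lam' *m Om'.
Hypotheses (N1' : forall i, N' i i = 1) (N0' : forall i k : 'I_2, (i < k)%N -> N' i k = 0).
Hypothesis OmI' : Om' *m I' = N' *m w'.
Variable P : 'M[C]_(d * 2, d).
Hypothesis kill0 : forall k : 'I_d, (k < r)%N ->
  row k w *m tensr d (row 0 w') *m P = 0.
Hypothesis kill1 : forall k : 'I_d, (r <= k)%N ->
  row (rev_ord k) w *m tensr d (row 1 w') *m P = 0.
Variables (g : 'rV[C]_2) (a b : C).
Hypothesis gE : g = a *: row 0 Om' + b *: row 1 Om'.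
Let l := lam' 0.

Lemma antidiag2_inv : l * lam' 1 = 1.
Proof.
have := antidiag_involution 0 (antidiag_conj Om_unit' FF' OmF').
by have -> : rev_ord 0 = 1 :> 'I_2 by apply/val_inj.
Qed.

Lemma mul_frob_cyclic : g *m F' = (b / l) *: row 0 Om' + (a * l) *: row 1 Om'.
Proof.
rewrite gE mulmxDl -!scalemxAl -!row_mul OmF' !mul_antidiag !scalerA.
have -> : rev_ord 0 = 1 :> 'I_2 by apply/val_inj.
have -> : rev_ord 1 = 0 :> 'I_2 by apply/val_inj.
have l0 : l != 0 by apply/eqP => l0; have /eqP := antidiag2_inv; rewrite l0 mul0r eq_sym oner_eq0.
by rewrite addrC; congr (_ * _ *: _ + _); apply: (mulfI l0); rewrite antidiag2_inv mulfV.
Qed.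

(** With g = a Omega'_1 + b Omega'_2 one has g F' = (b/l) Omega'_1 + a l Omega'_2. As F squares to
    1, the map x |-> x ⊗ g + x F ⊗ g F' is then a + (b/l) F followed by x |-> x ⊗ Omega'_1 + l x F ⊗
    Omega'_2, whose determinant modulo the filtration is given by [det_quotient]. So the second
    coefficient next to F is [b / l], not the bare coordinate [b]. *)
Lemma det_plus_part :
  \det Om * \det ((tensr d g + F *m tensr d (g *m F')) *m (I *t I') *m P) =
  \det (a%:M + (b / l) *: F) *
    (l ^+ r * \prod_(k < d | (k < r)%N) lam k * \det (quot_rows r w (row 0 w') (row 1 w') P)).
Proof.
have row0 : row 0 (Om' *m I') = row 0 w'.
  rewrite OmI' row_mul [LHS]mulmx_sum_row big_ord_recl big_ord1 !mxE N1' scale1r N0' //.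
  by rewrite scale0r addr0.
have row1 : row 1 (Om' *m I') = row 1 w' + N' 1 0 *: row 0 w'.
  rewrite OmI' row_mul [LHS]mulmx_sum_row big_ord_recl big_ord1 !mxE.
  have -> : lift ord0 ord0 = 1 :> 'I_2 by apply/val_inj.
  by rewrite N1' scale1r addrC.
have <- := det_quotient le_rd rev_lt (N' 1 0) l lam N1 N0 kill0 kill1.
have l0 : l != 0 by apply/eqP => l0; have /eqP := antidiag2_inv; rewrite l0 mul0r eq_sym oner_eq0.
have FO2 := antidiag_conj Om_unit FF OmF.
have -> : \det (a%:M + (b / l) *: F) = \det (a%:M + (b / l) *: antidiag lam).
  have : Om *m (a%:M + (b / l) *: F) = (a%:M + (b / l) *: antidiag lam) *m Om.
    by rewrite mulmxDr mulmxDl -scalemxAr OmF scalemxAl scalar_mxC.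
  move/(congr1 determinant); rewrite !det_mulmx mulrC; apply: mulIf.
  by rewrite -unitfE -unitmxE.
rewrite -!det_mulmx !mulmxA; congr (\det (_ *m P)).
set FO := antidiag lam in FO2 *.
have OmF1 : Om *m F = FO *m Om := OmF.
have gI : g *m I' = a *: row 0 (Om' *m I') + b *: row 1 (Om' *m I').
  by rewrite gE mulmxDl -!scalemxAl -!row_mul.
have gFI : g *m F' *m I' = (b / l) *: row 0 (Om' *m I') + (a * l) *: row 1 (Om' *m I').
  by rewrite mul_frob_cyclic mulmxDl -!scalemxAl -!row_mul.
rewrite -[LHS]mulmxA mulmxDl -(mulmxA F) !tensr_mul gI gFI row0 row1.
set T0 := tensr d (row 0 w'); set T1 := tensr d (row 1 w' + _).
rewrite !tensrD !tensrZ -/T0 -/T1 -OmI.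
(* The square of [FO], equal to 1, is inserted in the [b] term so that a + (b/l) [FO] can be
   factored out. *)
have -> : Om *m (I *m (a *: T0 + b *: T1) + F *m (I *m ((b / l) *: T0 + (a * l) *: T1))) =
    a *: (Om *m I *m T0) + b *: (FO *m FO *m (Om *m I) *m T1)
    + ((b / l) *: (FO *m (Om *m I) *m T0) + (a * l) *: (FO *m (Om *m I) *m T1)).
  by rewrite FO2 mul1mx !mulmxDr !mulmxA OmF1 -!scalemxAr.
rewrite [RHS]mulmxDl !mulmxDr !mul_scalar_mx -!scalemxAl -!scalemxAr !scalerA !mulmxA.
rewrite -(mulrA b) mulVf // mulr1 -?(mulmxA _ N w) -?OmI ?mulmxA -[LHS]addrA -[RHS]addrA; congr (_ + _).
by rewrite [RHS]addrC addrA; congr (_ + _); rewrite addrC.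
Qed.
End PlusPart.

Lemma rank_eigenspaces (E : fieldType) d (F : 'M[E]_d) :
  2%:R != 0 :> E -> F *m F = 1%:M ->
  (\rank (eigenspace F 1) + \rank (eigenspace F (-1)) = d)%N.
Proof.
move=> E2 FF; have [V [e [Vu VF]]] := involution_diag E2 FF.
rewrite -[1]/((-1)^+false) -[X in (_ + \rank (eigenspace _ X))%N]/((-1) ^+ true).
rewrite !(rank_eigenspace_diag E2 _ Vu VF) -big_split /= -[RHS]card_ord -sum1_card.
by apply: eq_bigr => i _; case: (e i).
Qed.

Section Parity.
Variables (R : realType) (E : fieldExtType rat) (d : nat) (F : 'M[E]_d).
Variables (phi : emb R E) (Om : 'M[R[i]]_d) (lam : 'I_d -> R[i]).
Hypotheses (FF : F *m F = 1%:M) (Omu : Om \in unitmx).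
Hypothesis OmF : Om *m map_mx phi F = antidiag lam *m Om.
Let dp := \rank (eigenspace F 1).
Let dm := \rank (eigenspace F (-1)).

Let E2 : 2%:R != 0 :> E.
Proof. by rewrite -(fmorph_eq0 phi) rmorph_nat pnatr_eq0. Qed.

(* The trace of an antidiagonal matrix is its central entry, if any, which is
   here a sign. *)
Lemma involution_parity :
  if odd d then if (dm < dp)%N then dp = dm.+1 else dm = dp.+1 else dp = dm.
Proof.
have sumd := rank_eigenspaces E2 FF; have trF := mxtrace_involution E2 FF.
rewrite -/dp -/dm in sumd trF.
have FFC : map_mx phi F *m map_mx phi F = 1%:M by rewrite -map_mxM FF map_mx1.
have lam1 i := antidiag_involution i (antidiag_conj Omu FFC OmF).
have {}trF : \sum_(i | i == rev_ord i) lam i + dm%:R = dp%:R.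
  rewrite -mxtrace_antidiag -(rmorph_nat phi dp) -trF rmorphD rmorph_nat; congr (_ + _).
  have -> : antidiag lam = Om *m map_mx phi F *m invmx Om by rewrite OmF mulmxK.
  by rewrite mxtrace_mulC mulmxA mulVmx // mul1mx trace_map_mx.
have [od|ed] := boolP (odd d).
  have lt0 : (d./2 < d)%N by lia.
  pose i0 := Ordinal lt0.
  have i0E : i0 = rev_ord i0 by apply/val_inj; rewrite /=; lia.
  have sumE : \sum_(i | i == rev_ord i) lam i = lam i0.
    rewrite (big_pred1 i0) // => i; rewrite -[LHS](inj_eq val_inj) -[RHS](inj_eq val_inj) /=.
    by have := ltn_ord i; do 2!case: eqP => //=; lia.
  have : lam i0 ^+ 2 == 1 by rewrite expr2 {2}i0E lam1.
  rewrite sqrf_eq1 => /orP[] /eqP lE; move: trF; rewrite sumE lE.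
    move/eqP; rewrite -[1]/(1%:R) -natrD eqr_nat => /eqP dE.
    have -> : (dm < dp)%N by lia.
    by lia.
  rewrite addrC => /eqP; rewrite subr_eq -[1]/(1%:R) -natrD eqr_nat => /eqP dE.
  have -> : (dm < dp)%N = false by lia.
  by lia.
move: trF; rewrite big_pred0 ?add0r => [/eqP|i].
  by rewrite eqr_nat => /eqP ->.
by rewrite -[LHS](inj_eq val_inj) /=; have := ltn_ord i; case: eqP => //=; lia.
Qed.

(** The determinant is (a + b)^(d^+) (a - b)^(d^-), and the larger exponent is [uphalf d]. For odd d
    the factor with the smaller exponent is counted once too often in the power of the product; its
    inverse is what becomes the period a^±. *)
Lemma det_involution_parity (a b : R[i]) :
  a + b != 0 -> a - b != 0 ->
  \det (a%:M + b *: map_mx phi F) = ((a + b) * (a - b)) ^+ uphalf d *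
    (if odd d then if (dm < dp)%N then (a - b)^-1 else (a + b)^-1 else 1).
Proof.
move=> ab0 ab1; rewrite (det_involution E2 FF) -/dp -/dm.
have := rank_eigenspaces E2 FF; rewrite -/dp -/dm => sumd.
have := involution_parity; case: ifP => [od|/negbT ed].
  case: ifP => _ dE.
    have -> : uphalf d = dp by lia.
    by rewrite exprMn dE [(a - b) ^+ _.+1]exprSr mulrA mulfK.
  have -> : uphalf d = dm by lia.
  by rewrite exprMn dE [(a + b) ^+ _.+1]exprSr mulrAC mulfK.
move=> dE; have -> : uphalf d = dp by lia.
by rewrite -dE mulr1 exprMn.
Qed.
End Parity.

Lemma span_ind (S : comNzRingType) d (U : set 'rV[S]_d) (Pr : 'rV[S]_d -> Prop) x :
  Pr 0 -> (forall a y z, Pr y -> Pr z -> Pr (a *: y + z)) ->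
  (forall u, U u -> Pr u) -> Defs.span U x -> Pr x.
Proof.
move=> Pr0 PrD PrU [n [c [v [vU ->]]]]; rewrite mulmx_sum_row.
by elim/big_rec: _ => // i z _ Prz; apply: PrD => //; apply: PrU.
Qed.

(** [is_r] compares t only with the two neighbours of r; monotonicity of p gives the other
    indices. *)
Lemma is_r_lt d (w : int) (p : 'I_d -> int) t r :
  (forall i k : 'I_d, (i < k)%N -> p k < p i) -> is_r w p t r ->
  (forall i : 'I_d, (i < r)%N -> w - 2 * p i < t) /\
  (forall i : 'I_d, (r <= i)%N -> t < w - 2 * p i).
Proof.
move=> pdec [rd hr].
have ple (i k : 'I_d) : (i <= k)%N -> p k <= p i.
  rewrite leq_eqVlt => /orP[/eqP/val_inj-> //|/pdec/ltW //].
split=> i ir.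
  have lt_d : (r.-1 < d)%N by have := ltn_ord i; lia.
  have [/(_ _)/= + _] := hr (Ordinal lt_d); have := ple i (Ordinal lt_d).
  by rewrite /=; lia.
have lt_d : (r < d)%N by have := ltn_ord i; lia.
have [_ +] := hr (Ordinal lt_d); have := ple (Ordinal lt_d) i ir.
by move=> + /(_ erefl); lia.
Qed.

(** * The middle step of the filtration *)

(** If i and rev i were both at least r, t would be smaller than w - 2 p_i and than w - 2 p_(rev i),
    which are opposite numbers. *)
Lemma is_r_rev_lt d (w : int) (p : 'I_d -> int) t r :
  (forall i k : 'I_d, (i < k)%N -> p k < p i) -> (forall i, p i + p (rev_ord i) = w) ->
  0 < t -> is_r w p t r -> forall i : 'I_d, (r <= i)%N -> (rev_ord i < r)%N.
Proof.
move=> p_dec p_sym t0 hr i ri; rewrite ltnNge; apply/negP => rri.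
have [_ h] := is_r_lt p_dec hr; have := h _ ri; have := h _ rri.
by have := p_sym i; lia.
Qed.

Section TensorFiltration.
Variables (R : realType) (K E Q F : fieldExtType rat) (d : nat).
Variables (iE : {rmorphism E -> F}) (iQ : {rmorphism Q -> F}).
Variables (M : hodge_dR R K E d) (N : hodge_dR R K Q 2) (sigma : emb R K) (psi : emb R F).
Let phi : emb R E := psi \o iE.
Let rho : emb R Q := psi \o iQ.
Let MN := tensor (ext_coeff iE M) (ext_coeff iQ N).
Local Notation C := R[i].

Lemma map_ext_coeff n (k : fieldExtType rat) (i : {rmorphism k -> F}) (X : hodge_dR R K k n) q x :
  fil (ext_coeff i X) q x -> filC X sigma (psi \o i) q (map_mx (ev psi sigma) x).
Proof.
apply: map_span => _ [y yq <-]; exists y => //.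
by apply/matrixP => a b; rewrite !mxE; exact/esym/ev_ext.
Qed.

Variables (m : int) (k : nat) (P : 'M[tens F K]_(d * 2, k)).
Hypothesis filP : forall x, fil MN m x <-> x *m P = 0.
Let Pc := map_mx (ev psi sigma) P.

Section Kill.
Hypothesis fil_dec : forall q q' x, q <= q' -> fil M q' x -> fil M q x.

Lemma tensor_fil_kill q q' x x' : m <= q + q' ->
  filC M sigma phi q x -> filC N sigma rho q' x' -> x *m tensr d x' *m Pc = 0.
Proof.
(* The filtration of a tensor product is generated by pairs of indices with exact sum, so q is
   lowered to m - q' first. *)
move=> mqq' /(filC_dec (q := m - q') fil_dec) xq x'q'.
have {}xq : filC M sigma phi (m - q') x by apply: xq; rewrite lerBlDr.
pose B (x : 'rV[C]_d) (x' : 'rV[C]_2) := x *m tensr d x' *m Pc.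
rewrite -[LHS]/(B x x').
have Bl a y z t : B (a *: y + z) t = a *: B y t + B z t.
  by rewrite /B !mulmxDl -!scalemxAl.
have Br a y z t : B t (a *: y + z) = a *: B t y + B t z.
  by rewrite /B tensrD tensrZ !mulmxDr !mulmxDl -!scalemxAr -!scalemxAl.
apply: (span_ind (Pr := fun x => B x x' = 0) _ _ _ xq).
- by rewrite /B !mul0mx.
- by move=> a y z y0 z0; rewrite Bl y0 z0 scaler0 addr0.
move=> _ [y0 y0q <-].
apply: (span_ind (Pr := fun x' => B _ x' = 0) _ _ _ x'q').
- rewrite /B (_ : tensr d 0 = 0) ?mulmx0 ?mul0mx //.
  by apply/matrixP => a b; rewrite !mxE mulr0.
- by move=> a y z y1 z1; rewrite Br y1 z1 scaler0 addr0.
move=> _ [z0 z0q <-]; rewrite /B mul_tensr.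
pose ext (l : fieldExtType rat) (i : {rmorphism l -> F}) n (x : 'rV[tens l K]_n) :=
  map_mx (tens_map (fun e => pure (i e) 1) (pure (1 : F))) x : 'rV[tens F K]_n.
have extE (l : fieldExtType rat) (i : {rmorphism l -> F}) n (x0 : 'rV[tens l K]_n) :
    map_mx (ev (psi \o i) sigma) x0 = map_mx (ev psi sigma) (ext l i n x0).
  by apply/matrixP => a b; rewrite !mxE; exact/esym/ev_ext.
rewrite !extE -(@map_mxT _ _ (ev psi sigma) 1 d 1 2) -map_mxM.
have /filP -> : fil MN m (ext _ iE _ y0 *t ext _ iQ _ z0 : 'rV_(d * 2)).
  apply: sub_span; exists (m - q'), q', (ext _ iE _ y0), (ext _ iQ _ z0); split=> //.
  - by rewrite subrK.
  - by apply: sub_span; exists y0.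
  - by apply: sub_span; exists z0.
by rewrite raddf0.
Qed.
End Kill.

Hypothesis P_surj : forall y : 'rV[tens F K]_k, exists x, y = x *m P.

Lemma surj_section (S : comNzRingType) n l (B : 'M[S]_(n, l)) :
  (forall y : 'rV[S]_l, exists x, y = x *m B) -> exists Z, Z *m B = 1%:M.
Proof.
move=> Bs; have /choice[z zE] : forall i : 'I_l, exists x, row i 1%:M = x *m B.
  by move=> i; apply: Bs.
by exists (\matrix_i z i); apply/row_matrixP => i; rewrite row_mul rowK zE.
Qed.

Lemma rank_Pc : \rank Pc = k.
Proof.
have [Z ZP] := surj_section P_surj.
have : map_mx (ev psi sigma) Z *m Pc = 1%:M by rewrite -map_mxM ZP map_mx1.
move=> ZPc; apply/eqP; rewrite eqn_leq rank_leq_col /=.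
by rewrite -[X in (X <= _)%N](mxrank1 C) -ZPc mxrankM_maxr.
Qed.

(** A section [Z] of [P] makes 1 - P Z a projector onto the kernel, defined over F ⊗ K. Hence the
    complex kernel is spanned by rational elements of F^m. *)
Lemma ker_filC x : x *m Pc = 0 -> filC MN sigma psi m x.
Proof.
have [Z ZP] := surj_section P_surj => xP.
exists (d * 2)%N, x, (map_mx (ev psi sigma) (1%:M - P *m Z)); split.
  move=> i; exists (row i (1%:M - P *m Z)); last by rewrite map_row.
  by apply/filP; rewrite -row_mul mulmxBl mul1mx -mulmxA ZP mulmx1 subrr row0.
by rewrite map_mxB map_mx1 map_mxM mulmxBr mulmx1 mulmxA xP mul0mx subr0.
Qed.

Section Middle.
Variables (w : int) (p : 'I_d -> int) (p' : 'I_2 -> int) (r : nat).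
Variables (om : 'M[C]_d) (om' : 'M[C]_2).
Hypothesis p_dec : forall i l : 'I_d, (i < l)%N -> p l < p i.
Hypothesis p_sym : forall i, p i + p (rev_ord i) = w.
Hypothesis hr : is_r w p (p' 0 - p' 1) r.
Hypothesis coordM : forall q x, filC M sigma phi q x ->
  exists c : 'rV_d, x = c *m om /\ forall l, p l < q -> c 0 l = 0.
Hypothesis coordN : forall q x, filC N sigma rho q x ->
  exists c : 'rV_2, x = c *m om' /\ forall l, p' l < q -> c 0 l = 0.
Hypothesis kd : k = d.

(* Otherwise [F^m], of rank d, would be spanned by fewer than d vectors. *)
Lemma middle_step :
  (forall i : 'I_d, (i < r)%N -> m <= p i + p' 0) /\
  (forall i : 'I_d, (r <= i)%N -> m <= p (rev_ord i) + p' 1).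
Proof.
have [lt_r ge_r] := is_r_lt p_dec hr.
(* [T i] is the level in the filtration of the vector [z i] below; these d vectors are the ones
   expected to span F^m. *)
pose T (i : 'I_d) := if (i < r)%N then p i + p' 0 else p (rev_ord i) + p' 1.
suff mT i : m <= T i.
  by split=> i ir; have := mT i; rewrite /T ?ir // ltnNge ir.
rewrite leNgt; apply/negP => Tm.
pose z (l : 'I_d) := if (l < r)%N then row l om *m tensr d (row 0 om')
  else row (rev_ord l) om *m tensr d (row 1 om').
pose Z := \matrix_l (if l == i then 0 else z l).
have rankZ : (\rank Z < d)%N.
  rewrite ltn_neqAle rank_leq_row andbT; apply/negP => Zfree.
  have : delta_mx 0 i *m Z = 0 :> 'rV[C]__ by rewrite -rowE rowK eqxx.
  move/eqP; rewrite mulmx_free_eq0 // => /eqP/rowP/(_ i)/eqP.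
  by rewrite !mxE !eqxx oner_eq0.
have zZ l : l != i -> (z l <= Z)%MS.
  by move=> li; have := row_sub l Z; rewrite rowK (negPf li).
(* Each [T i] exceeds half the sum w + p'_0 + p'_1, whereas every tensor of basis vectors not among
   the [z l] lies below it. So if [T i] < m, only the [z l] with l different from i can reach level
   m. *)
have half : w + p' 0 + p' 1 < 2 * T i.
  rewrite /T; case: ltnP => [/lt_r|/ge_r]; first by lia.
  by have := p_sym i; lia.
have gen (a : 'I_d) (b : 'I_2) : m <= p a + p' b ->
    (row a om *m tensr d (row b om') <= Z)%MS.
  have [->|b1] := eqVneq b 0.
    move=> ma; have [ar|ra] := ltnP a r.
      have := zZ a; rewrite /z ar; apply.
      by apply: contraTneq Tm => <-; rewrite /T ar -leNgt.
    by exfalso; have := ge_r _ ra; lia.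
  have -> : b = 1 by apply/val_inj; case: b b1 => [[|[|b]]].
  move=> ma; have [ar|ra] := ltnP (rev_ord a) r.
    by exfalso; have := lt_r _ ar; have := p_sym a; lia.
  have := zZ (rev_ord a); rewrite /z ltnNge ra /= rev_ordK; apply.
  by apply: contraTneq Tm => <-; rewrite /T ltnNge ra /= rev_ordK -leNgt.
have sub : (kermx Pc <= Z)%MS.
  apply/row_subP => a; have /ker_filC : row a (kermx Pc) *m Pc = 0.
    by apply/sub_kermxP/row_sub.
  apply: span_submx => _ [y ym <-].
  apply: (span_ind (Pr := fun y => (map_mx (ev psi sigma) y <= Z)%MS) _ _ _ ym).
  - by rewrite raddf0 sub0mx.
  - move=> c y0 y1 h0 h1; rewrite raddfD /= map_mxZ addmx_sub ?scalemx_sub //.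
  move=> _ [q [q' [x [x' [qq' /map_ext_coeff/coordM[c [xE c0]] /map_ext_coeff/coordN[c' [x'E c'0]] ->]]]]].
  rewrite (@map_mxT _ _ (ev psi sigma) 1 d 1 2) -mul_tensr.
  rewrite xE [c *m om]mulmx_sum_row mulmx_suml summx_sub // => l _.
  rewrite x'E [c' *m om']mulmx_sum_row.
  have -> : tensr d (\sum_i0 c' 0 i0 *: row i0 om') = \sum_i0 c' 0 i0 *: tensr d (row i0 om').
    elim/big_rec2: _ => [|b u v _ <-]; last by rewrite tensrD tensrZ.
    by apply/matrixP => a0 b0; rewrite !mxE mulr0.
  rewrite mulmx_sumr summx_sub // => b _.
  rewrite -scalemxAl -scalemxAr.
  have [pl|pl] := ltP (p l) q; first by rewrite c0 // scale0r sub0mx.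
  have [pb|pb] := ltP (p' b) q'; first by rewrite c'0 // scale0r scaler0 sub0mx.
  by rewrite !scalemx_sub // gen // -qq' lerD.
(* The kernel of [Pc] has rank 2d - d = d, more than the rank of [Z]. *)
have := mxrankS sub; rewrite mxrank_ker rank_Pc.
by rewrite kd; lia.
Qed.
End Middle.
End TensorFiltration.

(** * Periods *)

(** The basis hidden in the period and the chosen one [X] differ by an invertible matrix over E,
    whose determinant is [y]: one constant serves all embeddings. *)
Lemma period_wrt_basis (R : realType) (K E : fieldExtType rat) d (M : hodge_dR R K E d)
    sigma b m (c : emb R E -> R[i]) k (X : 'M[E]_(k, d)) :
  period_wrt M sigma b m c -> row_free X -> (X :=: Mpm M sigma b)%MS ->
  exists (y : E) (P : 'M[tens E K]_(d, k)),
  [/\ y != 0, forall z : 'rV_k, exists x, z = x *m P,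
      forall x, fil M m x <-> x *m P = 0
    & forall phi, c phi != 0 /\ c phi = phi y *
        \det (map_mx phi X *m cmp M sigma phi *m map_mx (ev phi sigma) P)].
Proof.
move=> [B [P [BM Psurj Pker cE]]] Xfree XM.
have kE : dpm M sigma b = k by rewrite /dpm -XM; apply/eqP.
move: B P BM Psurj Pker cE; rewrite kE => B P BM Psurj Pker cE.
have /submxP[D BD] : (B <= X)%MS by rewrite BM XM.
have rB : \rank B = k by rewrite BM -kE.
have Du : D \in unitmx.
  rewrite -row_free_unit /row_free eqn_leq rank_leq_row -[X in (X <= _)%N]rB BD.
  exact: mxrankM_maxl.
exists (\det D), P; split=> //; first by rewrite -unitfE -unitmxE.
move=> phi; have [cphi c0] := cE phi; split=> //.
by rewrite cphi BD map_mxM -!mulmxA det_mulmx det_map_mx !mulmxA.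
Qed.

Section PlusEigenspace.
Variables (E : fieldType) (d : nat) (F : 'M[E]_d) (F' : 'M[E]_2) (g : 'rV[E]_2).
Hypotheses (FF : F *m F = 1%:M) (FF' : F' *m F' = 1%:M).
Hypothesis g_cyc : \det (col_mx g (g *m F') : 'M[E]_2) != 0.
Let X := tensr d g + F *m tensr d (g *m F').
Let G : 'M[E]_2 := col_mx g (g *m F').

Let tensr_coord (x : 'rV[E]_(d * 2)) :
  exists u v : 'rV[E]_d, x = u *m tensr d g + v *m tensr d (g *m F').
Proof.
have Gu : G \in unitmx by rewrite unitmxE unitfE.
have gE : g = delta_mx 0 0 *m G.
  by rewrite mul_col2 !mxE !eqxx scale1r scale0r addr0.
have gF'E : g *m F' = delta_mx 0 1 *m G.
  by rewrite mul_col2 !mxE !eqxx scale1r scale0r add0r.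
pose x' := x *m (1%:M *t invmx G).
exists (\row_i x' 0 (mxtens_index (i, 0))), (\row_i x' 0 (mxtens_index (i, 1))).
have x'E : x' = (\row_i x' 0 (mxtens_index (i, 0))) *m tensr d (delta_mx 0 0)
   + (\row_i x' 0 (mxtens_index (i, 1))) *m tensr d (delta_mx 0 1).
  apply/rowP => k; case: (mxtens_indexP k) => a b.
  rewrite mxE !mxE (bigD1 a) //= [X in _ + X + _]big1; last first.
    by move=> l la; rewrite !mxE mxtens_indexK /= (negPf la) mul0r mulr0.
  rewrite (bigD1 a) //= [X in _ = _ + (_ + X)]big1; last first.
    by move=> l la; rewrite !mxE mxtens_indexK /= (negPf la) mul0r mulr0.
  rewrite !mxE !mxtens_indexK /= !eqxx !mul1r !addr0.
  case: (eqVneq b 0) => [->|b0]; first by rewrite mulr1 mulr0 addr0.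
  have -> : b = 1 by apply/val_inj; case: b b0 => [[|[|b]]].
  by rewrite mulr1 mulr0 add0r.
have : x' *m (1%:M *t G) = x.
  rewrite /x' -mulmxA tensmx_mul mulmx1 mulVmx //.
  rewrite (_ : 1%:M *t 1%:M = 1%:M) ?mulmx1 //.
  apply/matrixP => k l; case: (mxtens_indexP k) => a b; case: (mxtens_indexP l) => a' b'.
  rewrite tensmxE !mxE -natrM mulnb; congr (nat_of_bool _)%:R.
  by rewrite (can_eq (@mxtens_indexK _ _)) xpair_eqE.
by rewrite {1}x'E mulmxDl -!mulmxA !tensr_mul -gE -gF'E !mul1mx => <-.
Qed.

Let tensr_free (u v : 'rV[E]_d) :
  u *m tensr d g + v *m tensr d (g *m F') = 0 -> u = 0.
Proof.
have Gu : G \in unitmx by rewrite unitmxE unitfE.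
have gE : g = delta_mx 0 0 *m G.
  by rewrite mul_col2 !mxE !eqxx scale1r scale0r addr0.
have gF'E : g *m F' = delta_mx 0 1 *m G.
  by rewrite mul_col2 !mxE !eqxx scale1r scale0r add0r.
move/(congr1 (fun x : 'rV[E]_(d * 2) => x *m (1%:M *t invmx G))).
rewrite mul0mx mulmxDl -!mulmxA !tensr_mul gF'E {1}gE !mulmxK // !mul1mx => /rowP uv.
apply/rowP => a; have := uv (mxtens_index (a, 0)).
rewrite !mxE (bigD1 a) //= [X in _ + X + _]big1; last first.
  by move=> l la; rewrite !mxE mxtens_indexK /= (negPf la) mul0r mulr0.
rewrite big1; last by move=> l la; rewrite !mxE mxtens_indexK /= !mulr0.
by rewrite !mxE mxtens_indexK /= !eqxx !mulr1 !addr0.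
Qed.

Lemma plus_eigenspace_free : row_free X.
Proof.
rewrite -kermx_eq0; apply/rowV0P => u /sub_kermxP.
by rewrite mulmxDr mulmxA => /tensr_free.
Qed.

(** Any vector is u ⊗ g + v ⊗ g F', and F ⊗ F' sends it to v F ⊗ g + u F ⊗ g F'. It is fixed exactly
    when v = u F. *)
Lemma plus_eigenspace : (X :=: eigenspace (F *t F') 1)%MS.
Proof.
have gFF : g *m F' *m F' = g by rewrite -mulmxA FF' mulmx1.
apply/eqmxP/andP; split.
  apply/eigenspaceP; rewrite scale1r mulmxDl -mulmxA !tensr_mul gFF mulmxA FF mul1mx.
  by rewrite addrC.
apply/row_subP => i; set x := row i _.
have /eigenspaceP : (x <= eigenspace (F *t F') 1)%MS by apply: row_sub.
have [u [v ->]] := tensr_coord x.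
rewrite scale1r mulmxDl -!mulmxA !tensr_mul gFF !mulmxA => /eqP.
rewrite addrC -subr_eq0 opprD addrACA -!mulmxBl => /eqP/tensr_free/eqP.
rewrite subr_eq0 => /eqP uE; apply/submxP; exists u.
by rewrite mulmxDr mulmxA (_ : u *m F = v) // -uE -mulmxA FF mulmx1.
Qed.
End PlusEigenspace.

Section DualEigenspace.
Variables (E : fieldType) (F' : 'M[E]_2) (g : 'rV[E]_2) (b : bool).
Hypotheses (FF' : F' *m F' = 1%:M).
Hypothesis g_cyc : \det (col_mx g (g *m F') : 'M[E]_2) != 0.

(** f is the linear form with value 1 at g and ±1 at g F'. An eigenform for the sign is determined
    by its value at g, so the eigenspace is a line. *)
Lemma dual_eigenspace : exists f : 'rV[E]_2,
  [/\ row_free f, (f :=: eigenspace (invmx F')^T ((-1) ^+ b))%MS,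
      f *m F'^T = (-1) ^+ b *: f & f *m g^T = 1%:M].
Proof.
pose G : 'M[E]_2 := col_mx g (g *m F').
have Gu : G^T \in unitmx by rewrite unitmx_tr unitmxE unitfE.
have FV : invmx F' = F'.
  have [Fu _] := mulmx1_unit FF'.
  by rewrite -[LHS]mulmx1 -FF' mulmxA mulVmx // mul1mx.
have GE (e : 'rV[E]_2) : e *m G^T =
    \row_k (if k == 0 then (e *m g^T) 0 0 else (e *m (g *m F')^T) 0 0).
  have e0 : (0 : 'I_2) = lshift 1 (0 : 'I_1) by apply/val_inj.
  have e1 : (1 : 'I_2) = rshift 1 (0 : 'I_1) by apply/val_inj.
  have c0 a : G 0 a = g 0 a.
    by have : col_mx g (g *m F') 0 a = g 0 a by rewrite e0 col_mxEu.
  have c1 a : G 1 a = (g *m F') 0 a.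
    by have : col_mx g (g *m F') 1 a = (g *m F') 0 a by rewrite [X in col_mx _ _ X]e1 col_mxEd.
  apply/rowP => k; rewrite [LHS]mxE [RHS]mxE; case: (eqVneq k 0) => [->|k0].
    by rewrite [RHS]mxE; apply: eq_bigr => a _; rewrite [G^T _ _]mxE c0 [g^T _ _]mxE.
  have -> : k = 1 by apply/val_inj; case: k k0 => [[|[|k]]].
  by rewrite [RHS]mxE; apply: eq_bigr => a _; rewrite [G^T _ _]mxE c1 [(g *m F')^T _ _]mxE.
pose f := (\row_k (if k == 0 then 1 else (-1) ^+ b)) *m invmx G^T : 'rV[E]_2.
have fG : f *m G^T = \row_k (if k == 0 then 1 else (-1) ^+ b) by rewrite mulmxKV.
have fg : f *m g^T = 1%:M.
  have := fG; rewrite GE => /rowP/(_ 0); rewrite !mxE /= => fg.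
  by apply/matrixP => k l; rewrite !ord1 [RHS]mxE eqxx -fg !mxE.
have fgF : f *m (g *m F')^T = ((-1) ^+ b)%:M.
  have := fG; rewrite GE => /rowP/(_ 1); rewrite !mxE /= => fgF.
  by apply/matrixP => k l; rewrite !ord1 [RHS]mxE eqxx -fgF !mxE.
have fF : f *m F'^T = (-1) ^+ b *: f.
  apply: (can_inj (mulmxK Gu)); rewrite -scalemxAl fG GE.
  have -> : f *m F'^T *m g^T = ((-1) ^+ b)%:M by rewrite -fgF trmx_mul mulmxA.
  have -> : f *m F'^T *m (g *m F')^T = 1%:M.
    by rewrite -mulmxA -trmx_mul -(mulmxA g) FF' mulmx1.
  apply/rowP => k; rewrite [LHS]mxE [RHS]mxE [X in _ * X]mxE.
  by case: eqP => _; rewrite mxE eqxx ?mulr1 // -expr2 sqrr_sign.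
exists f; split=> //.
  rewrite /row_free rank_rV eqb1; apply/eqP => f0; move: fg.
  by rewrite f0 mul0mx => /matrixP/(_ 0 0)/eqP; rewrite !mxE eqxx eq_sym oner_eq0.
apply/eqmxP/andP; split; first by apply/eigenspaceP; rewrite FV.
apply/row_subP => i; set e := row i _.
have /eigenspaceP : (e <= eigenspace (invmx F')^T ((-1) ^+ b))%MS by apply: row_sub.
rewrite FV => eF; apply/submxP; exists (e *m g^T).
apply: (can_inj (mulmxK Gu)); rewrite /= -[RHS]mulmxA fG GE.
have -> : e *m (g *m F')^T = (-1) ^+ b *: (e *m g^T).
  by rewrite trmx_mul mulmxA eF -scalemxAl.
apply/rowP => k; rewrite [LHS]mxE [RHS]mxE big_ord1 [X in _ = _ * X]mxE.
by case: eqP => _; rewrite ?mulr1 // mxE mulrC.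
Qed.
End DualEigenspace.

(** F^m of the dual annihilates F^(1-m). If F^(1-m) lies in the line of omega_0, the form orthogonal
    to omega_0 is in F^m and is killed by [P]; otherwise omega_0 is in F^(1-m) and is killed by the
    form orthogonal to [P]. Either way [P] and omega_0 have zero determinant, and a vector pairing
    to 1 with omega_0, taken from [omega'], exhibits [P] as a multiple. *)
Lemma dual_projection (R : realType) (K Q : fieldExtType rat) (N : hodge_dR R K Q 2)
    (omega omega' : 'M[tens Q K]_2) (m0 m : int) (P : 'M[tens Q K]_(2, 1)) :
  (forall q q' x, q <= q' -> fil N q' x -> fil N q x) ->
  omega *m omega' = 1%:M ->
  (forall x, fil N m0 x <-> exists c : 'rV_2,
     (forall i : 'I_2, (1 <= i)%N -> c 0 i = 0) /\ x = c *m omega) ->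
  (forall f, fil (dual N) m f <-> f *m P = 0) ->
  exists u, P = u *: (row 0 omega)^T.
Proof.
move=> dec ww' fil0 filP; pose v := row 0 omega.
have P2 (f : 'rV[tens Q K]_2) (B : 'M[tens Q K]_(2, 1)) : (f *m B) 0 0 = f 0 0 * B 0 0 + f 0 1 * B 1 0.
  by rewrite mxE sum_ord2.
pose perp (a b : tens Q K) : 'rV[tens Q K]_2 := \row_k (if k == 0 then - b else a).
have cross : v 0 0 * P 1 0 = v 0 1 * P 0 0.
  have [le_m0|lt_m0] := leP m0 (1 - m).
    have /filP/(congr1 (fun B : 'M[tens Q K]_1 => B 0 0)) : fil (dual N) m (perp (v 0 0) (v 0 1)).
      move=> x /(dec _ _ _ le_m0)/fil0[c [c0 ->]].
      have -> : c *m omega = c 0 0 *: v.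
        by rewrite [LHS]mulmx_sum_row sum_ord2 [c 0 1]c0 // scale0r addr0.
      apply/matrixP => i k; rewrite !ord1 [RHS]mxE P2 !mxE /=.
      by rewrite mulrN mulrAC addNr.
    by rewrite P2 [RHS]mxE !mxE /= mulNr addrC => /eqP; rewrite subr_eq0 => /eqP.
  have vm : fil N (1 - m) v.
    apply: dec (ltW lt_m0) _; apply/fil0; exists (delta_mx 0 0); split; last by rewrite -rowE.
    by case=> [[|i]] hi // _; rewrite !mxE.
  have /filP/(_ _ vm)/(congr1 (fun B : 'M[tens Q K]_1 => B 0 0)) : perp (P 0 0) (P 1 0) *m P = 0.
    by apply/matrixP => i k; rewrite !ord1 P2 !mxE /= mulNr mulrC addNr.
  by rewrite P2 [RHS]mxE !mxE /= mulrN addrC => /eqP; rewrite subr_eq0 => /eqP <-.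
pose z := (col 0 omega')^T.
have zv : v 0 0 * z 0 0 + v 0 1 * z 0 1 = 1.
  have <- : (omega *m omega') 0 0 = 1 by rewrite ww' mxE eqxx.
  by rewrite [RHS]mxE sum_ord2 !mxE.
exists ((z *m P) 0 0); apply/matrixP => i k; rewrite ord1 [RHS]mxE [X in _ * X]mxE.
rewrite P2 -[LHS]mul1r -zv -/v.
have [->|i0] := eqVneq i 0.
  by rewrite !mulrDl; congr (_ + _); [rewrite -mulrA mulrC | rewrite mulrAC -cross mulrC [v 0 0 * _]mulrC mulrA].
have -> : i = 1 by apply/val_inj; case: i i0 => [[|[|i]]].
by rewrite !mulrDl; congr (_ + _); [rewrite mulrAC cross mulrC [v 0 1 * _]mulrC mulrA | rewrite -mulrA mulrC].
Qed.

(** The two Hodge lines are independent, so they pair nontrivially, and the target A(-w) has no type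
    other than w. *)
Lemma alternating_hodge_types (R : realType) (K Q : fieldExtType rat)
    (M : hodge_dR R K Q 2) (w : int) (A : hodge_dR R K Q 1) f g sigma rho (p : 'I_2 -> int) :
  alternating_polarization M w A f g ->
  (forall q, hodge A sigma rho q = if q == 0 then setT else [set 0]%classic) ->
  gram (f sigma) 0 1 != 0 ->
  (forall q q' x x', q != q' -> x != 0 -> x' != 0 ->
     hodge M sigma rho q x -> hodge M sigma rho q' x' ->
     \det (col_mx x x' : 'M[R[i]]_2) != 0) ->
  hodge_types M sigma rho p -> p 0 + p 1 = w.
Proof.
move=> [[[_ hmor _ _] _ _] alt _] hA f0 indep [pdec pE].
have ex i : exists2 x, x != 0 & hodge M sigma rho (p i) x.
  by apply: sdim_gt0P; rewrite -/(hodge_number _ _ _ _) (pE _).2 //; exists i.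
have [x0 nx0 hx0] := ex 0; have [x1 nx1 hx1] := ex 1.
have p10 : p 0 != p 1 by rewrite gt_eqF // pdec.
apply/eqP/negPn/negP => pw.
have : hodge (tensor M M) sigma rho (p 0 + p 1) (x0 *t x1 : 'rV_(2 * 2)).
  by apply: sub_span; exists (p 0), (p 1), x0, x1.
move/hmor; rewrite /= hA subr_eq0 (negPf pw) => x01.
have : (x0 *m gram (map_mx rho (f sigma)) *m x1^T) 0 0 = 0.
  by rewrite -pairingE /pairing x01 mxE.
have -> : gram (map_mx rho (f sigma)) = map_mx rho (gram (f sigma)).
  by apply/matrixP => i k; rewrite !mxE.
rewrite alt_mx2_det; last first.
  by apply/map_alt_mx2/alt_mx2P => x; rewrite -pairingE; apply: alt.
move/eqP; rewrite mulf_eq0 mxE fmorph_eq0 (negPf f0) /=.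
by apply/negP; apply: indep nx0 nx1 hx0 hx1.
Qed.

(** The coordinates (a, b) and (b/l, a l) of g and g F' have determinant a^2 l - b^2 / l. *)
Lemma cyclic_coord (C : fieldType) (F' Om' : 'M[C]_2) (lam' : 'I_2 -> C) (g : 'rV[C]_2) :
  F' *m F' = 1%:M -> Om' \in unitmx -> Om' *m F' = antidiag lam' *m Om' ->
  exists a b, g = a *: row 0 Om' + b *: row 1 Om' /\
    \det (col_mx g (g *m F') : 'M[C]_2) =
      lam' 0 * ((a + b / lam' 0) * (a - b / lam' 0)) * \det Om'.
Proof.
move=> FF' Om'u OmF'; pose c := g *m invmx Om'.
have gE : g = c 0 0 *: row 0 Om' + c 0 1 *: row 1 Om'.
  by rewrite -[LHS](mulmxKV Om'u) [LHS]mulmx_sum_row sum_ord2.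
exists (c 0 0), (c 0 1); split=> //.
have l0 : lam' 0 != 0.
  apply/eqP => l0; have /eqP := antidiag2_inv FF' Om'u OmF'.
  by rewrite l0 mul0r eq_sym oner_eq0.
rewrite (mul_frob_cyclic FF' Om'u OmF' gE) {1}gE.
set a := c 0 0; set b := c 0 1; set l := lam' 0 in l0 *.
have bE : b = b / l * l by rewrite mulfVK.
rewrite det_col2 det_mx22 !mxE.
by clearbody a b l; move: (b / l) bE => b' ->; ring.
Qed.

Lemma det_unitriangular (S : comNzRingType) d (N : 'M[S]_d) :
  (forall i, N i i = 1) -> (forall i k : 'I_d, (i < k)%N -> N i k = 0) -> \det N = 1.
Proof.
move=> N1 N0; rewrite det_trig; last by apply/is_trig_mxP.
by rewrite big1.
Qed.

Lemma map_quot_rows (S S' : comNzRingType) (f : {rmorphism S -> S'}) d n r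
    (w : 'M[S]_d) (w0 w1 : 'rV[S]_n) P :
  map_mx f (quot_rows r w w0 w1 P) =
  quot_rows r (map_mx f w) (map_mx f w0) (map_mx f w1) (map_mx f P).
Proof.
apply/row_matrixP => i; rewrite -map_row !rowK.
by case: ifP => _; rewrite !map_mxM map_tensr map_row.
Qed.

Lemma det_row0 (S : comNzRingType) d (A : 'M[S]_d) i : row i A = 0 -> \det A = 0.
Proof.
move=> /rowP Ai; rewrite (expand_det_row _ i) big1 // => k _.
by have := Ai k; rewrite !mxE => ->; rewrite mul0r.
Qed.

(** The row whose index is the smaller of r and r' is zero: there [quot_rows] at r' selects a tensor
    that lies in the filtration step. *)
Lemma det_quot_rows0 (S : comNzRingType) d n r r' (w : 'M[S]_d) (w0 w1 : 'rV[S]_n) P :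
  (forall k : 'I_d, (k < r)%N -> row k w *m tensr d w0 *m P = 0) ->
  (forall k : 'I_d, (r <= k)%N -> row (rev_ord k) w *m tensr d w1 *m P = 0) ->
  (r <= d)%N -> (r' <= d)%N -> r' != r -> \det (quot_rows r' w w0 w1 P) = 0.
Proof.
move=> k0 k1 rd r'd; rewrite neq_ltn => /orP[] lt.
  have ltd : (r' < d)%N by apply: leq_trans lt rd.
  by apply: (@det_row0 _ _ _ (Ordinal ltd)); rewrite rowK /= ltnn k0.
have ltd : (r < d)%N by apply: leq_trans lt r'd.
by apply: (@det_row0 _ _ _ (Ordinal ltd)); rewrite rowK /= lt k1.
Qed.

(** Bookkeeping of constants. The last parenthesis is the right-hand side of the theorem; the
    factors before it are rational. The relation between [Om], [dM] and [w] exchanges the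
    determinant of the Omega_i for delta(M). *)
Lemma period_identity (C : fieldType)
    (c D Om dM w y dt N T Qh Qr ast vst dAr mur lr lamr s QM Up mup : C) :
  Om != 0 -> w != 0 ->
  Om * c = y * dt * (lr * lamr * D) -> Om * dM = w ->
  dt = N * T / Qh * (ast / vst) -> lr = Qr * dAr / mur -> lamr = s * (QM * Up / mup) ->
  c = y / w * N / vst * s / mur * (Up / mup) * D *
      (T * dAr * dM * ast * (Qr / Qh) * QM).
Proof.
move=> Om0 w0 cE dME dtE lrE lamrE; apply: (mulfI Om0); rewrite cE dtE lrE lamrE.
rewrite -[y]mulr1 -{1}(mulfV w0) -{1}dME.
move: (w^-1) (Qh^-1) (vst^-1) (mur^-1) (mup^-1) => w' Qh' vst' mur' mup'.
by ring.
Qed.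

(** If q is the value of f at row 0 of [Om'], its value at row 1, which is l^-1 times the Frobenius
    image of row 0, is e q / l. Expanding f(g) = 1 gives the claim, so the periods of the dual are
    inverses of a ± b/l. *)
Lemma dual_pairing (C : fieldType) (F' Om' I' N' w' : 'M[C]_2) (lam' : 'I_2 -> C)
    (g f : 'rV[C]_2) (a b e : C) :
  F' *m F' = 1%:M -> Om' \in unitmx -> I' \in unitmx ->
  Om' *m F' = antidiag lam' *m Om' -> Om' *m I' = N' *m w' ->
  (forall i, N' i i = 1) -> (forall i k : 'I_2, (i < k)%N -> N' i k = 0) ->
  g = a *: row 0 Om' + b *: row 1 Om' ->
  f *m F'^T = e *: f -> f *m g^T = 1%:M ->
  (f *m (invmx I')^T *m (row 0 w')^T) 0 0 * (a + e * (b / lam' 0)) = 1.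
Proof.
move=> FF' Om'u I'u OmF' OmI' N1 N0 gE fF fg.
have l0 : lam' 0 != 0.
  apply/eqP => l0; have /eqP := antidiag2_inv FF' Om'u OmF'.
  by rewrite l0 mul0r eq_sym oner_eq0.
have -> : row 0 w' = row 0 Om' *m I'.
  rewrite -row_mul OmI' row_mul [RHS]mulmx_sum_row sum_ord2 !mxE N1 N0 //.
  by rewrite scale1r scale0r addr0.
rewrite -mulmxA -trmx_mul mulmxK //; set q := f *m _.
have r1 : row 1 Om' = (lam' 0)^-1 *: (row 0 Om' *m F').
  rewrite -row_mul OmF' mul_antidiag scalerA mulVf // scale1r.
  by congr (row _ _); apply/val_inj.
have : f *m g^T = (a + e * (b / lam' 0)) *: q.
  rewrite gE r1 linearD !linearZ /= mulmxDr -!scalemxAr trmx_mul mulmxA fF -scalemxAl.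
  by rewrite !scalerA -scalerDl; congr ((_ + _) *: _); rewrite mulrC mulrA.
rewrite fg => /matrixP/(_ 0 0); rewrite [LHS]mxE [RHS]mxE mulrC => <-.
by rewrite eqxx.
Qed.

Lemma det_map_col2 (S S' : comNzRingType) (h : {rmorphism S -> S'}) (x y : 'rV[S]_2) :
  \det (col_mx (map_mx h x) (map_mx h y) : 'M[S']_2) = h (\det (col_mx x y : 'M[S]_2)).
Proof. by rewrite !det_col2 !mxE rmorphB !rmorphM. Qed.

(** This is the product of a + b/l and a - b/l. The entry l is eliminated through the quadratic
    period of RM(chi), and the determinant of its comparison matrix through the compatibility of the
    two pairings, which brings in [T], the power of 2 pi i. *)
Lemma cyclic_discriminant (C : fieldType) (l g01 dw dA T f01 n0 Delta dO dI : C) :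
  l != 0 -> g01 != 0 -> dw != 0 -> dA != 0 ->
  n0 = l * Delta * dO -> dO * dI = dw -> T * dA * f01 = g01 * dI ->
  Delta = n0 * f01 * T / (l * (g01 * dw) / dA).
Proof.
move=> l0 g0 dw0 dA0 n0E dE fE.
have Q0 : l * (g01 * dw) / dA != 0 by rewrite !mulf_neq0 ?invr_eq0.
apply: (mulIf Q0); rewrite mulfVK //.
apply: (mulIf dA0); rewrite -!mulrA mulVf // mulr1 -dE n0E.
by rewrite [f01 * _]mulrC fE; ring.
Qed.

Lemma map_mx_ev_ext (R : realType) (E F K : fieldExtType rat) (sigma : emb R K)
    (i : {rmorphism E -> F}) (psi : emb R F) a b (x : 'M[tens E K]_(a, b)) :
  map_mx (ev psi sigma) (map_mx (tens_map (fun e => pure (i e) 1) (pure (1 : F))) x) =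
  map_mx (ev (psi \o i) sigma) x.
Proof. by apply/matrixP => k l; rewrite !mxE; apply: ev_ext. Qed.

Lemma det_map_invertible (S : comNzRingType) (C : fieldType) (f : {rmorphism S -> C}) d
    (A B : 'M[S]_d) : A *m B = 1%:M -> \det (map_mx f A) != 0.
Proof.
move/(congr1 determinant)/(congr1 f); rewrite det_mulmx det1 rmorphM rmorph1 det_map_mx.
by move=> AB; apply: contra_eq_neq AB => ->; rewrite mul0r eq_sym oner_eq0.
Qed.

Lemma det_row01 (S : comNzRingType) (A : 'M[S]_2) :
  \det (col_mx (row 0 A) (row 1 A) : 'M[S]_2) = \det A.
Proof. by rewrite det_col2 det_mx22 !mxE. Qed.

Lemma det_antidiag1_sq (C : fieldType) d :
  \det (antidiag (fun _ : 'I_d => 1 : C)) * \det (antidiag (fun _ : 'I_d => 1 : C)) = 1.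
Proof.
rewrite -det_mulmx (_ : _ *m _ = 1%:M) ?det1 //.
apply/row_matrixP => i; rewrite mul_antidiag scale1r; apply/rowP => k.
by rewrite !mxE rev_ordK eq_sym.
Qed.

Lemma prod_conj_antidiag (C : fieldType) d (F Om : 'M[C]_d) (lam : 'I_d -> C) :
  Om \in unitmx -> Om *m F = antidiag lam *m Om ->
  \prod_i lam i = \det F * \det (antidiag (fun _ : 'I_d => 1 : C)).
Proof.
move=> Omu /(congr1 determinant); rewrite !det_mulmx mulrC => e.
have -> : \det F = \det (antidiag lam).
  by apply: mulIf e; rewrite -unitfE -unitmxE.
by rewrite det_antidiag -mulrA det_antidiag1_sq mulr1.
Qed.

Lemma prod_ord_lt_const (S : comNzRingType) d n (x : S) : (n <= d)%N ->
  \prod_(k < d | (k < n)%N) x = x ^+ n.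
Proof. by move=> nd; rewrite -(big_ord_widen _ (fun=> x)) // prodr_const card_ord. Qed.

Theorem theorem2p14 (R : realType) (K L E : fieldExtType rat)
  (* L/K is CM, with L embedded in the algebraic closure *)
  (j : {rmorphism K -> L}) (kappa : {rmorphism L -> algC})
  (hK : totally_real R K) (hL : CM_over R j)
  (* the realization M and its polarization *)
  (Ehat : completions E) (d : nat) (w : int) (M : realization R K Ehat d)
  (hM : is_realization (kappa \o j) M w)
  (hreg : regular M) (hspec : special M w)
  (U : hodge_dR R K E 1) (hU : is_artin (kappa \o j) (fun=> 1) U)
  (fM : emb R K -> 'M[E]_(d * d, 1)) (gM : 'M[tens E K]_(d * d, 1))
  (hpolM : polarization M w U fM gM)
  (* the Hecke character chi, of infinity type n, and Q = Q(chi) *)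
  (Lhat : completions L) (chi : idele_family Lhat -> R[i])
  (n : emb R L -> int) (wchi : int) (hchi : is_hecke chi n)
  (hwchi : forall tau, n tau + n (cj tau) = wchi)
  (hcrit : forall tau, n tau != n (cj tau))
  (Q : fieldExtType rat) (iota : emb R Q) (hQ : is_value_field iota chi)
  (* F = E (x) Q(chi) is a field *)
  (F : fieldExtType rat) (iE : {rmorphism E -> F}) (iQ : {rmorphism Q -> F})
  (hF : bijective (tens_map iE iQ : tens E Q -> F))
  (* N = M(chi), RN = RM(chi), A = [chi_0 epsilon_L], and the isomorphism
     from the exterior square of RN to A(-wchi) *)
  (Qhat : completions Q) (N : realization R L Qhat 1)
  (hN : is_hecke_motive iota kappa chi n wchi N)
  (RN : hodge_dR R K Q 2) (hRN : is_restriction j N RN)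
  (chi0 : aut_alg -> Q)
  (hchi0 : is_chi_0 iota j (kappa \o j) chi wchi chi0)
  (A : hodge_dR R K Q 1)
  (hA : is_artin (kappa \o j)
          (fun gamma => chi0 gamma * quadratic_character Q kappa gamma) A)
  (fR : emb R K -> 'M[Q]_(2 * 2, 1)) (gR : 'M[tens Q K]_(2 * 2, 1))
  (hpolR : alternating_polarization RN wchi A fR gR)
  (MRN := tensor (ext_coeff iE M) (ext_coeff iQ RN))
  (hMRN : has_critical_values MRN (w + wchi))
  (sigma : emb R K)
  (* Hodge types and quadratic periods of M and of RM(chi) *)
  (p : emb R E -> 'I_d -> int)
  (hp : forall phi, hodge_types M sigma phi (p phi))
  (QM : 'I_d -> emb R E -> R[i])
  (hQM : quadratic_periods M U gM sigma p QM)
  (pchi : emb R Q -> 'I_2 -> int)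
  (hpchi : forall rho, hodge_types RN sigma rho (pchi rho))
  (Qchi : 'I_2 -> emb R Q -> R[i])
  (hQchi : quadratic_periods RN A gR sigma pchi Qchi)
  (r : emb R E -> emb R Q -> nat)
  (hr : forall phi rho,
     is_r w (p phi) (pchi rho ord0 - pchi rho ord_max) (r phi rho))
  (* a b, for b a sign, and c are the periods of RM(chi)^v and M (x) RM(chi) *)
  (a : bool -> emb R Q -> R[i])
  (ha : forall b, period (dual RN) sigma b (a b))
  (c : emb R F -> R[i]) (hc : period MRN sigma false c) :
  let astar rho : R[i] :=
    if odd d then a (dpm M sigma true < dpm M sigma false)%N rho else 1 in
  sim sigma c (fun psi =>
    let phi : emb R E := psi \o iE in
    let rho : emb R Q := psi \o iQ in
    two_pi_i R ^ (- ((uphalf d)%:Z * wchi)) *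
    delta A sigma rho ^+ r phi rho *
    delta M sigma phi *
    astar rho *
    Qchi ord0 rho ^ ((r phi rho)%:Z - (uphalf d)%:Z) *
    \prod_(k < d | (k < d - r phi rho)%N) QM k phi).
Proof.
move=> astar.

(* The realization M at sigma *)
have csig (s : emb R K) : cj s = s by apply: emb_inj => x; apply: hK.
have [hodgeM _ _ _] := hM; have [hodgeN0 typesN _] := hN; have [hodgeN _ _ _] := hodgeN0.
have E2 (k : fieldExtType rat) : 2%:R != 0 :> k by rewrite -(rmorph_nat (in_alg k)) fmorph_eq0.
pose FM := frob M sigma.
have FF : FM *m FM = 1%:M by have [_ _ /(_ sigma)[]] := hodgeM; rewrite csig.
have cmpM phi : cmp M sigma phi \in unitmx by have [_ _ _ _ /(_ sigma phi)[]] := hodgeM.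
have decM q q' x : q <= q' -> fil M q' x -> fil M q x.
  by have [_ _ _ [_ dec] _] := hodgeM => qq'; exact: (dec _ _ qq' x).
have [ratU U0] := delta_trivial_artin sigma hU.
have filU q : fil U q = if q <= 0 then setT else [set 0]%classic.
  by have [zeta [ext [_ _ _ _ [_ ->]]]] := hU.
have [morM ndM _] := hpolM.
have tpi0 : two_pi_i R != 0.
  by rewrite eq_complex /= negb_and mulf_neq0 ?orbT // gt_eqF // pi_gt0.
have gramM phi : map_mx (ev phi sigma) (gram gM) \in unitmx.
  have := morphism_gram sigma phi morM; set kap := _ * delta U _ _ => eqG.
  have kap0 : kap != 0 by rewrite mulf_neq0 ?expfz_neq0.
  have : kap *: map_mx phi (gram (fM sigma)) \in unitmx.
    by rewrite unitmxZ ?unitfE // map_unitmx; apply: nondegenerate_gram (ndM sigma).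
  by rewrite eqG !unitmx_mul => /andP[/andP[]].
have p_dec phi (i k : 'I_d) : (i < k)%N -> p phi k < p phi i.
  by have [dec _] := hp phi; apply: dec.
have p_sym phi := hodge_types_sym hodgeM hreg (csig sigma) (hp phi).
have [om [om' /= [omom' _ mu0 inM factM]]] :=
  quadratic_periodsP morM filU gramM p_dec p_sym hQM.
set mu := fun i => pairing gM (row i om) (row (rev_ord i) om) 0 0 in mu0 factM.

(* The realization RM(chi) at sigma *)
pose FR := frob RN sigma.
have typesN' tau rho : exists k, forall q,
    hodge N tau rho q = if q == k then setT else [set 0]%classic.
  by have [k _ hk] := typesN tau rho; exists k.
have [FF' cmpR indepR] := restriction_structure hRN hodgeN (csig sigma) typesN'.
rewrite -/FR in FF'.
have decR := restriction_fil_dec hRN hodgeN.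
have [f0 g0 A0 pairR eqR] := alternating_periods hpolR cmpR.
set f01 : Q := gram (fR sigma) 0 1 in f0 eqR.
set g01 : tens Q K := gram gR 0 1 in g0 pairR eqR.
have [[morR _ _] _ _] := hpolR.
have filA q : fil A q = if q <= 0 then setT else [set 0]%classic.
  by have [zeta [ext [_ _ _ _ [_ ->]]]] := hA.
have hodgeA rho q : hodge A sigma rho q = if q == 0 then setT else [set 0]%classic.
  by have [zeta [ext [_ _ _ _ [-> _]]]] := hA.
have pc01 rho : pchi rho 0 + pchi rho 1 = wchi.
  exact: alternating_hodge_types hpolR (hodgeA rho) f0 (indepR rho) (hpchi rho).
have ord2 (i : 'I_2) : i = 0 \/ i = 1.
  by case: i => [[|[|i]] hi] //; [left|right]; apply/val_inj.
have rev0 : rev_ord 0 = 1 :> 'I_2 by apply/val_inj.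
have rev1 : rev_ord 1 = 0 :> 'I_2 by apply/val_inj.
have pc_dec rho (i k : 'I_2) : (i < k)%N -> pchi rho k < pchi rho i.
  by have [dec _] := hpchi rho; apply: dec.
have pc_sym rho i : pchi rho i + pchi rho (rev_ord i) = wchi.
  by case: (ord2 i) => ->; rewrite ?rev0 ?rev1 // addrC.
have [wR [wR' /= [wRwR' FpmR mu0' inR factR]]] :=
  quadratic_periodsP morR filA (alternating_gram_unit hpolR cmpR) pc_dec pc_sym hQchi.
set mu' := fun i => pairing gR (row i wR) (row (rev_ord i) wR) 0 0 in mu0' factR.
have det_om phi : \det (map_mx (ev phi sigma) om) != 0 by apply: det_map_invertible omom'.
have det_wR rho : \det (map_mx (ev rho sigma) wR) != 0 by apply: det_map_invertible wRwR'.
have Om_unit d' (Om N0 w0 I0 : 'M[R[i]]_d') : (forall i, N0 i i = 1) ->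
    (forall i k : 'I_d', (i < k)%N -> N0 i k = 0) -> Om *m I0 = N0 *m w0 ->
    \det w0 != 0 -> Om \in unitmx /\ \det Om * \det I0 = \det w0.
  move=> N1 N00 OI w00; have e : \det Om * \det I0 = \det w0.
    by rewrite -det_mulmx OI det_mulmx det_unitriangular // mul1r.
  split=> //; rewrite unitmxE unitfE; apply: contra w00 => /eqP O0.
  by rewrite -e O0 mul0r.
have [gR0 gcyc] : exists g : 'rV[Q]_2, \det (col_mx g (g *m FR) : 'M[Q]_2) != 0.
  (* Frobenius is antidiagonal in the basis Omega'; were it also scalar it would be zero, against
     its square being 1. One embedding, [iota], is enough to see this. *)
  apply: cyclic_vector2 => x; apply/eqP => FRx.
  have [_ [N' [Om' [lam' [[N1' N0'] OmI' OmF' _]]]]] := factR iota.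
  have [Om'u _] := Om_unit _ _ _ _ _ N1' N0' OmI' (det_wR iota).
  move: OmF'; rewrite -/FR FRx map_scalar_mx scalar_mxC => /(can_inj (mulmxK Om'u)).
  move/matrixP/(_ 0 0); rewrite !mxE eqxx rev0 /= mulr0n mulr1n => /eqP.
  rewrite fmorph_eq0 => /eqP x0; move/matrixP/(_ 0 0): FF'.
  by rewrite FRx x0 mul_scalar_mx scale0r !mxE => /eqP; rewrite eq_sym oner_eq0.

(* The period of the dual of RM(chi) *)
pose b0 := (dpm M sigma true < dpm M sigma false)%N.
have [m1 wrt1] := ha b0.
have [f [ffree fE fF fg]] := dual_eigenspace b0 FF' gcyc.
have [yb [Pb [_ _ Pbker aE]]] := period_wrt_basis wrt1 ffree fE.
have dR : dpm RN sigma false = 1%N.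
  have [_ [N' [Om' [lam' [[N1' N0'] OmI' OmF' _]]]]] := factR iota.
  have [Om'u _] := Om_unit _ _ _ _ _ N1' N0' OmI' (det_wR iota).
  have := involution_parity FF' Om'u OmF'; have := rank_eigenspaces (E2 Q) FF'.
  rewrite -[\rank (eigenspace FR 1)]/(dpm RN sigma false) /=; lia.
have [m0 _ fil0] := FpmR false; rewrite dR in fil0.
have [u PbE] := dual_projection decR wRwR' fil0 Pbker.
(* The part of the period that is not evidently rational; [dual_pairing] identifies it with the
   inverse of a ± b/l. *)
pose q rho := (map_mx (GRing.RMorphism.sort rho) f *m (invmx (cmp RN sigma rho))^T *m
  (row 0 (map_mx (ev rho sigma) wR))^T) 0 0.
have {}aE rho : a b0 rho != 0 /\ a b0 rho = rho yb * ev rho sigma u * q rho.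
  have [a0 arE] := aE rho; split=> //.
  by rewrite arE PbE map_mxZ -map_trmx map_row det_mx11 -scalemxAr mxE mulrA.

(* The period of the tensor product in the explicit basis of the +1-eigenspace *)
have [m wrt] := hc.
have FFE : map_mx iE FM *m map_mx iE FM = 1%:M by rewrite -map_mxM FF map_mx1.
have FFQ : map_mx iQ FR *m map_mx iQ FR = 1%:M by rewrite -map_mxM FF' map_mx1.
have gcycQ : \det (col_mx (map_mx iQ gR0) (map_mx iQ gR0 *m map_mx iQ FR) : 'M[F]_2) != 0.
  by rewrite -map_mxM det_map_col2 fmorph_eq0.
have [y [P [_ Psurj Pker cE]]] := period_wrt_basis wrt
  (plus_eigenspace_free (map_mx iE FM) gcycQ) (plus_eigenspace FFE FFQ gcycQ).

(* The rational factors *)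
pose ph (psi : emb R F) : emb R E := psi \o iE.
pose rh (psi : emb R F) : emb R Q := psi \o iQ.
pose h := uphalf d.
pose n0 := \det (col_mx gR0 (gR0 *m FR) : 'M[Q]_2).
pose s0 : R[i] := \det (antidiag (fun _ : 'I_d => 1)).
pose vst (psi : emb R F) := if odd d then rh psi yb * ev (rh psi) sigma u else 1.
(* All the factors of c apart from [Dm] and the right-hand side. The index r' is kept independent of
   psi because exponents and ranges of products that vary with psi would not define an element of F
   ⊗ K. *)
pose V (r' : nat) (psi : emb R F) := psi y / \det (map_mx (ev (ph psi) sigma) om) *
  rh psi (n0 * f01) ^+ h / vst psi * (ph psi (\det FM) * s0) / ev (rh psi) sigma (mu' 0) ^+ r' *
  (delta U sigma (ph psi) ^+ (d - r') /
     \prod_(k < d | (k < d - r')%N) ev (ph psi) sigma (mu k)).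
pose Dm r' : tens F K := \det (quot_rows r'
  (map_mx (tens_map (fun e => pure (iE e) 1) (pure (1 : F))) om)
  (row 0 (map_mx (tens_map (fun e => pure (iQ e) 1) (pure (1 : F))) wR))
  (row 1 (map_mx (tens_map (fun e => pure (iQ e) 1) (pure (1 : F))) wR)) P).
have DmE r' psi : ev psi sigma (Dm r') = \det (quot_rows r'
    (map_mx (ev (ph psi) sigma) om) (row 0 (map_mx (ev (rh psi) sigma) wR))
    (row 1 (map_mx (ev (rh psi) sigma) wR)) (map_mx (ev psi sigma) P)).
  by rewrite /Dm -det_map_mx map_quot_rows !map_row !map_mx_ev_ext.
have vst0 psi : vst psi != 0.
  rewrite /vst; case: ifP => _; last exact: oner_neq0.
  by have [+ aE'] := aE (rh psi); rewrite aE' mulf_eq0 => /norP[].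
have rat_vst : rational sigma vst.
  rewrite /vst; case: (odd d); last exact: rational1.
  apply: (@rational_ext _ _ _ _ sigma iQ (fun rho : emb R Q => rho yb * ev rho sigma u)).
  by apply: rationalM; [apply: rational_emb | apply: rational_ev].
have rat_s0 : rational sigma (fun _ : emb R F => s0).
  exists (\det (antidiag (fun _ : 'I_d => 1))) => psi; rewrite -det_map_mx; congr (\det _).
  by apply/matrixP => i k; rewrite !mxE rmorphMn rmorph1.
have rat_V r' : rational sigma (V r').
  have rE (x : tens E K) : rational sigma (fun psi => ev (ph psi) sigma x).
    exact: (rational_ext iE (rational_ev sigma x)).
  have rQ (x : tens Q K) : rational sigma (fun psi => ev (rh psi) sigma x).
    exact: (rational_ext iQ (rational_ev sigma x)).
  apply: rationalM; first (apply: rationalM; first (apply: rationalM;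
    first (apply: rationalM; first (apply: rationalM; first apply: rationalM)))).
  - exact: rational_emb.
  - apply: rationalV => [psi|]; first exact: det_om.
    by apply: eq_rational (rE (\det om)) => psi; rewrite -det_map_mx.
  - by apply: rationalX; apply: (rational_ext iQ (rational_emb _ _)).
  - exact: rationalV.
  - by apply: rationalM => //; apply: (rational_ext iE (rational_emb _ _)).
  - by apply: rationalV => [psi|]; [apply: expf_neq0; apply: mu0' | apply: rationalX; apply: rQ].
  apply: rationalM; first by apply: rationalX; apply: (rational_ext iE ratU).
  apply: rationalV => [psi|]; first by apply/prodf_neq0 => k _; apply: mu0.
  by apply: rational_prod => k; apply: rE.

(* The identity at a single embedding of F *)
have key psi (rr := r (ph psi) (rh psi)) : [/\ (rr <= d)%N,
    forall r', (r' <= d)%N -> r' != rr -> ev psi sigma (Dm r') = 0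
  & c psi = V rr psi * ev psi sigma (Dm rr) *
    (two_pi_i R ^ (- ((uphalf d)%:Z * wchi)) *
    delta A sigma (rh psi) ^+ rr *
    delta M sigma (ph psi) *
    astar (rh psi) *
    Qchi ord0 (rh psi) ^ (rr%:Z - (uphalf d)%:Z) *
    \prod_(k < d | (k < d - rr)%N) QM k (ph psi))].
  pose phi := ph psi; pose rho := rh psi; rewrite -/phi -/rho in rr *.
  have [coordM [N0 [Om [lam [[N1 N00] OmI OmF QE]]]]] := factM phi.
  have [coordR [N0' [Om' [lam' [[N1' N00'] OmI' OmF' QE']]]]] := factR rho.
  have [Omu detOm] := Om_unit _ _ _ _ _ N1 N00 OmI (det_om phi).
  have [Om'u detOm'] := Om_unit _ _ _ _ _ N1' N00' OmI' (det_wR rho).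
  have e0 : ord0 = 0 :> 'I_2 by apply/val_inj.
  have hrr : is_r w (p phi) (pchi rho 0 - pchi rho 1) rr.
    by have := hr phi rho; rewrite (_ : ord_max = 1) ?e0 //; apply/val_inj.
  have rd : (rr <= d)%N by have [] := hrr.
  have [mid0 mid1] := middle_step Pker Psurj (p_dec phi) (p_sym phi) hrr coordM coordR (erefl d).
  have kill0 (k : 'I_d) (kr : (k < rr)%N) := tensor_fil_kill Pker decM (mid0 k kr) (inM phi k) (inR rho 0).
  have kill1 (k : 'I_d) (kr : (rr <= k)%N) :=
    tensor_fil_kill Pker decM (mid1 k kr) (inM phi (rev_ord k)) (inR rho 1).
  have t0 : 0 < pchi rho 0 - pchi rho 1 by rewrite subr_gt0 pc_dec.
  have rev_lt := is_r_rev_lt (p_dec phi) (p_sym phi) t0 hrr.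
  split=> // [r' r'd r'r|]; first by rewrite DmE (det_quot_rows0 kill0 kill1).
  have FFC : map_mx phi FM *m map_mx phi FM = 1%:M by rewrite -map_mxM FF map_mx1.
  have FFC' : map_mx rho FR *m map_mx rho FR = 1%:M by rewrite -map_mxM FF' map_mx1.
  have [al [be [gE detg]]] := cyclic_coord (map_mx rho gR0) FFC' Om'u OmF'.
  have plus := det_plus_part rd rev_lt FFC Omu OmF N1 N00 OmI FFC' Om'u OmF' N1' N00' OmI'
    kill0 kill1 gE.
  set l := lam' 0 in plus detg.
  set Dl := (al + be / l) * (al - be / l) in detg.
  have n0E : rho n0 = l * Dl * \det Om' by rewrite -detg -map_mxM det_map_col2.
  have n00 : rho n0 != 0 by rewrite fmorph_eq0.
  have [l0 Dl0] : l != 0 /\ Dl != 0.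
    by move: n00; rewrite n0E !mulf_eq0 => /norP[/norP[]].
  have [ab0 ab1] : al + be / l != 0 /\ al - be / l != 0.
    by move: Dl0; rewrite mulf_eq0 => /norP[].
  have mu'E : ev rho sigma (mu' 0) = ev rho sigma g01 * \det (map_mx (ev rho sigma) wR).
    by rewrite /mu' pairR rev0 det_row01 rmorphM -det_map_mx.
  have QcE : Qchi ord0 rho = l * ev rho sigma (mu' 0) / delta A sigma rho by rewrite e0 QE'.
  have DlE : Dl = rho (n0 * f01) * two_pi_i R ^ (- wchi) / Qchi ord0 rho.
    rewrite QcE mu'E rmorphM.
    exact: cyclic_discriminant l0 (g0 rho) (det_wR rho) (A0 rho) n0E detOm' (eqR rho).
  have Qc0 : Qchi ord0 rho != 0.
    by rewrite QcE !mulf_neq0 ?invr_eq0 ?A0 ?mu0'.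
  have [_ cpsi] := cE psi.
  have cpl : \det Om * c psi = psi y * \det (al%:M + (be / l) *: map_mx phi FM) *
      (l ^+ rr * \prod_(k < d | (k < rr)%N) lam k * ev psi sigma (Dm rr)).
    have mm (k : fieldExtType rat) (i : {rmorphism k -> F}) e e' (Z : 'M[k]_(e, e')) :
        map_mx psi (map_mx i Z) = map_mx (psi \o i) Z.
      by apply/matrixP => ? ?; rewrite !mxE.
    have XE : map_mx psi (tensr d (map_mx iQ gR0) + map_mx iE FM *m
          tensr d (map_mx iQ gR0 *m map_mx iQ FR)) =
        tensr d (map_mx rho gR0) +
          map_mx phi FM *m tensr d (map_mx rho gR0 *m map_mx rho FR).
      by rewrite map_mxD map_mxM !map_tensr map_mxM !mm.
    have cmpE : cmp MRN sigma psi = cmp M sigma phi *t cmp RN sigma rho by [].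
    rewrite cpsi XE cmpE mulrCA DmE.
    rewrite plus mulrA.
    by [].
  (* The same test, d^- < d^+, decides which factor is left over in the determinant and which sign
     defines a^*; [dual_pairing] shows that the two choices match. *)
  have astE : (if odd d then if (\rank (eigenspace FM (-1)) < \rank (eigenspace FM 1))%N
      then (al - be / l)^-1 else (al + be / l)^-1 else 1) = astar rho / vst psi.
    rewrite /astar /vst; case: (odd d); last by rewrite divr1.
    have [ar0 arE] := aE rho; rewrite -/b0 -/rho arE.
    have yu0 : rho yb * ev rho sigma u != 0.
      by move: ar0; rewrite arE mulf_eq0 => /norP[].
    rewrite mulrAC mulfV // mul1r.
    have fFC : map_mx rho f *m (map_mx rho FR)^T = (-1) ^+ b0 *: map_mx rho f.
      by rewrite map_trmx -map_mxM fF map_mxZ rmorphXn rmorphN1.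
    have fgC : map_mx rho f *m (map_mx rho gR0)^T = 1%:M.
      by rewrite map_trmx -map_mxM fg map_mx1.
    have := dual_pairing FFC' Om'u (cmpR rho) OmF' OmI' N1' N00' gE fFC fgC.
    rewrite -/(q rho) -/l; case: (b0) => /= qE.
      rewrite expr1 mulN1r in qE.
      by apply: (mulIf ab1); rewrite mulVf.
    rewrite expr0 mul1r in qE.
    by apply: (mulIf ab0); rewrite mulVf.
  have dtE := det_involution_parity FF Omu OmF ab0 ab1.
  have {}dtE : \det (al%:M + (be / l) *: map_mx phi FM) = rho (n0 * f01) ^+ h *
      two_pi_i R ^ (- (h%:Z * wchi)) / Qchi ord0 rho ^+ h * (astar rho / vst psi).
    rewrite dtE -astE -/Dl DlE !exprMn exprVn; congr (_ * _ / _ * _).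
    by rewrite -mulrN mulrC -exprz_exp.
  have lE : l ^+ rr = Qchi ord0 rho ^+ rr * delta A sigma rho ^+ rr / ev rho sigma (mu' 0) ^+ rr.
    by rewrite -exprVn -!exprMn QcE mulfVK ?A0 // mulfK ?mu0'.
  (* After the passage from r to d - r, each remaining lambda_k equals Q_k delta(U) / mu_k. *)
  have lamE : \prod_(k < d | (k < rr)%N) lam k = phi (\det FM) * s0 *
      (\prod_(k < d | (k < d - rr)%N) QM k phi * delta U sigma phi ^+ (d - rr) /
       \prod_(k < d | (k < d - rr)%N) ev phi sigma (mu k)).
    have lam1 k := antidiag_involution k (antidiag_conj Omu FFC OmF).
    rewrite (prod_antidiag rd lam1) (prod_conj_antidiag Omu OmF) det_map_mx -/s0.
    congr (_ * _); rewrite -(prod_ord_lt_const _ (leq_subr rr d)) -prodfV -!big_split /=.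
    apply: eq_bigr => k _; by rewrite QE divfK ?U0 // mulfK.
  have Om0 : \det Om != 0 by rewrite -unitfE -unitmxE.
  rewrite expfzDr // -exprnN.
  exact: (period_identity Om0 (det_om phi) cpl detOm dtE lE lamE).
(* At [psi] only the term of index [r psi] is nonzero. *)
pose V' psi := \sum_(i < d.+1) V i psi * ev psi sigma (Dm i).
have V'E psi (rr := r (ph psi) (rh psi)) : V' psi = V rr psi * ev psi sigma (Dm rr).
  have [rd Dm0 _] := key psi.
  rewrite /V' (bigD1 (Ordinal (rd : (rr < d.+1)%N))) //= big1 ?addr0 // => i ne.
  by rewrite Dm0 ?mulr0 //; apply: ltn_ord i.
have rat_V' : rational sigma V'.
  by apply: rational_sum => i; apply: rationalM => //; apply: rational_ev.
set B := (X in sim _ _ X).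
have cVB psi : c psi = V' psi * B psi by rewrite V'E; have [_ _] := key psi.
(* [period] includes the nonvanishing of c, which forces that of the right-hand side. *)
have B0 psi : B psi != 0.
  have [c0 _] := cE psi; apply: contraNneq c0 => B0.
  by rewrite cVB B0 mulr0.
apply: sim_rational => // [psi|]; first by have [] := cE psi.
by apply: eq_rational rat_V' => psi; rewrite cVB mulfK.
Qed.
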